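(* Let $0<\alpha<1$ and $\theta>-\alpha$. Let $(V_j)_{j\geq 1}$ be independent random variables with $V_j\sim\mathrm{beta}(1-\alpha,\theta+j\alpha)$, let $R_n=\prod_{j\leq n}(1-V_j)$, and for $\epsilon\in(0,1)$ let $\tau(\epsilon)=\min\{n\geq 1:\ R_n<\epsilon\}$. Then there is a random variable $T_{\alpha,\theta}$, defined on the same probability space as $(V_j)_{j\ge 1}$ and having density $f_{\alpha,\theta}(t)=\frac{\Gamma(\theta+1)}{\Gamma(\theta/\alpha+1)}\,t^{-\theta}f_\alpha(t)$, $t>0$, such that $$\tau(\epsilon)-1\ \sim_{a.s.}\ (\epsilon\, T_{\alpha,\theta}/\alpha)^{-\alpha/(1-\alpha)}\quad\text{as }\epsilon\to 0,$$ that is, the ratio of the two sides converges to $1$ almost surely as $\epsilon\to 0$.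
   Context: Here $f_\alpha$ denotes the density on $(0,\infty)$ of a positive stable random variable $T_\alpha$ with exponent $\alpha$, i.e. one with Laplace transform $\mathrm{E}(e^{-sT_\alpha})=e^{-s^\alpha}$ for $s\geq 0$. The law with density $f_{\alpha,\theta}$ is the polynomially tilted positive stable law. The distribution $\mathrm{beta}(a,b)$ has density proportional to $v^{a-1}(1-v)^{b-1}$ on $(0,1)$. The quantity $R_n=\sum_{i>n}p_i$ is the truncation error of the stick-breaking frequencies $p_i=V_i\prod_{j=1}^{i-1}(1-V_j)$ of the Pitman--Yor process with parameters $(\alpha,\theta)$, and $\tau(\epsilon)$ is the random truncation point. *)

(* Defs.v *)
From HB Require Import structures.
From mathcomp Require Import all_boot all_order all_algebra.
From mathcomp Require Import finmap.
From mathcomp Require Import all_classical all_reals all_analysis.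

Set Implicit Arguments.
Unset Strict Implicit.
Unset Printing Implicit Defensive.

Import Order.TTheory GRing.Theory Num.Theory.
Import numFieldNormedType.Exports.

Local Open Scope classical_set_scope.
Local Open Scope ring_scope.

(* [mu] is a law on the real line with density [f] on [D], hence carried by
   [D]; the values of [f] outside [D] are irrelevant. *)
Definition has_density_on (R : realType) (mu : probability R R)
    (D : set R) (f : R -> R) : Prop :=
  [/\ measurable_fun D f,
      forall x, D x -> 0 <= f x &
      forall A : set R, measurable A ->
        mu A = (\int[lebesgue_measure]_(x in A `&` D) (f x)%:E)%E].

Definition mutually_independent d (Omega : measurableType d) (R : realType)
    (P : probability Omega R) (I : choiceType) (D : set I)
    (X : I -> {RV P >-> R}) : Prop :=
  forall (J : {fset I}) (A : I -> set R),
    [set` J] `<=` D -> (forall i, measurable (A i)) ->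
    P (\bigcap_(i in [set` J]) (X i @^-1` A i)) =
    (\prod_(i <- J) P (X i @^-1` A i))%E.

(* For [a, b > 0]; the constant [c] is forced, since [mu] has mass 1. *)
Definition beta_law (R : realType) (a b : R) (mu : probability R R) : Prop :=
  exists c : R,
    has_density_on mu `]0, 1[ (fun v => c * (v `^ (a - 1) * (1 - v) `^ (b - 1))).

(* Euler's integral, meaningful for [a > 0]. *)
Definition Gamma (R : realType) (a : R) : R :=
  (\int[lebesgue_measure]_(t in `]0, +oo[) (t `^ (a - 1) * expR (- t)))%R.

Definition positive_stable_density (R : realType) (alpha : R) (f : R -> R) :
    Prop :=
  exists mu : probability R R,
    (forall s : R, 0 <= s ->
       'E_mu[fun t : R => expR (- (s * t))]%E = (expR (- (s `^ alpha)))%:E) /\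
    has_density_on mu `]0, +oo[ f.

Definition tilted_stable_density (R : realType) (alpha theta : R) (f : R -> R)
    (t : R) : R :=
  Gamma (theta + 1) / Gamma (theta / alpha + 1) * (t `^ (- theta) * f t).

Definition stick_remainder (R : realType) (v : nat -> R) (n : nat) : R :=
  \prod_(1 <= j < n.+1) (1 - v j).

(* The least [n >= 1] with [r n < eps]; the value 0 encodes that there is
   none. *)
Definition truncation_point (R : realType) (r : nat -> R) (eps : R) : nat :=
  if pselect (exists n, (1 <= n)%N && (r n < eps)) is left h then ex_minn h
  else 0%N.

(* Main.v *)
Require Import Defs.
From HB Require Import structures.
From mathcomp Require Import all_boot all_order all_algebra finmap.
From mathcomp Require Import all_classical all_reals all_analysis.
From mathcomp Require Import measurable_realfun ring lra.

(** The remainders decay like a power of [n], and the variable [T] is read off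
    from the constant of that power law.

    The remaining fractions [1 - V_j] are independent with beta laws of
    parameters [theta + j * alpha] and [1 - alpha], so the moments of
    [R_n ^ alpha] are products of Beta values.  Exponent and parameter step
    agree, hence these products telescope ([stick_ratioE]), and [k]-th moments
    of [Y_n = n ^ (1 - alpha) * (R_n / alpha) ^ alpha] converge to an explicit
    limit, [diversity_moment k] ([cvg_diversity_moment]).  Divided by its mean,
    [R_n ^ alpha] is a martingale [Z_n] bounded in mean square, with
    [E (Z_N - Z_n) ^ 2 = O (1 / n)] for [n <= N]
    ([normalized_stick_increment]).  Along [n = m ^ 4] its increments are
    therefore summable in mean and it converges almost surely; since [R_n] is
    monotone, the whole sequence [Y_n] then converges to some [Y]
    ([cvg_diversity]), and bounded second moments carry the moments to the
    limit ([expectation_diversity]).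

    On the other side, [t ^ (- alpha)] has the same moments under the tilted
    stable law ([tilted_stable_moment]): if [G] is exponential and independent
    of the stable variable [S], then [(G / S) ^ alpha] is exponential too, which
    gives the negative moments of [S].  The common moments grow slowly enough
    for all exponential moments to be finite, so that they determine the law
    ([moment_determination]).  Thus [Y] is distributed like [t ^ (- alpha)], and
    [T = Y ^ (- 1 / alpha)] has the required density.

    Finally [Y_n / Y] raised to the power [1 / (1 - alpha)] is
    [n * (R_n * T / alpha) ^ (alpha / (1 - alpha))], which thus tends to 1.  If
    [n + 1] is the truncation point of [eps], then [R_(n+1) < eps <= R_n], and
    the ratio in the theorem is squeezed between the values of this expression
    at [n + 1] and at [n], up to a factor [n / (n + 1)]
    ([cvg_truncation_point]).

    The facts about Euler's integrals behind the asymptotics of the moments, the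
    relation between Beta and Gamma and the growth of [Gamma (a + b) / Gamma a],
    follow from log-convexity as in the Bohr-Mollerup theorem. *)

Set Implicit Arguments.
Unset Strict Implicit.
Unset Printing Implicit Defensive.

Import Order.TTheory GRing.Theory Num.Theory.
Import numFieldNormedType.Exports.

Local Open Scope classical_set_scope.
Local Open Scope ring_scope.

(** * Measures with a density *)

Definition density {d} {T : measurableType d} {R : realType}
    (mu : {measure set T -> \bar R}) (h : T -> R)
    (mh : measurable_fun setT h) (h0 : forall x, 0 <= h x) (A : set T) :=
  (\int[mu]_(x in A) (h x)%:E)%E.

Section density_measure.
Local Open Scope ereal_scope.
Context {d} {T : measurableType d} {R : realType}.
Variables (mu : {measure set T -> \bar R}) (h : T -> R).
Variables (mh : measurable_fun setT h) (h0 : forall x, (0 <= h x)%R).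
Local Notation nu := (density mu mh h0).

Let density0 : nu set0 = 0.
Proof. by rewrite /density integral_set0. Qed.

Let density_ge0 A : 0 <= nu A.
Proof. by apply: integral_ge0 => x _; rewrite lee_fin. Qed.

Let density_sigma_additive : semi_sigma_additive nu.
Proof.
move=> F mF tF mUF; rewrite /density; apply: cvg_toP.
  apply: ereal_nondecreasing_is_cvgn => m n mn.
  by apply: lee_sum_nneg_natr => // k _ _; exact: density_ge0.
rewrite ge0_integral_bigcup//=.
- by apply/measurable_EFinP; exact: measurable_funTS.
- by move=> x _; rewrite lee_fin.
Qed.

HB.instance Definition _ := isMeasure.Build _ _ _
  nu density0 density_ge0 density_sigma_additive.

Import HBNNSimple.

Let integral_density_nnsfun (g : {nnsfun T >-> R}) :
  \int[nu]_x (g x)%:E = \int[mu]_x (g x * h x)%:E.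
Proof.
under [LHS]eq_integral do rewrite fimfunE -fsumEFin//.
rewrite [LHS]ge0_integral_fsum//; last 2 first.
  - by move=> r; exact/measurable_EFinP/measurableT_comp.
  - by move=> n x _; rewrite EFinM nnfun_muleindic_ge0.
under [RHS]eq_integral.
  move=> x _; rewrite EFinM fimfunE -fsumEFin// ge0_mule_fsuml; last first.
    by move=> r; rewrite EFinM nnfun_muleindic_ge0.
  over.
rewrite [RHS]ge0_integral_fsum//; last 2 first.
  - move=> r; apply: emeasurable_funM; last exact/measurable_EFinP.
    by apply/measurable_EFinP; exact/measurableT_comp.
  - move=> n x _; apply: mule_ge0; last by rewrite lee_fin.
    by rewrite EFinM nnfun_muleindic_ge0.
apply: eq_fsbigr => r _; rewrite integralZl_indic_nnsfun// integral_indic//.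
have [r0|r0] := ltP r 0%R.
  rewrite preimage_nnfun0//; under eq_integral do rewrite indic0 mulr0 mul0e.
  by rewrite integral0 setIT measure0 mule0.
under eq_integral do rewrite EFinM -muleA.
rewrite ge0_integralZl//; last 2 first.
  - by apply: emeasurable_funM; exact/measurable_EFinP.
  - by move=> x _; rewrite mule_ge0// lee_fin.
congr (_ * _); rewrite setIT /= /density [LHS]integral_mkcond.
by apply: eq_integral => x _; rewrite epatch_indic muleC.
Qed.

(** The defining identity of a density extends from indicators to nonnegative
    functions by approximation with simple functions. *)
Lemma ge0_integral_density (g : T -> \bar R) :
  measurable_fun setT g -> (forall x, 0 <= g x) ->
  \int[nu]_x g x = \int[mu]_x (g x * (h x)%:E).
Proof.
move=> mg g0; pose g_ := nnsfun_approx measurableT mg.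
transitivity (limn (fun n => \int[nu]_x (g_ n x)%:E)).
  rewrite -monotone_convergence//=.
  - apply: eq_integral => x _; apply/esym/cvg_lim => //=.
    by apply: cvg_nnsfun_approx => // y _; exact: g0.
  - by move=> n; exact/measurable_EFinP.
  - by move=> n x _; rewrite lee_fin.
  - by move=> x _ a b ab; rewrite lee_fin//; exact/lefP/nd_nnsfun_approx.
under eq_fun do rewrite integral_density_nnsfun.
rewrite -monotone_convergence//=.
- apply: eq_integral => x _; apply/cvg_lim => //=.
  under eq_fun do rewrite EFinM.
  apply: cvgeMr => //.
  by apply: cvg_nnsfun_approx => // y _; exact: g0.
- by move=> n; apply/measurable_EFinP/measurable_funM.
- by move=> n x _; rewrite lee_fin mulr_ge0.
- move=> x _ a b ab; rewrite lee_fin ler_wpM2r//; exact/lefP/nd_nnsfun_approx.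
Qed.

End density_measure.

(** Change of variables under the measure with density [h]: [nu] is the law of
    [X] there, without having to be given as an image measure. *)
Lemma ge0_integral_pushforward_density {d d'} {T : measurableType d}
    {T' : measurableType d'} {R : realType} (mu : {measure set T -> \bar R})
    (nu : {measure set T' -> \bar R}) (h : T -> R) (X : T -> T')
    (g : T' -> \bar R) :
  measurable_fun setT h -> (forall x, 0 <= h x) -> measurable_fun setT X ->
  (forall A, measurable A ->
     nu A = (\int[mu]_(x in X @^-1` A) (h x)%:E)%E) ->
  measurable_fun setT g -> (forall x, 0 <= g x)%E ->
  (\int[nu]_y g y = \int[mu]_x (g (X x) * (h x)%:E))%E.
Proof.
move=> mh h0 mX nuE mg g0.
pose X' : {mfun T >-> T'} := HB.pack X (isMeasurableFun.Build _ _ _ _ _ mX).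
rewrite (eq_measure_integral (pushforward (density mu mh h0) X'))//; last first.
  by move=> A mA _; rewrite nuE.
rewrite (ge0_integral_pushforward mX)// preimage_setT ge0_integral_density//.
  exact: measurableT_comp.
by move=> x; exact: g0.
Qed.

Lemma ge0_integral_has_density {R : realType} (mu : probability R R)
    (D : set R) (f : R -> R) (g : R -> \bar R) :
  measurable D -> has_density_on mu D f ->
  measurable_fun setT g -> (forall x, 0 <= g x)%E ->
  (\int[mu]_x g x = \int[lebesgue_measure]_(x in D) (g x * (f x)%:E))%E.
Proof.
move=> mD [mf f0 muE] mg g0.
rewrite (@ge0_integral_pushforward_density _ _ (measurableTypeR R) R R lebesgue_measure mu (f \_ D) idfun)//.
- rewrite [RHS]integral_mkcond.
  apply: eq_integral => x _; rewrite /patch; case: ifP => // _.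
  by rewrite mule0.
- exact/(measurable_restrictT f).
- by move=> x; apply: restrict_ge0.
- exact: measurable_id.
- move=> A mA; rewrite [LHS]muE//= integral_mkcondr.
  by apply: eq_integral => x _; rewrite /patch/=; case: ifP.
Qed.

(** * Integrals of powers and exponentials *)

Section improper_FTC.
Context {R : realType}.
Implicit Types (f F : R -> R) (l r Fl Fr : R).

(** The compact intervals on which the proper theorem applies exhaust the open
    one; since [f] is nonnegative its integral is the limit of theirs, even
    where [f] blows up at an endpoint. *)
Lemma ge0_FTC2_oo f F l r Fl Fr : l < r ->
  {in `]l, r[, continuous f} -> {in `]l, r[, forall x, 0 <= f x} ->
  {in `]l, r[, forall x, derivable F x 1} -> {in `]l, r[, derive1 F =1 f} ->
  F x @[x --> l^'+] --> Fl -> F x @[x --> r^'-] --> Fr ->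
  (\int[lebesgue_measure]_(x in `]l, r[) (f x)%:E = (Fr - Fl)%:E)%E.
Proof.
move=> lr cf f0 dF F'f Fl_cvg Fr_cvg.
pose h n : R := (r - l) / n.+3%:R.
have rl0 : 0 < r - l by rewrite subr_gt0.
have h0 n : 0 < h n by rewrite divr_gt0.
have hcvg : h n @[n --> \oo] --> (0 : R).
  rewrite -(mulr0 (r - l)); apply: cvgMr.
  rewrite (_ : (fun n => n.+3%:R^-1) = (fun n => harmonic (n + 2)%N)).
    by rewrite (cvg_shiftn 2); exact: cvg_harmonic.
  by apply/funext => n; rewrite addn2.
pose I n := `[l + h n, r - h n]%classic.
have hlt n : l + h n < r - h n.
  rewrite -subr_gt0 (_ : _ - _ = (r - l) * (n.+1%:R / n.+3%:R)).
    by rewrite mulr_gt0// divr_gt0.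
  rewrite /h; field.
  by rewrite gt_eqF// ltr_wpDr.
have Isub n : {subset `[l + h n, r - h n] <= `]l, r[}.
  move=> x; rewrite !in_itv/= => /andP[a b]; apply/andP; split.
    by apply: lt_le_trans a; rewrite ltrDl.
  by apply: (le_lt_trans b); rewrite gtrBl.
have UI : \bigcup_n I n = `]l, r[%classic.
  apply/seteqP; split => [x [n _ /=]|x /=]; first exact: Isub.
  rewrite in_itv/= => /andP[lx xr].
  have /cvgrPdist_lt/(_ (Num.min (x - l) (r - x))) := hcvg.
  rewrite lt_min !subr_gt0 lx xr => /(_ isT)[n _ /(_ n (leqnn n))].
  rewrite sub0r normrN gtr0_norm//= lt_min => /andP[h1 h2].
  exists n => //=; rewrite /I/= in_itv/=; apply/andP; split; lra.
have ndI : nondecreasing_seq I.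
  apply/nondecreasing_seqP => n; rewrite subsetEset /I => x /=.
  have hn : h n.+1 <= h n.
    by rewrite /h ler_pM2l// lef_pV2 ?posrE// ler_nat.
  rewrite !in_itv/= => /andP[a b]; apply/andP; split; lra.
have cI n : {within `[l + h n, r - h n], continuous f}.
  by apply: continuous_in_subspaceT => x /set_mem/= /Isub; exact: cf.
have mf n : measurable_fun (I n) (EFin \o f).
  apply/measurable_EFinP; apply: subspace_continuous_measurable_fun.
    exact: measurable_itv.
  exact: cI.
have : (\int[lebesgue_measure]_(x in I n) (f x)%:E)%E @[n --> \oo] -->
    (\int[lebesgue_measure]_(x in `]l, r[) (f x)%:E)%E.
  rewrite -UI; apply: ge0_nondecreasing_set_cvg_integral => //.
  - by move=> n; exact: measurable_itv.
  - by move=> n x /Isub; rewrite lee_fin; exact: f0.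
have -> : (fun n => \int[lebesgue_measure]_(x in I n) (f x)%:E)%E =
    (fun n => (F (r - h n) - F (l + h n))%:E).
  apply/funext => n; rewrite (@continuous_FTC2 _ f F)//.
  - have dFc x : x \in `[l + h n, r - h n] -> F y @[y --> x] --> F x.
      move=> /Isub/dF/derivable1_diffP; exact: differentiable_continuous.
    split.
    + move=> x /subset_itv_oo_cc; rewrite inE => /Isub; exact: dF.
    + by apply: cvg_at_right_filter; apply: dFc; rewrite in_itv/= lexx ltW.
    + by apply: cvg_at_left_filter; apply: dFc; rewrite in_itv/= lexx ltW.
  - by move=> x /subset_itv_oo_cc /[!inE] /Isub; exact: F'f.
move=> H; apply: (cvg_unique _ H) => //.
apply: cvg_EFin; first by near=> n.
apply: cvgB.
  move/cvg_at_leftP : Fr_cvg; apply; split => [n|].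
    by rewrite gtrBl.
  by rewrite -[X in _ --> X]subr0; apply: cvgB => //; exact: cvg_cst.
move/cvg_at_rightP : Fl_cvg; apply; split => [n|].
  by rewrite ltrDl.
by rewrite -[X in _ --> X]addr0; apply: cvgD => //; exact: cvg_cst.
Unshelve. all: by end_near. Qed.

End improper_FTC.

Section power_integrals.
Context {R : realType}.
Local Notation mu := lebesgue_measure.
Implicit Types (a b x u : R).

Lemma powR_continuous a x : 0 < x -> {for x, continuous (fun u : R => u `^ a)}.
Proof.
move=> x0; apply: differentiable_continuous; apply/derivable1_diffP.
by have [] := is_derive1_powR a x0.
Qed.

Lemma integral_powR a x : 0 < a -> 0 < x ->
  (\int[mu]_(u in `]0%R, x[) (a * u `^ (a - 1))%:E = (x `^ a)%:E)%E.
Proof.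
move=> a0 x0.
rewrite (@ge0_FTC2_oo R _ (fun u => u `^ a) 0 x 0 (x `^ a))//.
- by rewrite subr0.
- move=> u; rewrite in_itv/= => /andP[u0 _]; apply: cvgM.
    exact: cvg_cst.
  exact: powR_continuous.
- by move=> u _; rewrite mulr_ge0 ?powR_ge0// ltW.
- move=> u; rewrite in_itv/= => /andP[u0 _].
  by have [] := is_derive1_powR a u0.
- move=> u; rewrite in_itv/= => /andP[u0 _].
  by rewrite powR_derive1// in_itv/= u0.
- exact: powR_cvg0.
- by apply: cvg_at_left_filter; exact: powR_continuous.
Qed.

(** The lower end [u] stays free: as the inner integral of Tonelli's theorem
    this is a primitive of the second Beta factor. *)
Lemma integral_powR_onem b u : 0 < b -> u < 1 ->
  (\int[mu]_(v in `]u, 1%R[) (b * (1 - v) `^ (b - 1))%:E = ((1 - u) `^ b)%:E)%E.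
Proof.
move=> b0 u1.
have dF v : v \in `]u, 1[ ->
    is_derive v 1 (fun v => - (1 - v) `^ b) (b * (1 - v) `^ (b - 1)).
  rewrite in_itv/= => /andP[_ v1].
  have v0 : 0 < 1 - v by rewrite subr_gt0.
  have := is_derive1_powR b v0.
  move=> H.
  have H1 : is_derive v 1 (fun v : R => 1 - v) (-1).
    by apply: is_derive_eq; rewrite add0r mul1r.
  have H2 := @is_derive1_comp R (fun w => w `^ b) (fun v : R => 1 - v) v _ _ H H1.
  have := is_deriveN H2.
  by rewrite /= mulrN1 opprK.
rewrite (@ge0_FTC2_oo R _ (fun v => - (1 - v) `^ b) u 1 (- (1 - u) `^ b) 0)//.
- by rewrite sub0r opprK.
- move=> v; rewrite in_itv/= => /andP[_ v1]; apply: cvgM.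
    exact: cvg_cst.
  apply: (@continuous_comp _ _ _ (fun v : R => 1 - v) (fun w => w `^ (b - 1))).
    by apply: cvgB => //; exact: cvg_cst.
  by apply: powR_continuous; rewrite subr_gt0.
- by move=> v _; rewrite mulr_ge0 ?powR_ge0// ltW.
- by move=> v /dF[].
- by move=> v /dF H; rewrite derive1E derive_val.
- apply: cvg_at_right_filter; apply: cvgN.
  apply: (@continuous_comp _ _ _ (fun v : R => 1 - v) (fun w => w `^ b)).
    by apply: cvgB => //; exact: cvg_cst.
  by apply: powR_continuous; rewrite subr_gt0.
- rewrite -oppr0; apply: cvgN.
  apply/cvg_at_leftP => w [w1 wcvg].
  have /cvg_at_rightP := powR_cvg0 b0; apply; split => [n|].
    by rewrite subr_gt0.
  by rewrite -(subrr 1); apply: cvgB => //; exact: cvg_cst.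
Qed.

Lemma integral_expRN u :
  (\int[mu]_(v in `]u, +oo[) (expR (- v))%:E = (expR (- u))%:E)%E.
Proof.
have dF (v : R) : is_derive v 1 (fun v : R => - expR (- v)) (expR (- v)).
  by apply: is_derive_eq; rewrite mulrN1 opprK.
have cexp : continuous (fun v : R => expR (- v)).
  move=> v; apply: continuous_comp; last exact: continuous_expR.
  exact: continuousN.
rewrite integral_itv_obnd_cbnd; last first.
  apply/measurable_EFinP; apply: measurable_funTS.
  exact: continuous_measurable_fun.
rewrite (@ge0_continuous_FTC2y R _ (fun v => - expR (- v)) u 0)//.
- by rewrite sub0e -EFinN opprK.
- exact: continuous_subspaceT.
- by rewrite -oppr0; apply: cvgN; exact: cvgr_expR.
- by apply: cvg_at_right_filter; apply: cvgN; exact: cexp.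
- by move=> v _; rewrite derive1E derive_val.
Qed.

Lemma ge0_lebesgue_integralZl (D : set R) (f : R -> R) (k : R) :
  measurable D -> measurable_fun setT f -> (forall x, 0 <= f x) -> 0 <= k ->
  (k%:E * \int[mu]_(x in D) (f x)%:E = \int[mu]_(x in D) (k * f x)%:E)%E.
Proof.
move=> mD mf f0 k0; under [RHS]eq_integral do rewrite EFinM.
rewrite ge0_integralZl; [by []|exact: mD| | |by rewrite lee_fin].
  by apply/measurable_EFinP; exact: measurable_funTS.
by move=> x _; rewrite lee_fin.
Qed.

Lemma tonelli_lt (g h : R -> R) :
  measurable_fun setT g -> measurable_fun setT h ->
  (forall x, 0 <= g x) -> (forall x, 0 <= h x) ->
  (\int[mu]_v ((h v)%:E * \int[mu]_(u in `]-oo, v[) (g u)%:E) =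
   \int[mu]_u ((g u)%:E * \int[mu]_(v in `]u, +oo[) (h v)%:E))%E.
Proof.
move=> mg mh g0 h0.
pose T := measurableTypeR R.
pose f (z : T * T) : \bar R :=
  (g z.1 * h z.2 * (if z.1 < z.2 then 1 else 0 : R))%:E.
have mf : measurable_fun setT f.
  apply/measurable_EFinP; apply: measurable_funM.
    by apply: measurable_funM; exact: measurableT_comp.
  by apply: measurable_fun_ifT => //; apply: measurable_fun_ltr.
have f0 z : (0 <= f z)%E.
  by rewrite lee_fin !mulr_ge0//; case: ifP.
have swap := @fubini_tonelli _ _ T T R mu mu f mf f0.
apply: etrans (etrans _ (esym swap)) _.
  apply: eq_integral => v _.
  rewrite ge0_lebesgue_integralZl//.
  rewrite integral_mkcond; apply: eq_integral => u _.
  rewrite /patch /f/= mem_setE in_itv/=; case: ifP => _.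
    by rewrite mulr1 mulrC.
  by rewrite mulr0.
apply: eq_integral => u _.
rewrite ge0_lebesgue_integralZl//.
rewrite [RHS]integral_mkcond; apply: eq_integral => v _.
rewrite /patch /f/= mem_setE in_itv/= andbT; case: ifP => _.
  by rewrite mulr1.
by rewrite mulr0.
Qed.

End power_integrals.

Section tonelli_interval.
Context {R : realType}.
Local Notation mu := lebesgue_measure.

(** This form stands in for integration by parts: with primitives for the inner
    integrals, both sides become single integrals, and no finiteness is
    required. *)
Lemma tonelli_lt_itv (c : itv_bound R) (g h : R -> R) :
  measurable_fun setT g -> measurable_fun setT h ->
  (forall x, 0 <= g x) -> (forall x, 0 <= h x) ->
  (\int[mu]_(v in [set` Interval (BRight 0%R) c])
     ((h v)%:E * \int[mu]_(u in `]0%R, v[) (g u)%:E) =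
   \int[mu]_(u in [set` Interval (BRight 0%R) c])
     ((g u)%:E * \int[mu]_(v in [set` Interval (BRight u) c]) (h v)%:E))%E.
Proof.
move=> mg mh g0 h0; set D := [set` Interval _ c].
have mD : measurable D by exact: measurable_itv.
have mDg : measurable_fun setT (g \_ D).
  by apply/(measurable_restrictT g) => //; exact: measurable_funTS.
have mDh : measurable_fun setT (h \_ D).
  by apply/(measurable_restrictT h) => //; exact: measurable_funTS.
have Dg0 x : 0 <= (g \_ D) x by apply: restrict_ge0.
have Dh0 x : 0 <= (h \_ D) x by apply: restrict_ge0.
have tl := tonelli_lt mDg mDh Dg0 Dh0.
transitivity (\int[mu]_v ((h \_ D v)%:E * \int[mu]_(u in `]-oo, v[) (g \_ D u)%:E))%E.
  rewrite integral_mkcond; apply: eq_integral => v _.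
  rewrite {1 2}/patch; case: ifPn => [/set_mem Dv|_]; last by rewrite mul0e.
  congr (_ * _)%E.
  rewrite (_ : `]0%R, v[%classic = `]-oo, v[ `&` D).
    rewrite integral_mkcondr; apply: eq_integral => u _.
    by rewrite /patch; case: ifP.
  move: Dv; rewrite /D/= itv_boundlr => /andP[v0 vc].
  apply/seteqP; split => u /=; rewrite !itv_boundlr/=.
    move=> /andP[-> uv]; rewrite uv; split => //.
    by apply: le_trans vc; move: uv; rewrite !bnd_simp; exact: ltW.
  by move=> [-> /andP[-> _]].
rewrite tl [RHS]integral_mkcond; apply: eq_integral => u _.
rewrite {1 3}/patch; case: ifPn => [/set_mem Du|_]; last by rewrite mul0e.
congr (_ * _)%E.
rewrite (_ : [set` Interval (BRight u) c] = `]u, +oo[ `&` D).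
  rewrite integral_mkcondr; apply: eq_integral => v _.
  by rewrite /patch; case: ifP.
move: Du; rewrite /D/= itv_boundlr => /andP[u0 uc].
apply/seteqP; split => v /=; rewrite !itv_boundlr/=.
  move=> /andP[uv ->]; rewrite uv; split => //; rewrite andbT.
  by apply: le_trans uv; move: u0; rewrite !bnd_simp; exact: ltW.
by move=> [/andP[-> _] /andP[_ ->]].
Qed.

End tonelli_interval.

(** Bernoulli's inequality: a concave power lies below its tangent at 1. *)
Lemma powR_le_tangent {R : realType} (s x : R) : 0 <= s <= 1 -> 0 <= x ->
  x `^ s <= 1 - s + s * x.
Proof.
move=> /andP[s0 s1] x0.
have [->|sn0] := eqVneq s 0; first by rewrite powRr0 mul0r addr0 subr0.
have [->|sn1] := eqVneq s 1; first by rewrite powRr1// subrr add0r mul1r.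
have sp : 0 < s by rewrite lt_neqAle eq_sym sn0.
have sp1 : 0 < 1 - s by rewrite subr_gt0 lt_neqAle sn1.
(* Young's inequality for [x ^ s] and 1 with exponents [1 / s] and
   [1 / (1 - s)]. *)
have := @conjugate_powR R (x `^ s) 1 s^-1 (1 - s)^-1 (powR_ge0 _ _) ler01.
rewrite !invr_gt0 !invrK => /(_ sp sp1).
rewrite mulr1 powR1 -powRrM mulfV// powRr1// => H.
apply: le_trans (H _) _; first by ring.
by rewrite mul1r mulrC addrC.
Qed.

(** * Euler's Gamma and Beta integrals *)

Section Gamma_integral.
Context {R : realType}.
Local Notation mu := lebesgue_measure.
Implicit Types a s x : R.

Lemma measurable_powR_expRN a :
  measurable_fun setT (fun x : R => x `^ a * expR (- x)).
Proof.
apply: measurable_funM; first exact: measurable_powR.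
exact: (measurableT_comp (@measurable_expR R)).
Qed.

(* Extended-real values, because finiteness is a consequence of the functional
   equation. *)
Let GammaE a : \bar R :=
  (\int[mu]_(x in `]0%R, +oo[) (x `^ (a - 1) * expR (- x))%:E)%E.

Let GammaE_ge0 a : (0 <= GammaE a)%E.
Proof.
by apply: integral_ge0 => x _; rewrite lee_fin mulr_ge0 ?powR_ge0 ?expR_ge0.
Qed.

(* Integration by parts, as Tonelli on [0 < u < x] for [a u^(a-1) e^(-x)]. *)
Let GammaES a : 0 < a -> GammaE (a + 1) = (a%:E * GammaE a)%E.
Proof.
move=> a0.
have m1 : measurable_fun setT (fun x : R => a * x `^ (a - 1)).
  by apply: measurable_funM => //; exact: measurable_powR.
have m2 : measurable_fun setT (fun x : R => expR (- x)).
  exact: (measurableT_comp (@measurable_expR R)).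
have g0 (x : R) : 0 <= a * x `^ (a - 1) by rewrite mulr_ge0 ?powR_ge0// ltW.
have h0 (x : R) : 0 <= expR (- x) by exact: expR_ge0.
have tl := tonelli_lt_itv +oo%O m1 m2 g0 h0.
rewrite /GammaE ge0_lebesgue_integralZl ?(ltW a0)//; last 2 first.
- exact: measurable_powR_expRN.
- by move=> x; rewrite mulr_ge0 ?powR_ge0 ?expR_ge0.
transitivity (\int[mu]_(v in `]0%R, +oo[)
    ((expR (- v))%:E * \int[mu]_(u in `]0%R, v[) (a * u `^ (a - 1))%:E))%E.
  apply: eq_integral => v /set_mem/=; rewrite in_itv/= andbT => v0.
  by rewrite integral_powR// addrK -EFinM mulrC.
rewrite tl; apply: eq_integral => u _.
by rewrite integral_expRN -EFinM mulrA.
Qed.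

Let GammaE1 : GammaE 1 = 1%E.
Proof.
rewrite /GammaE -[RHS](_ : (expR (- 0))%:E = 1%E); last by rewrite oppr0 expR0.
rewrite -integral_expRN; apply: eq_integral => x _.
by rewrite subrr powRr0 mul1r.
Qed.

(* [x^s <= 1 - s + s x] bounds [Gamma (1 + s)] by a combination of
   [Gamma 1] and [Gamma 2]. *)
Let GammaE_lty_le1 s : 0 < s <= 1 -> (GammaE s < +oo)%E.
Proof.
move=> /andP[s0 s1].
have : (GammaE (s + 1) < +oo)%E.
  have m a : measurable_fun (`]0%R, +oo[%classic : set (measurableTypeR R))
      (fun x : R => (x `^ (a - 1) * expR (- x))%:E).
    by apply/measurable_EFinP; apply: measurable_funTS; exact: measurable_powR_expRN.
  apply: (@le_lt_trans _ _ ((1 - s)%:E * GammaE 1 + s%:E * GammaE (1 + 1))%E).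
    rewrite /GammaE -!ge0_integralZl//; last 4 first.
    - by move=> x _; rewrite lee_fin mulr_ge0 ?powR_ge0 ?expR_ge0.
    - by rewrite lee_fin ltW.
    - by move=> x _; rewrite lee_fin mulr_ge0 ?powR_ge0 ?expR_ge0.
    - by rewrite lee_fin subr_ge0.
    rewrite -ge0_integralD//; last 4 first.
    - by move=> x _; rewrite -EFinM lee_fin !mulr_ge0 ?subr_ge0 ?powR_ge0 ?expR_ge0.
    - exact: measurable_funeM.
    - by move=> x _; rewrite -EFinM lee_fin !mulr_ge0 ?powR_ge0 ?expR_ge0// ltW.
    - exact: measurable_funeM.
    apply: ge0_le_integral => //.
    - by move=> x _; rewrite lee_fin mulr_ge0 ?powR_ge0 ?expR_ge0.
    - by apply: emeasurable_funD; exact: measurable_funeM.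
    - move=> x /=; rewrite in_itv/= andbT => x0.
      rewrite -!EFinM -EFinD lee_fin subrr powRr0 mul1r !addrK (powRr1 (ltW x0)).
      rewrite mulrA -mulrDl ler_wpM2r ?expR_ge0//.
      by apply: powR_le_tangent; rewrite ltW.
  by rewrite GammaES// GammaE1 !mule1 -EFinD ltry.
rewrite GammaES//; have := GammaE_ge0 s; case: (GammaE s) => [r _ _|_|//].
  exact: ltry.
by rewrite gt0_muley.
Qed.

(* The functional equation reduces [a] to the interval between 0 and 1. *)
Let GammaE_lty a : 0 < a -> (GammaE a < +oo)%E.
Proof.
have [n] : exists n : nat, a <= n%:R.
  by exists (Num.truncn a).+1; rewrite ltW// truncnS_gt.
elim: n a => [|n IHn] a an a0; first by move: a0; rewrite ltNge an.
have [a1|a1] := leP a 1; first by apply: GammaE_lty_le1; rewrite a0.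
have a10 : 0 < a - 1 by rewrite subr_gt0.
rewrite -(subrK 1 a) GammaES//.
have /IHn/(_ a10) : a - 1 <= n%:R by rewrite lerBlDr natr1.
have := GammaE_ge0 (a - 1); case: (GammaE (a - 1)) => [r _ _|//|//].
by rewrite -EFinM ltry.
Qed.

Lemma integral_Gamma a : 0 < a ->
  (\int[mu]_(x in `]0%R, +oo[) (x `^ (a - 1) * expR (- x))%:E =
   (Gamma a)%:E)%E.
Proof.
move=> a0; rewrite /Gamma /Rintegral fineK// ge0_fin_numE; last exact: GammaE_ge0.
exact: GammaE_lty.
Qed.

Lemma GammaS a : 0 < a -> Gamma (a + 1) = a * Gamma a.
Proof.
move=> a0; apply: EFin_inj; rewrite EFinM -!integral_Gamma ?addr_gt0//.
exact: GammaES.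
Qed.

Lemma Gamma1 : Gamma 1 = 1 :> R.
Proof. by apply: EFin_inj; rewrite -integral_Gamma//; exact: GammaE1. Qed.

End Gamma_integral.

Section positive_integrals.
Context d (T : measurableType d) (R : realType).
Variables (mu : {measure set T -> \bar R}) (D : set T) (mD : measurable D).

Lemma integral_gt0 (f : T -> R) : mu D != 0%E ->
  measurable_fun D f -> (forall x, D x -> 0 < f x) ->
  (0 < \int[mu]_(x in D) (f x)%:E)%E.
Proof.
move=> muD mf f0; rewrite lt0e integral_ge0 ?andbT; last first.
  by move=> x /f0 /ltW; rewrite lee_fin.
apply/eqP => f_eq0; move/eqP: muD; apply.
have /(ae_eq_integral_abs mu mD) [H _] : measurable_fun D (EFin \o f).
  exact/measurable_EFinP.
apply: measure_negligible => //.
have /H : (\int[mu]_(x in D) `|(EFin \o f) x| = 0)%E.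
  rewrite -[RHS]f_eq0; apply: eq_integral => x /set_mem /f0 fx.
  by rewrite /= ger0_norm// ltW.
move=> H1; apply: (negligibleS _ H1) => x Dx /= /(_ Dx) [] fx0.
by have := f0 x Dx; rewrite fx0 ltxx.
Qed.

End positive_integrals.

Section powR_moment.
Context d (T : measurableType d) (R : realType).
Variables (mu : {measure set T -> \bar R}) (D : set T) (mD : measurable D).

(** Log-convexity of moments between exponents 0 and 1: integrate the tangent
    inequality at the mean [B / A]. *)
Lemma powR_moment_le (w X : T -> R) (A B s : R) :
  measurable_fun D w -> (forall x, D x -> 0 <= w x) ->
  measurable_fun D X -> (forall x, D x -> 0 <= X x) -> 0 <= s <= 1 ->
  0 < A -> 0 < B ->
  (\int[mu]_(x in D) (w x)%:E = A%:E)%E ->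
  (\int[mu]_(x in D) (w x * X x)%:E = B%:E)%E ->
  (\int[mu]_(x in D) (w x * X x `^ s)%:E <= (A `^ (1 - s) * B `^ s)%:E)%E.
Proof.
move=> mw w0 mX X0 s01 A0 B0 wA wB; have /andP[s0 s1] := s01.
have [rho rhoE] : {rho | rho = B / A} by exists (B / A).
have rho0 : 0 < rho by rewrite rhoE divr_gt0.
have c10 : 0 <= rho `^ s * (1 - s) by rewrite mulr_ge0 ?powR_ge0 ?subr_ge0.
have c20 : 0 <= rho `^ s * s / rho.
  by rewrite divr_ge0 ?mulr_ge0 ?powR_ge0// ltW.
have wX0 x : D x -> 0 <= w x * X x by move=> Dx; rewrite mulr_ge0 ?w0 ?X0.
have mwE : measurable_fun D (fun x => (w x)%:E) by exact/measurable_EFinP.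
have mwXE : measurable_fun D (fun x => (w x * X x)%:E).
  exact/measurable_EFinP/measurable_funM.
apply: (@le_trans _ _ (\int[mu]_(x in D) ((rho `^ s * (1 - s))%:E * (w x)%:E +
    (rho `^ s * s / rho)%:E * (w x * X x)%:E))%E).
  apply: ge0_le_integral => //.
  - by move=> x Dx; rewrite lee_fin mulr_ge0 ?powR_ge0 ?w0.
  - apply/measurable_EFinP/measurable_funM => //.
    by apply: (measurableT_comp (@measurable_powR R s)).
  - by apply: emeasurable_funD; exact: measurable_funeM.
  - move=> x Dx; rewrite -!EFinM -EFinD lee_fin.
    have -> : X x = rho * (X x / rho) by rewrite mulrCA mulfV ?mulr1// gt_eqF.
    rewrite (powRM s (ltW rho0)); last by rewrite divr_ge0 ?X0// ltW.
    have := @powR_le_tangent R s (X x / rho) s01.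
    move=> /(_ (divr_ge0 (X0 _ Dx) (ltW rho0))) tg.
    rewrite (_ : rho `^ s * (1 - s) * w x + _ =
        w x * (rho `^ s * (1 - s + s * (X x / rho)))).
      by rewrite ler_wpM2l ?w0// ler_wpM2l ?powR_ge0.
    by field; rewrite gt_eqF.
rewrite ge0_integralD//; last 4 first.
- by move=> x Dx; rewrite -EFinM lee_fin mulr_ge0 ?w0.
- exact: measurable_funeM.
- by move=> x Dx; rewrite -EFinM lee_fin mulr_ge0 ?wX0.
- exact: measurable_funeM.
rewrite !ge0_integralZl//; try by [|move=> x Dx; rewrite lee_fin ?w0 ?wX0].
rewrite wA wB -!EFinM -EFinD lee_fin.
rewrite (_ : _ + _ = rho `^ s * A); last first.
  by rewrite rhoE; field; rewrite !gt_eqF.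
rewrite rhoE powRM ?invr_ge0 ?(ltW A0) ?(ltW B0)// -(powR_inv1 (ltW A0)) -powRrM mulN1r powRN.
rewrite (_ : A `^ (1 - s) = A / A `^ s); last first.
  by rewrite powRB ?powRr1 ?(ltW A0)// (gt_eqF A0) implybT.
have -> : B `^ s / A `^ s * A = A / A `^ s * B `^ s by field; rewrite gt_eqF ?powR_gt0.
exact: lexx.
Qed.

End powR_moment.

(** Convexity of the logarithm, compared only at the two ends of a unit step:
    the recurrence of the Gamma function gives access to these. *)
Definition step_log_convex {R : realType} (F : R -> R) :=
  forall x s : R, 0 < x -> 0 <= s <= 1 ->
    F (x + s) <= F x `^ (1 - s) * F (x + 1) `^ s.

Section Beta_integral.
Context {R : realType}.
Local Notation mu := lebesgue_measure.
Implicit Types a b s x : R.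

Lemma Gamma_gt0 a : 0 < a -> 0 < Gamma a.
Proof.
move=> a0; rewrite -lte_fin -integral_Gamma//; apply: integral_gt0 => //=.
- by rewrite lebesgue_measure_itv/= ltry.
- by apply: measurable_funTS; exact: measurable_powR_expRN.
- by move=> x; rewrite in_itv/= andbT => x0; rewrite mulr_gt0 ?powR_gt0 ?expR_gt0.
Qed.

(** Moments of the measure with density [u ^ (x - 1) * exp (- u)]. *)
Lemma Gamma_log_convex : step_log_convex (@Gamma R).
Proof.
move=> x s x0 s01; have /andP[s0 s1] := s01.
have xs0 : 0 < x + s by rewrite ltr_wpDr.
have x10 : 0 < x + 1 by rewrite addr_gt0.
rewrite -lee_fin -integral_Gamma//.
pose w (u : R) := u `^ (x - 1) * expR (- u).
rewrite [leLHS](_ : _ = \int[mu]_(u in `]0%R, +oo[) (w u * u `^ s)%:E)%E.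
  apply: powR_moment_le => //.
  - by apply: measurable_funTS; exact: measurable_powR_expRN.
  - by move=> u _; rewrite mulr_ge0 ?powR_ge0 ?expR_ge0.
  - by move=> u /=; rewrite in_itv/= andbT => /ltW.
  - exact: Gamma_gt0.
  - exact: Gamma_gt0.
  - exact: integral_Gamma.
  - rewrite -integral_Gamma//; apply: eq_integral => u /set_mem/=.
    rewrite in_itv/= andbT => u0; rewrite /w addrK mulrAC.
    by rewrite (mulrC _ u) mulr_powRB1// ltW.
apply: eq_integral => u /set_mem/=; rewrite in_itv/= andbT => u0.
by rewrite /w mulrAC -powRD ?(gt_eqF u0) ?implybT// addrAC.
Qed.

Definition Beta a b : R :=
  (\int[mu]_(v in `]0, 1[) (v `^ (a - 1) * (1 - v) `^ (b - 1)))%R.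

Lemma measurable_onem_powR b : measurable_fun setT (fun v : R => (1 - v) `^ b).
Proof.
apply: (measurableT_comp (@measurable_powR R b)).
exact: measurable_funB.
Qed.

Lemma measurable_beta_kernel a b :
  measurable_fun setT (fun v : R => v `^ a * (1 - v) `^ b).
Proof.
by apply: measurable_funM; [exact: measurable_powR|exact: measurable_onem_powR].
Qed.

Let BetaE a b : \bar R :=
  (\int[mu]_(v in `]0%R, 1%R[) (v `^ (a - 1) * (1 - v) `^ (b - 1))%:E)%E.

Let BetaE_ge0 a b : (0 <= BetaE a b)%E.
Proof.
by apply: integral_ge0 => x _; rewrite lee_fin mulr_ge0 ?powR_ge0.
Qed.

Let mBE a b : measurable_fun (`]0%R, 1%R[%classic : set (measurableTypeR R))
  (fun v : R => (v `^ a * (1 - v) `^ b)%:E).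
Proof.
by apply/measurable_EFinP; apply: measurable_funTS; exact: measurable_beta_kernel.
Qed.

(* Integration by parts, as Tonelli on [0 < u < v < 1] for
   [a u^(a-1) b (1-v)^(b-1)]. *)
Let BetaE_parts a b : 0 < a -> 0 < b ->
  (b%:E * BetaE (a + 1) b = a%:E * BetaE a (b + 1))%E.
Proof.
move=> a0 b0.
have m1 : measurable_fun setT (fun x : R => a * x `^ (a - 1)).
  by apply: measurable_funM => //; exact: measurable_powR.
have m2 : measurable_fun setT (fun v : R => b * (1 - v) `^ (b - 1)).
  by apply: measurable_funM => //; exact: measurable_onem_powR.
have g0 (x : R) : 0 <= a * x `^ (a - 1) by rewrite mulr_ge0 ?powR_ge0// ltW.
have h0 (x : R) : 0 <= b * (1 - x) `^ (b - 1) by rewrite mulr_ge0 ?powR_ge0// ltW.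
have tl := tonelli_lt_itv (BLeft 1) m1 m2 g0 h0.
have pull (k c e : R) : 0 < k ->
    (k%:E * \int[mu]_(v in `]0%R, 1%R[) (v `^ c * (1 - v) `^ e)%:E =
     \int[mu]_(v in `]0%R, 1%R[) (k * (v `^ c * (1 - v) `^ e))%:E)%E.
  move=> k0; apply: (@ge0_lebesgue_integralZl R _ (fun v => v `^ c * (1 - v) `^ e)).
  - exact: measurable_itv.
  - exact: measurable_beta_kernel.
  - by move=> v; rewrite mulr_ge0 ?powR_ge0.
  - exact: ltW.
rewrite /BetaE (pull b _ _ b0) (pull a _ _ a0).
transitivity (\int[mu]_(v in `]0%R, 1%R[) ((b * (1 - v) `^ (b - 1))%:E *
    \int[mu]_(u in `]0%R, v[) (a * u `^ (a - 1))%:E))%E.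
  apply: eq_integral => v /set_mem/=; rewrite in_itv/= => /andP[v0 _].
  by rewrite (integral_powR a0 v0) addrK -EFinM [X in b * X]mulrC mulrA.
rewrite tl; apply: eq_integral => u /set_mem/=; rewrite in_itv/= => /andP[_ u1].
by rewrite (integral_powR_onem b0 u1) addrK -EFinM mulrA.
Qed.

Let BetaE_split a b : (BetaE (a + 1) b + BetaE a (b + 1) = BetaE a b)%E.
Proof.
rewrite /BetaE -ge0_integralD//; last 2 first.
- by move=> x _; rewrite lee_fin mulr_ge0 ?powR_ge0.
- by move=> x _; rewrite lee_fin mulr_ge0 ?powR_ge0.
apply: eq_integral => v /set_mem/=; rewrite in_itv/= => /andP[v0 v1].
rewrite -EFinD !addrK; congr EFin.
have p (x c : R) : 0 < x -> x `^ c = x * x `^ (c - 1).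
  move=> x0; rewrite -[X in X * _](powRr1 (ltW x0)) -powRD; last first.
    by rewrite (gt_eqF x0) implybT.
  by rewrite addrC subrK.
by rewrite (p v a)// (p (1 - v) b) ?subr_gt0//; ring.
Qed.

Let BetaE1 b : 0 < b -> BetaE 1 b = (b^-1)%:E.
Proof.
move=> b0; rewrite /BetaE.
have -> : (b^-1)%:E = (b^-1%:E * ((1 - 0) `^ b)%:E)%E.
  by rewrite subr0 powR1 mule1.
rewrite -integral_powR_onem// ge0_lebesgue_integralZl ?invr_ge0 ?ltW//; last 2 first.
- by apply: measurable_funM => //; exact: measurable_onem_powR.
- by move=> x; rewrite mulr_ge0 ?powR_ge0 ?ltW.
apply: eq_integral => v _; rewrite subrr powRr0 mul1r mulrA mulVf ?mul1r//.
by rewrite gt_eqF.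
Qed.

(* [BetaE_parts] and [BetaE_split] are two linear equations between the values
   at [(a + 1, b)], [(a, b + 1)] and [(a, b)]. *)
Let BetaE_rec a b : 0 < a -> 0 < b ->
  BetaE a b = ((1 + b / a)%:E * BetaE (a + 1) b)%E.
Proof.
move=> a0 b0; rewrite -BetaE_split EFinD ge0_muleDl ?lee_fin//; last first.
  by rewrite divr_ge0 ?ltW.
rewrite mul1e; congr (_ + _)%E.
have -> : (BetaE a (b + 1) = a^-1%:E * (a%:E * BetaE a (b + 1)))%E.
  by rewrite muleA -EFinM mulVf ?mul1e// gt_eqF.
by rewrite -BetaE_parts// muleA -EFinM mulrC.
Qed.

(* After one step of the recurrence the exponent of [v] is positive, which makes
   the integrand at most that of [BetaE 1 b]. *)
Let BetaE_lty a b : 0 < a -> 0 < b -> (BetaE a b < +oo)%E.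
Proof.
move=> a0 b0; rewrite BetaE_rec//.
have : (BetaE (a + 1) b < +oo)%E.
  apply: (@le_lt_trans _ _ (BetaE 1 b)); last by rewrite BetaE1// ltry.
  apply: ge0_le_integral => //.
  - by move=> x _; rewrite lee_fin mulr_ge0 ?powR_ge0.
  - move=> v /=; rewrite in_itv/= => /andP[v0 v1].
    rewrite lee_fin ler_wpM2r ?powR_ge0// addrK subrr powRr0.
    have : v `^ a <= 1 `^ a by apply: ge0_ler_powR; rewrite ?nnegrE ltW.
    by rewrite powR1.
have := BetaE_ge0 (a + 1) b; case: (BetaE (a + 1) b) => [r _ _|//|//].
by rewrite -EFinM ltry.
Qed.

Lemma integral_Beta a b : 0 < a -> 0 < b ->
  (\int[mu]_(v in `]0%R, 1%R[) (v `^ (a - 1) * (1 - v) `^ (b - 1))%:E =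
   (Beta a b)%:E)%E.
Proof.
move=> a0 b0; rewrite /Beta /Rintegral fineK// ge0_fin_numE; last exact: BetaE_ge0.
exact: BetaE_lty.
Qed.

Lemma Beta_gt0 a b : 0 < a -> 0 < b -> 0 < Beta a b.
Proof.
move=> a0 b0; rewrite -lte_fin -integral_Beta//; apply: integral_gt0 => //=.
- by rewrite lebesgue_measure_itv/= lte_fin ltr01 -EFinB subr0 eqe oner_eq0.
- by apply: measurable_funTS; exact: measurable_beta_kernel.
- move=> v; rewrite in_itv/= => /andP[v0 v1].
  by rewrite mulr_gt0 ?powR_gt0 ?subr_gt0.
Qed.

Lemma Beta1 b : 0 < b -> Beta 1 b = b^-1.
Proof. by move=> b0; apply: EFin_inj; rewrite -integral_Beta//; exact: BetaE1. Qed.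

Lemma BetaS a b : 0 < a -> 0 < b -> Beta (a + 1) b = a / (a + b) * Beta a b.
Proof.
move=> a0 b0; have ab0 : 0 < a + b by rewrite addr_gt0.
have -> : Beta a b = (1 + b / a) * Beta (a + 1) b.
  apply: EFin_inj; rewrite EFinM -!integral_Beta ?addr_gt0//.
  exact: BetaE_rec.
by field; rewrite !gt_eqF.
Qed.

Lemma Beta_log_convex b : 0 < b -> step_log_convex (fun a => Beta a b).
Proof.
move=> b0 x s x0 s01; have /andP[s0 s1] := s01.
have xs0 : 0 < x + s by rewrite ltr_wpDr.
have x10 : 0 < x + 1 by rewrite addr_gt0.
rewrite -lee_fin -integral_Beta//.
pose w (v : R) := v `^ (x - 1) * (1 - v) `^ (b - 1).
rewrite [leLHS](_ : _ = \int[mu]_(v in `]0%R, 1%R[) (w v * v `^ s)%:E)%E.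
  apply: powR_moment_le => //.
  - by apply: measurable_funTS; exact: measurable_beta_kernel.
  - by move=> v _; rewrite mulr_ge0 ?powR_ge0.
  - by move=> v /=; rewrite in_itv/= => /andP[/ltW].
  - exact: Beta_gt0.
  - exact: Beta_gt0.
  - exact: integral_Beta.
  - rewrite -integral_Beta//; apply: eq_integral => v /set_mem/=.
    rewrite in_itv/= => /andP[v0 _]; rewrite /w addrK mulrAC.
    by rewrite (mulrC _ v) mulr_powRB1// ltW.
apply: eq_integral => v /set_mem/=; rewrite in_itv/= => /andP[v0 _].
by rewrite /w mulrAC -powRD ?(gt_eqF v0) ?implybT// addrAC.
Qed.

End Beta_integral.

(** * Functions characterised by log-convexity *)

Section Bohr_Mollerup.
Context {R : realType}.
Implicit Types (F G : R -> R) (x s : R).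

(** The functions characterised by the Bohr-Mollerup theorem, up to a
    constant factor. *)
Definition Gamma_like F := [/\ forall x, 0 < x -> 0 < F x, step_log_convex F &
  forall x, 0 < x -> F (x + 1) = x * F x].

Lemma Gamma_like_upper F x s : Gamma_like F -> 0 < x -> 0 <= s <= 1 ->
  F (x + s) <= x `^ s * F x.
Proof.
move=> [F0 Flc Frec] x0 s01; apply: le_trans (Flc _ _ x0 s01) _.
have Fx0 := F0 _ x0; rewrite Frec// (powRM s (ltW x0) (ltW Fx0)) mulrCA.
rewrite -powRD; last by rewrite subrK oner_eq0.
by rewrite subrK (powRr1 (ltW Fx0)).
Qed.

(** The upper bound at [x + s] with the complementary step [1 - s], which also
    ends at [x + 1]. *)
Lemma Gamma_like_lower F x s : Gamma_like F -> 0 < x -> 0 <= s <= 1 ->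
  x `^ s * F x * x <= (x + 1) * F (x + s).
Proof.
move=> HF x0 s01; have [F0 _ Frec] := HF; have /andP[s0 s1] := s01.
have xs0 : 0 < x + s by rewrite ltr_wpDr.
have s01' : 0 <= 1 - s <= 1 by rewrite subr_ge0 s1 lerBlDr lerDl.
have H := Gamma_like_upper HF xs0 s01'.
rewrite -mulrA (mulrC (F x)) -Frec//.
have -> : F (x + 1) = F (x + s + (1 - s)) by congr F; ring.
apply: (@le_trans _ _ (x `^ s * ((x + s) `^ (1 - s) * F (x + s)))).
  by rewrite ler_wpM2l ?powR_ge0.
rewrite mulrA ler_wpM2r ?(ltW (F0 _ xs0))//.
have x10 : 0 < x + 1 by rewrite addr_gt0.
have -> : x + 1 = (x + 1) `^ s * (x + 1) `^ (1 - s).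
  by rewrite -powRD ?(gt_eqF x10) ?implybT// subrKC (powRr1 (ltW x10)).
apply: ler_pM; rewrite ?powR_ge0//.
  by apply: ge0_ler_powR; rewrite ?nnegrE ?(ltW x0) ?(ltW x10) ?lerDl.
by apply: ge0_ler_powR; rewrite ?nnegrE ?(ltW xs0) ?(ltW x10) ?lerD2l ?subr_ge0.
Qed.

(* The quotient [F / G] has period 1. *)
Let cross F G x n : Gamma_like F -> Gamma_like G -> 0 < x ->
  F x * G (x + n%:R) = G x * F (x + n%:R).
Proof.
move=> [_ _ Frec] [_ _ Grec] x0; elim: n => [|n IHn].
  by rewrite addr0 mulrC.
have xn0 : 0 < x + n%:R by rewrite ltr_wpDr.
by rewrite -natr1 addrA Frec// Grec// mulrCA IHn mulrCA.
Qed.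

(* By periodicity the quotients are compared at [n + 1 + s], where the two bounds
   above confine both functions up to a factor [(n + 2) / (n + 1)]. *)
Let unit_le F G s : Gamma_like F -> Gamma_like G -> 0 < s <= 1 ->
  F s * G 1 <= G s * F 1.
Proof.
move=> HF HG /andP[s0 s1]; have [F0 _ _] := HF; have [G0 _ _] := HG.
have s01 : 0 <= s <= 1 by rewrite ltW.
suff H n : F s * G 1 * n.+1%:R <= G s * F 1 * n.+2%:R.
  apply/ler_addgt0Pr => e e0.
  have Gs0 : 0 < G s * F 1 by rewrite mulr_gt0 ?G0 ?F0.
  pose n := Num.truncn (G s * F 1 / e).
  have ne : G s * F 1 <= e * n.+1%:R.
    by rewrite [leRHS]mulrC -ler_pdivrMr// ltW// truncnS_gt.
  have := H n; rewrite -(natr1 n.+1) mulrDr mulr1 => Hn.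
  have n0 : 0 < n.+1%:R :> R by [].
  rewrite -(ler_pM2r n0) mulrDl; apply: le_trans Hn _.
  by rewrite lerD2l.
have n0 : 0 < n.+1%:R :> R by [].
have Gn0 := G0 _ n0; have Fn0 := F0 _ n0.
have ns0 : 0 < n.+1%:R + s by rewrite addr_gt0.
have c1 := cross n.+1 HF HG s0; rewrite (addrC s) in c1.
have c2 := cross n HG HF ltr01; rewrite nat1r in c2.
have up := Gamma_like_upper HF n0 s01.
have lo := Gamma_like_lower HG n0 s01.
rewrite natr1 in lo.
have p0 : 0 < n.+1%:R `^ s :> R by rewrite powR_gt0.
rewrite -(ler_pM2r (mulr_gt0 p0 Gn0)).
have E1 : F s * G 1 * n.+1%:R * (n.+1%:R `^ s * G n.+1%:R) =
  (F s * G 1) * (n.+1%:R `^ s * G n.+1%:R * n.+1%:R) by ring.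
have E2 : G s * F 1 * n.+2%:R * (n.+1%:R `^ s * G n.+1%:R) =
  G 1 * n.+2%:R * (G s * (n.+1%:R `^ s * F n.+1%:R)).
  transitivity (F 1 * G n.+1%:R * (G s * n.+2%:R * n.+1%:R `^ s)); first by ring.
  by rewrite -c2; ring.
rewrite E1 E2.
apply: (@le_trans _ _ (F s * G 1 * (n.+2%:R * G (n.+1%:R + s)))).
  by rewrite ler_wpM2l// mulr_ge0// ltW ?F0 ?G0.
have -> : F s * G 1 * (n.+2%:R * G (n.+1%:R + s)) =
    G 1 * n.+2%:R * (F s * G (n.+1%:R + s)) by ring.
rewrite c1 ler_wpM2l//; first by rewrite mulr_ge0// ltW ?G0.
by rewrite ler_wpM2l// ltW ?G0.
Qed.

Lemma Bohr_Mollerup F G x : Gamma_like F -> Gamma_like G -> 0 < x ->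
  F x * G 1 = G x * F 1.
Proof.
move=> HF HG; have [_ _ Frec] := HF; have [_ _ Grec] := HG.
have [n] : exists n : nat, x <= n%:R.
  by exists (Num.truncn x).+1; rewrite ltW// truncnS_gt.
elim: n x => [|n IHn] x xn x0; first by move: x0; rewrite ltNge xn.
have [x1|x1] := leP x 1.
  have x01 : 0 < x <= 1 by rewrite x0.
  by apply/eqP; rewrite eq_le !unit_le.
have x10 : 0 < x - 1 by rewrite subr_gt0.
have /IHn/(_ x10) H : x - 1 <= n%:R by rewrite lerBlDr natr1.
by rewrite -(subrK 1 x) Frec// Grec// -!mulrA H.
Qed.

Lemma Gamma_like_Gamma : Gamma_like (@Gamma R).
Proof.
by split; [exact: Gamma_gt0|exact: Gamma_log_convex|exact: GammaS].
Qed.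

Lemma step_log_convexM F G :
  (forall x, 0 < x -> 0 < F x) -> (forall x, 0 < x -> 0 < G x) ->
  step_log_convex F -> step_log_convex G ->
  step_log_convex (fun x => F x * G x).
Proof.
move=> F0 G0 HF HG x s x0 s01; have /andP[s0 _] := s01.
have xs0 : 0 < x + s by rewrite ltr_wpDr.
have x10 : 0 < x + 1 by rewrite addr_gt0.
rewrite (powRM _ (ltW (F0 _ x0)) (ltW (G0 _ x0))).
rewrite (powRM _ (ltW (F0 _ x10)) (ltW (G0 _ x10))) mulrACA.
by apply: ler_pM; rewrite ?(ltW (F0 _ xs0)) ?(ltW (G0 _ xs0)) ?HF ?HG.
Qed.

Lemma step_log_convex_shift F b : 0 <= b -> step_log_convex F ->
  step_log_convex (fun x => F (x + b)).
Proof.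
move=> b0 HF x s x0 s01; have xb0 : 0 < x + b by rewrite ltr_wpDr.
by rewrite (addrAC x s) (addrAC x 1); exact: HF.
Qed.

(** Both sides are functions of [a] to which the Bohr-Mollerup theorem
    applies. *)
Lemma Beta_Gamma (a b : R) : 0 < a -> 0 < b ->
  Beta a b * Gamma (a + b) = Gamma a * Gamma b.
Proof.
move=> a0 b0.
have HF : Gamma_like (fun a => Beta a b * Gamma (a + b)).
  split=> [x x0| |x x0].
  - by rewrite mulr_gt0 ?Beta_gt0 ?Gamma_gt0 ?addr_gt0.
  - apply: step_log_convexM.
    + by move=> x x0; exact: Beta_gt0.
    + by move=> x x0; rewrite Gamma_gt0 ?addr_gt0.
    + exact: Beta_log_convex.
    + by apply: step_log_convex_shift; [exact: ltW|exact: Gamma_log_convex].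
  - have xb0 : 0 < x + b by rewrite addr_gt0.
    rewrite (BetaS x0 b0) (addrAC x 1) (GammaS xb0) mulrA.
    move: (Beta x b) (Gamma (x + b)) => B G; field.
    by rewrite gt_eqF.
have := Bohr_Mollerup HF Gamma_like_Gamma a0.
rewrite Gamma1 mulr1 (Beta1 b0) (addrC 1) (GammaS b0) mulKf.
  by [].
by rewrite gt_eqF.
Qed.

(** [Beta a b] behaves like [Gamma b / a ^ b] for large [a]: this is the growth
    of [Gamma (a + b) / Gamma a], by the bounds for functions like Gamma. *)
Lemma Beta_bounds (a b : R) : 0 < a -> 0 < b <= 1 ->
  Gamma b <= a `^ b * Beta a b <= Gamma b * (1 + a^-1).
Proof.
move=> a0 /andP[b0 b1]; have b01 : 0 <= b <= 1 by rewrite ltW.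
have up := Gamma_like_upper Gamma_like_Gamma a0 b01.
have lo := Gamma_like_lower Gamma_like_Gamma a0 b01.
have G0 : 0 < Gamma (a + b) by rewrite Gamma_gt0// addr_gt0.
have Gb0 := Gamma_gt0 b0; have := Beta_Gamma a0 b0; move: up lo G0 Gb0.
move: (Gamma a) (Gamma b) (Gamma (a + b)) (Beta a b) => Ga Gb Gab B.
move=> up lo G0 Gb0 BG.
have E : a `^ b * B * Gab = Gb * (a `^ b * Ga) by rewrite -mulrA BG; ring.
apply/andP; split; rewrite -(ler_pM2r G0) E.
  by rewrite ler_pM2l.
rewrite -mulrA ler_pM2l// -(ler_pM2r a0); apply: le_trans lo _.
by rewrite le_eqVlt; apply/orP; left; apply/eqP; field; rewrite gt_eqF.
Qed.

End Bohr_Mollerup.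

(** * Laws determined by their moments *)

Lemma mem_preimage_itvoy {T : Type} {R : realType} (X : T -> R) (c : R) z :
  (z \in X @^-1` `]c, +oo[) = (c < X z).
Proof.
apply/idP/idP => [/set_mem/=|cX]; first by rewrite in_itv/= andbT.
by apply/mem_set; rewrite /= in_itv/= cX.
Qed.

Section exponential_series.
Context {R : realType}.
Implicit Types (x z : R).

Lemma cvg_series_exp_coeff x : series (exp_coeff x) @ \oo --> expR x.
Proof. exact: is_cvg_series_exp_coeff. Qed.

Lemma nondecreasing_series_exp_coeff x : 0 <= x ->
  nondecreasing_seq (series (exp_coeff x)).
Proof.
move=> x0; apply: nondecreasing_series => n _ _.
exact: exp_coeff_ge0.
Qed.

Lemma series_exp_coeff_le x n : 0 <= x -> series (exp_coeff x) n <= expR x.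
Proof.
move=> x0; apply: nondecreasing_cvgn_le.
  exact: nondecreasing_series_exp_coeff.
exact: is_cvg_series_exp_coeff.
Qed.

Lemma normr_series_exp_coeffN x n : 0 <= x ->
  `|series (exp_coeff (- x)) n| <= expR x.
Proof.
move=> x0; apply: le_trans (series_exp_coeff_le n x0).
rewrite /series/=; apply: le_trans (ler_norm_sum _ _ _) _.
apply: ler_sum => k _; rewrite /exp_coeff/= normrM normrX normrN.
by rewrite ger0_norm// ger0_norm// invr_ge0.
Qed.

Lemma exp_coeff_le x n : 0 <= x -> x ^+ n / n`!%:R <= expR x.
Proof.
move=> x0; apply: le_trans (series_exp_coeff_le n.+1 x0).
rewrite /series/= big_nat_recr//= lerDr sumr_ge0// => k _.
exact: exp_coeff_ge0.
Qed.

End exponential_series.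

Section exponential_moments.
Local Open Scope ereal_scope.
Context d (T : measurableType d) (R : realType).
Variables (mu : {measure set T -> \bar R}) (U : T -> R).
Hypotheses (mU : measurable_fun setT U) (U0 : forall x, (0 <= U x)%R).

Lemma measurable_series_exp_coeff (s : R) n :
  measurable_fun setT (fun x => series (exp_coeff (s * U x)%R) n).
Proof.
rewrite /series/=; apply: measurable_sum => k.
apply: measurable_funM => //; apply: measurable_funX.
exact: measurable_funM.
Qed.

(** The ratio test: consecutive terms of the exponential series of [z U] have
    integrals whose quotient falls below one half. *)
Lemma exponential_moment_lty (q : nat -> R) (z : R) (N : nat) :
  (forall k, \int[mu]_x (U x ^+ k)%:E = (q k)%:E) -> (0 <= z)%R ->
  (forall k, (N <= k)%N -> (z * q k.+1 * 2 <= k.+1%:R * q k)%R) ->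
  \int[mu]_x (expR (z * U x))%:E < +oo.
Proof.
move=> Uq z0 ratio.
pose t k : R := (z ^+ k / k`!%:R * q k)%R.
have q0 k : (0 <= q k)%R.
  by rewrite -lee_fin -Uq; apply: integral_ge0 => x _; rewrite lee_fin exprn_ge0.
have t0 k : (0 <= t k)%R by rewrite mulr_ge0// divr_ge0// exprn_ge0.
have zU0 x : (0 <= z * U x)%R by rewrite mulr_ge0.
have termE k : \int[mu]_x (exp_coeff (z * U x)%R k)%:E = (t k)%:E.
  rewrite /t EFinM -Uq -ge0_integralZl//; last 3 first.
  - by apply/measurable_EFinP; exact: measurable_funX.
  - by move=> x _; rewrite lee_fin exprn_ge0.
  - by rewrite lee_fin divr_ge0// exprn_ge0.
  apply: eq_integral => x _; rewrite -EFinM /exp_coeff/= exprMn.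
  by rewrite mulrAC.
have serE n : \int[mu]_x (series (exp_coeff (z * U x)%R) n)%:E =
    (\sum_(0 <= k < n) t k)%:E.
  rewrite /series/=; under eq_integral do rewrite -sumEFin.
  rewrite ge0_integral_sum//.
  - by rewrite -sumEFin; apply: eq_bigr => k _; exact: termE.
  - move=> k; apply/measurable_EFinP; apply: measurable_funM => //.
    by apply: measurable_funX; exact: measurable_funM.
  - by move=> k x _; rewrite lee_fin exp_coeff_ge0.
have half k : (N <= k)%N -> (t k.+1 * 2 <= t k)%R.
  move=> Nk; have := ratio _ Nk; rewrite /t factS natrM exprS => r.
  have k1 : (0 < k.+1%:R :> R)%R by [].
  have kf : (0 < k`!%:R :> R)%R by rewrite ltr0n fact_gt0.
  have -> : (z * z ^+ k / (k.+1%:R * k`!%:R) * q k.+1 * 2 =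
    z ^+ k / k`!%:R * (z * q k.+1 * 2 / k.+1%:R))%R.
    by field; rewrite -!nat1r in k1 *; rewrite !gt_eqF.
  rewrite ler_wpM2l ?divr_ge0 ?exprn_ge0//.
  by rewrite ler_pdivrMr// [leRHS]mulrC.
have bound n : (\sum_(0 <= k < n) t k <= \sum_(0 <= k < N) t k + 2 * t N)%R.
  have [nN|Nn] := leqP n N.
    rewrite (big_cat_nat (leq0n n) nN)/= -addrA lerDl.
    by apply: addr_ge0; [exact: sumr_ge0|exact: mulr_ge0].
  have H j : (\sum_(0 <= k < N + j) t k + 2 * t (N + j)%N <=
              \sum_(0 <= k < N) t k + 2 * t N)%R.
    elim: j => [|j IHj]; first by rewrite addn0.
    apply: le_trans IHj; rewrite addnS big_nat_recr//=.
    by have := half (N + j)%N (leq_addr _ _); lra.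
  rewrite -(subnKC (ltnW Nn)); apply: (le_trans _ (H (n - N)%N)).
  by rewrite lerDl mulr_ge0.
have <- : (fun x => limn (EFin \o series (exp_coeff (z * U x)%R))) =
    (fun x => (expR (z * U x))%:E).
  apply/funext => x; apply/cvg_lim => //; apply: cvg_EFin; first exact: nearW.
  exact: cvg_series_exp_coeff.
rewrite monotone_convergence//.
- apply: le_lt_trans (ltry (\sum_(0 <= k < N) t k + 2 * t N)).
  apply: lime_le.
    apply: ereal_nondecreasing_is_cvgn => m n mn; rewrite !serE lee_fin.
    by apply: (nondecreasing_series (u_ := t)) => // k _ _; exact: t0.
  by apply: nearW => n; rewrite /= serE lee_fin.
- by move=> n; apply/measurable_EFinP; exact: measurable_series_exp_coeff.
- move=> n x _ /=; rewrite lee_fin /series/= sumr_ge0// => k _.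
  exact: exp_coeff_ge0.
- move=> x _ m n mn /=; rewrite lee_fin.
  exact: nondecreasing_series_exp_coeff.
Qed.

Hypothesis Uexp : \int[mu]_x (expR (U x))%:E < +oo.

Let integrable_exp : mu.-integrable setT (fun x => (expR (U x))%:E).
Proof.
apply/integrableP; split.
  by apply/measurable_EFinP; exact: (measurableT_comp (@measurable_expR R)).
rewrite (eq_integral (fun x => (expR (U x))%:E))// => x _.
by rewrite gee0_abs// lee_fin expR_ge0.
Qed.

Let integrable_pow n : mu.-integrable setT (fun x => (U x ^+ n / n`!%:R)%:E).
Proof.
apply: le_integrable integrable_exp => //.
  by apply/measurable_EFinP; apply: measurable_funM => //; exact: measurable_funX.
move=> x _; rewrite !gee0_abs ?lee_fin ?expR_ge0//.
  exact: exp_coeff_le.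
by rewrite divr_ge0// exprn_ge0.
Qed.

(** An exponential moment dominates the partial sums of the exponential series,
    so that the expansion may be integrated term by term. *)
Lemma cvg_laplace_series (q : nat -> R) :
  (forall k, \int[mu]_x (U x ^+ k)%:E = (q k)%:E) ->
  (\sum_(0 <= k < n) (-1) ^+ k * (q k / k`!%:R))%R%:E @[n --> \oo] -->
  \int[mu]_x (expR (- U x))%:E.
Proof.
move=> Uq.
have [] // := @dominated_convergence _ _ _ mu setT measurableT
  (fun n x => (series (exp_coeff (- U x)%R) n)%:E)
  (fun x => (expR (- U x))%:E) (fun x => (expR (U x))%:E).
- move=> n; have := measurable_series_exp_coeff (-1) n.
  by under eq_fun do rewrite mulN1r; move=> ?; exact/measurable_EFinP.
- apply/measurable_EFinP; apply: (measurableT_comp (@measurable_expR R)).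
  exact: measurableT_comp.
- apply: aeW => x _; apply: cvg_EFin; first exact: nearW.
  exact: cvg_series_exp_coeff.
- apply: aeW => x n _; rewrite abse_EFin lee_fin.
  exact: normr_series_exp_coeffN.
move=> _ _; apply: cvg_trans; apply: near_eq_cvg; apply: nearW => n.
rewrite /series/=; under eq_integral do rewrite -sumEFin.
have E k x : (exp_coeff (- U x)%R k)%:E =
    ((-1) ^+ k)%R%:E * (U x ^+ k / k`!%:R)%:E.
  by rewrite -EFinM /exp_coeff/= mulrA -exprNn.
under eq_integral do under eq_bigr do rewrite E.
rewrite integral_sum//; last by move=> k; exact: integrableZl.
rewrite -sumEFin; apply: eq_bigr => k _.
rewrite integralZl// EFinM; congr (_ * _).
under eq_integral do rewrite mulrC EFinM.
rewrite ge0_integralZl//.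
- by rewrite Uq -EFinM mulrC.
- by apply/measurable_EFinP; exact: measurable_funX.
- by move=> x _; rewrite lee_fin exprn_ge0.
Qed.

End exponential_moments.

Section Laplace_determination.
Local Open Scope ereal_scope.
Context d1 d2 (T1 : measurableType d1) (T2 : measurableType d2) (R : realType).
Variables (mu1 : {measure set T1 -> \bar R}) (mu2 : {measure set T2 -> \bar R}).

Lemma laplace_moments_eq (U1 : T1 -> R) (U2 : T2 -> R) (q : nat -> R) :
  measurable_fun setT U1 -> measurable_fun setT U2 ->
  (forall x, (0 <= U1 x)%R) -> (forall x, (0 <= U2 x)%R) ->
  \int[mu1]_x (expR (U1 x))%:E < +oo -> \int[mu2]_x (expR (U2 x))%:E < +oo ->
  (forall k, \int[mu1]_x (U1 x ^+ k)%:E = (q k)%:E) ->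
  (forall k, \int[mu2]_x (U2 x ^+ k)%:E = (q k)%:E) ->
  \int[mu1]_x (expR (- U1 x))%:E = \int[mu2]_x (expR (- U2 x))%:E.
Proof.
move=> mU1 mU2 U10 U20 e1 e2 q1 q2.
apply: cvg_unique (cvg_laplace_series mU1 U10 e1 q1) _ => //.
exact: cvg_laplace_series.
Qed.

End Laplace_determination.

(** The exponential of [- n exp (- n t)], a rescaled Gumbel distribution
    function, approximates the indicator of [t > 0] at every [t]. *)
Lemma cvg_gumbel (R : realType) (t : R) :
  expR (- (n%:R * expR (- (n%:R * t)))) @[n --> \oo] -->
  (if 0 < t then 1 else 0 : R).
Proof.
case: ltP => t0.
  apply: (@squeeze_cvgr _ _ _ _ (fun n => 1 - 4 / t ^+ 2 * harmonic n) (cst 1)).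
  - apply: nearW => n; apply/andP; split; last first.
      by rewrite expR_le1 oppr_le0 mulr_ge0// expR_ge0.
    have [->|n0] := eqVneq n 0%N.
      rewrite mul0r oppr0 expR0 gerBl mulr_ge0//.
        by rewrite divr_ge0// sqr_ge0.
      exact: harmonic_ge0.
    apply: le_trans (expR_ge1Dx _); rewrite lerD2l lerN2.
    have n0' : 0 < n%:R :> R by rewrite ltr0n lt0n.
    have n1' : 1 <= n%:R :> R by rewrite ler1n lt0n.
    have := expR_ge1Dxn 1 (mulr_ge0 (ltW n0') (ltW t0)).
    rewrite expRN; move: (expR_gt0 (n%:R * t)).
    move: (expR (n%:R * t)) => E E0; rewrite !factS fact0 !muln1 => Ege.
    rewrite ler_pdivrMr// /harmonic/= -(nat1r n).
    have n1 : 0 < 1 + n%:R :> R by rewrite addr_gt0.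
    have t2 : 0 < t ^+ 2 by rewrite exprn_gt0.
    have -> : 4 / t ^+ 2 / (1 + n%:R) * E = E / (t ^+ 2 * (1 + n%:R) / 4).
      by field; rewrite !gt_eqF.
    rewrite ler_pdivlMr; last by rewrite divr_gt0// mulr_gt0.
    apply: le_trans Ege; rewrite exprMn.
    apply: (@le_trans _ _ (n%:R ^+ 2 * t ^+ 2 / 2)); last by rewrite lerDr.
    rewrite (_ : n%:R * _ = n%:R * (1 + n%:R) * t ^+ 2 / 4); last by ring.
    rewrite (_ : n%:R ^+ 2 * t ^+ 2 / 2 = n%:R * (n%:R + n%:R) * t ^+ 2 / 4).
      rewrite ler_pM2r// ler_pM2r// ler_pM2l//; lra.
    by field.
  - rewrite -[X in _ --> X]subr0 -(mulr0 (4 / t ^+ 2)).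
    by apply: cvgB; [exact: cvg_cst|apply: cvgMr; exact: cvg_harmonic].
  - exact: cvg_cst.
apply: (@squeeze_cvgr _ _ _ _ (cst 0) harmonic).
- apply: nearW => n; rewrite expR_ge0/= /harmonic/=.
  rewrite expRN lef_pV2 ?posrE ?expR_gt0//.
  apply: le_trans (expR_ge1Dx _); rewrite -(nat1r n) lerD2l ler_peMr//.
  by rewrite -expR0 ler_expR oppr_ge0 mulr_ge0_le0.
- exact: cvg_cst.
- exact: cvg_harmonic.
Qed.

Section moment_determination.
Local Open Scope ereal_scope.
Context {R : realType}.

Let gumbel_cvg d (T : measurableType d) (mu : {measure set T -> \bar R})
    (Y : T -> R) (c : R) : measurable_fun setT Y -> mu setT < +oo ->
  \int[mu]_x (expR (- (n%:R * expR (- (n%:R * (Y x - c))))))%:E @[n --> \oo] -->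
  mu (Y @^-1` `]c, +oo[).
Proof.
move=> mY muT.
have [] // := @dominated_convergence _ _ _ mu setT measurableT
  (fun n x => (expR (- (n%:R * expR (- (n%:R * (Y x - c))))))%:E)
  (fun x => (\1_(Y @^-1` `]c, +oo[) x)%:E) (cst 1).
- move=> n; apply/measurable_EFinP.
  apply: (measurableT_comp (@measurable_expR R)); apply: measurableT_comp => //.
  apply: measurable_funM => //.
  apply: (measurableT_comp (@measurable_expR R)); apply: measurableT_comp => //.
  by apply: measurable_funM => //; exact: measurable_funB.
- apply/measurable_EFinP; apply: measurable_indic.
  by rewrite -[X in measurable X]setTI; exact: mY.
- apply: aeW => x _; apply: cvg_EFin; first exact: nearW.
  rewrite indicE; have := @cvg_gumbel R (Y x - c); rewrite subr_gt0.
  rewrite mem_preimage_itvoy.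
  by case: ltP.
- apply/integrableP; split; first exact: measurable_cst.
  rewrite (eq_integral (cst 1)); last by move=> x _; rewrite /= normr1.
  by rewrite integral_cst// mul1e.
- apply: aeW => x n _; rewrite abse_EFin lee_fin ger0_norm ?expR_ge0//.
move=> _ _; rewrite integral_indic ?setIT//.
by rewrite -[X in measurable X]setTI; exact: mY.
Qed.

(** Exponential moments make the Laplace transform at each [z >= 0] a function
    of the moments; the same principle, applied to [n e^(- n (Y - c))], whose
    own moments are values of that Laplace transform, recovers the law. *)
Lemma moment_determination d1 d2 (T1 : measurableType d1)
    (T2 : measurableType d2) (mu1 : {measure set T1 -> \bar R})
    (mu2 : {measure set T2 -> \bar R}) (Y1 : T1 -> R) (Y2 : T2 -> R)
    (q : nat -> R) :
  measurable_fun setT Y1 -> measurable_fun setT Y2 ->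
  (forall x, (0 <= Y1 x)%R) -> (forall x, (0 <= Y2 x)%R) ->
  (forall z : R, (0 <= z)%R -> \int[mu1]_x (expR (z * Y1 x))%:E < +oo) ->
  (forall z : R, (0 <= z)%R -> \int[mu2]_x (expR (z * Y2 x))%:E < +oo) ->
  (forall k, \int[mu1]_x (Y1 x ^+ k)%:E = (q k)%:E) ->
  (forall k, \int[mu2]_x (Y2 x ^+ k)%:E = (q k)%:E) ->
  forall A : set R, measurable A -> mu1 (Y1 @^-1` A) = mu2 (Y2 @^-1` A).
Proof.
move=> mY1 mY2 Y10 Y20 e1 e2 q1 q2.
have pow d (T : measurableType d) (mu : {measure set T -> \bar R}) (Y : T -> R)
    (z : R) : measurable_fun setT Y -> (forall x, (0 <= Y x)%R) -> (0 <= z)%R ->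
    (forall k, \int[mu]_x (Y x ^+ k)%:E = (q k)%:E) ->
    forall k, \int[mu]_x ((z * Y x) ^+ k)%:E = (z ^+ k * q k)%:E.
  move=> mY Y0 z0 mq k; rewrite EFinM -mq -ge0_integralZl//.
  - by apply: eq_integral => x _; rewrite exprMn.
  - by apply/measurable_EFinP; exact: measurable_funX.
  - by move=> x _; rewrite lee_fin exprn_ge0.
  - by rewrite lee_fin exprn_ge0.
have mass d (T : measurableType d) (mu : {measure set T -> \bar R}) (Y : T -> R) :
    (forall k, \int[mu]_x (Y x ^+ k)%:E = (q k)%:E) -> mu setT < +oo.
  move=> mq; have := mq 0%N; under eq_integral do rewrite expr0.
  by rewrite integral_cst// mul1e => ->; exact: ltry.
have lap (z : R) : (0 <= z)%R -> \int[mu1]_x (expR (- (z * Y1 x)))%:E =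
    \int[mu2]_x (expR (- (z * Y2 x)))%:E.
  move=> z0; apply: (@laplace_moments_eq _ _ _ _ _ _ _ _ _ (fun k => z ^+ k * q k)%R).
  - exact: measurable_funM.
  - exact: measurable_funM.
  - by move=> x; rewrite mulr_ge0.
  - by move=> x; rewrite mulr_ge0.
  - exact: e1.
  - exact: e2.
  - exact: pow.
  - exact: pow.
(* [n e^(- n (Y - c)) = C n c e^(- n Y)], whose [k]-th moment is [C n c ^ k]
   times the Laplace transform at [k n]. *)
pose C n (c : R) : R := (n%:R * expR (n%:R * c))%R.
have C0 n c : (0 <= C n c)%R by rewrite mulr_ge0 ?expR_ge0.
have CE n c (y : R) : (n%:R * expR (- (n%:R * (y - c))) = C n c * expR (- (n%:R * y)))%R.
  by rewrite /C -mulrA -expRD; congr (_ * expR _)%R; ring.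
have fin (m : nat) : \int[mu1]_x (expR (- (m%:R * Y1 x)))%:E \is a fin_num.
  rewrite ge0_fin_numE; last first.
    by apply: integral_ge0 => x _; rewrite lee_fin expR_ge0.
  apply: le_lt_trans (mass _ _ _ _ q1).
  rewrite -[leRHS]mul1e -integral_cst//; apply: ge0_le_integral => //.
  - apply/measurable_EFinP; apply: (measurableT_comp (@measurable_expR R)).
    by apply: measurableT_comp => //; exact: measurable_funM.
  - by move=> x _; rewrite lee_fin expR_le1 oppr_le0 mulr_ge0.
have mexp d (T : measurableType d) (Y : T -> R) (a b : R) : measurable_fun setT Y ->
    measurable_fun setT (fun x => a * expR (- (b * Y x)))%R.
  move=> mY; apply: measurable_funM => //.
  apply: (measurableT_comp (@measurable_expR R)); apply: measurableT_comp => //.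
  exact: measurable_funM.
have lty d (T : measurableType d) (mu : {measure set T -> \bar R}) (Y : T -> R) n c :
    measurable_fun setT Y -> (forall x, (0 <= Y x)%R) -> mu setT < +oo ->
    \int[mu]_x (expR (C n c * expR (- (n%:R * Y x))))%:E < +oo.
  move=> mY Y0 muT.
  apply: (@le_lt_trans _ _ (\int[mu]_x (expR (C n c))%:E)).
    apply: ge0_le_integral => //.
    - apply/measurable_EFinP; apply: (measurableT_comp (@measurable_expR R)).
      exact: mexp.
    - move=> x _; rewrite lee_fin ler_expR ler_piMr// expR_le1 oppr_le0.
      by rewrite mulr_ge0.
  by rewrite integral_cst// lte_mul_pinfty ?lee_fin ?expR_ge0.
have powC d (T : measurableType d) (mu : {measure set T -> \bar R}) (Y : T -> R) n c k :
    measurable_fun setT Y ->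
    \int[mu]_x ((C n c * expR (- (n%:R * Y x))) ^+ k)%:E =
    (C n c ^+ k)%:E * \int[mu]_x (expR (- ((k * n)%:R * Y x)))%:E.
  move=> mY; rewrite -ge0_integralZl//.
  - apply: eq_integral => x _; rewrite exprMn -expRM_natl EFinM.
    by rewrite mulrN mulrA natrM.
  - by apply/measurable_EFinP; have := mexp _ _ _ 1%R (k * n)%:R mY;
      under eq_fun do rewrite mul1r.
  - by rewrite lee_fin exprn_ge0.
have ray (c : R) : mu1 (Y1 @^-1` `]c, +oo[) = mu2 (Y2 @^-1` `]c, +oo[).
  apply: cvg_unique (gumbel_cvg mY1 (mass _ _ _ _ q1)) _ => //.
  apply: cvg_trans (gumbel_cvg mY2 (mass _ _ _ _ q2)).
  apply: near_eq_cvg; apply: nearW => n.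
  under eq_integral do rewrite CE; under [RHS]eq_integral do rewrite CE.
  apply/esym/(@laplace_moments_eq _ _ _ _ _ _ _ _ _ (fun k => C n c ^+ k *
    fine (\int[mu1]_x (expR (- ((k * n)%:R * Y1 x)))%:E))%R).
  - exact: mexp.
  - exact: mexp.
  - by move=> x; rewrite mulr_ge0// expR_ge0.
  - by move=> x; rewrite mulr_ge0// expR_ge0.
  - exact: lty (mass _ _ _ _ q1).
  - exact: lty (mass _ _ _ _ q2).
  - by move=> k; rewrite powC// EFinM (fineK (fin _)).
  - by move=> k; rewrite powC// -lap// EFinM (fineK (fin _)).
move=> A mA.
pose m1 := (pushforward mu1 Y1 : {measure set R -> \bar R}).
pose m2 := (pushforward mu2 Y2 : {measure set R -> \bar R}).
apply: (@measure_unique _ R R (@RGenOInfty.G R) (fun n => `](- n%:R)%R, +oo[%classic)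
  _ _ _ _ (m1 mY1) (m2 mY2)) => //.
- exact: RGenOInfty.measurableE.
- move=> _ _ [x ->] [y ->]; exists (Num.max x y).
  apply/seteqP; split => t /=; rewrite !in_itv/= !andbT gt_max.
    by move=> [-> ->].
  by move=> /andP[].
- by move=> n; exists (- n%:R)%R.
- apply/seteqP; split => // x _.
  exists (Num.truncn `|x|).+1 => //=; rewrite in_itv/= andbT ltrNl.
  by rewrite (le_lt_trans _ (truncnS_gt _))// -normrN ler_norm.
- by move=> _ [c ->]; exact: ray.
- move=> k; apply: (le_lt_trans _ (mass _ _ _ _ q1)).
  apply: (le_measure mu1); rewrite ?inE//.
  by rewrite -[X in measurable X]setTI; exact: mY1.
Qed.

End moment_determination.

(** * Moments of tilted stable laws *)

Section stable_moments.
Context {R : realType}.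
Local Notation leb := lebesgue_measure.
Local Notation T := (measurableTypeR R).

Let exp_density (x : R) : R := if 0 < x then expR (- x) else 0.

Let measurable_exp_density : measurable_fun setT exp_density.
Proof.
apply: measurable_fun_ifT => //; first exact: measurable_fun_ltr.
exact: (measurableT_comp (@measurable_expR R)).
Qed.

Let exp_density_ge0 x : 0 <= exp_density x.
Proof. by rewrite /exp_density; case: ifP => // _; exact: expR_ge0. Qed.

Let integral_exp_density (D : set R) (g : R -> R) : measurable D ->
  (\int[leb]_(x in D) (g x * exp_density x)%:E =
   \int[leb]_(x in D `&` `]0%R, +oo[) (g x * expR (- x))%:E)%E.
Proof.
move=> mD; rewrite integral_mkcondr; apply: eq_integral => x _.
rewrite /exp_density /patch mem_setE/= in_itv/= andbT; case: ifP => //.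
by rewrite mulr0.
Qed.

Let exp_density_ray (c : R) :
  (\int[leb]_(x in `]c, +oo[) (exp_density x)%:E = (expR (- (Num.max c 0)))%:E)%E.
Proof.
transitivity (\int[leb]_(x in `]c, +oo[) (1 * exp_density x)%:E)%E.
  by apply: eq_integral => x _; rewrite mul1r.
rewrite (integral_exp_density (fun=> 1)); last exact: measurable_itv.
rewrite -integral_expRN.
rewrite (_ : `]c, +oo[ `&` _ = `]Num.max c 0, +oo[%classic).
  by apply: eq_integral => x _; rewrite mul1r.
apply/seteqP; split => t /=; rewrite !in_itv/= !andbT gt_max.
  by move=> [-> ->].
by move=> /andP[].
Qed.

Variables (alpha : R) (mu : probability R R) (f : R -> R).
Hypotheses (alpha_gt0 : 0 < alpha) (alpha_lt1 : alpha < 1).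
Hypothesis laplace : forall s : R, 0 <= s ->
  'E_mu[fun t : R => expR (- (s * t))]%E = (expR (- (s `^ alpha)))%:E.
Hypothesis mu_f : has_density_on mu `]0, +oo[ f.

Let eq_integral_gt0 (g1 g2 : R -> \bar R) :
  measurable_fun setT g1 -> measurable_fun setT g2 ->
  (forall x, 0 <= g1 x)%E -> (forall x, 0 <= g2 x)%E ->
  (forall x, 0 < x -> g1 x = g2 x) -> (\int[mu]_x g1 x = \int[mu]_x g2 x)%E.
Proof.
move=> m1 m2 g10 g20 g12.
have mD : measurable (`]0, +oo[%classic : set R) by exact: measurable_itv.
rewrite (ge0_integral_has_density mD mu_f m1 g10).
rewrite (ge0_integral_has_density mD mu_f m2 g20).
by apply: eq_integral => x /set_mem/=; rewrite in_itv/= andbT => /g12 ->.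
Qed.

(* The variable [(G / t) ^ alpha] on the product space. *)
Let X (z : T * R) : R := (z.1 * z.2 `^ (-1)) `^ alpha.

Let mX : measurable_fun setT X.
Proof.
apply: (measurableT_comp (@measurable_powR R alpha)); apply: measurable_funM => //.
exact: (measurableT_comp (@measurable_powR R (-1))).
Qed.

Let mh : measurable_fun setT (fun z : T * R => exp_density z.1).
Proof. exact: (measurableT_comp measurable_exp_density). Qed.

Let h0 (z : T * R) : 0 <= exp_density z.1. Proof. exact: exp_density_ge0. Qed.

Local Notation m := (lebesgue_measure \x mu)%E.

Let rayE (c g t : R) : 0 < g -> 0 < t ->
  (c < (g * t `^ (-1)) `^ alpha) = (t * (Num.max c 0) `^ alpha^-1 < g).
Proof.
move=> g0 t0; rewrite powR_inv1 ?(ltW t0)//.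
rewrite [t * _]mulrC -ltr_pdivlMr//.
have y0 : 0 < g / t by rewrite divr_gt0.
have [c0|c0] := leP c 0.
  rewrite powR0 ?invr_neq0 ?(gt_eqF alpha_gt0)// y0.
  by rewrite (le_lt_trans c0)// powR_gt0.
have {1}-> : c = (c `^ alpha^-1) `^ alpha.
  by rewrite -powRrM mulVf ?(gt_eqF alpha_gt0)// powRr1// ltW.
set s := c `^ alpha^-1; have s0 : 0 <= s by exact: powR_ge0.
apply/idP/idP => H.
  rewrite ltNge; apply/negP => ys; move: H; rewrite ltNge => /negP; apply.
  by apply: ge0_ler_powR; rewrite ?nnegrE ?(ltW alpha_gt0) ?(ltW y0).
by apply: gt0_ltr_powR; rewrite ?in_itv/= ?nnegrE ?(ltW y0).
Qed.

Let law_ray (c : R) :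
  (\int[m]_(z in X @^-1` `]c, +oo[) (exp_density z.1)%:E =
   \int[leb]_(x in `]c, +oo[) (exp_density x)%:E)%E.
Proof.
rewrite exp_density_ray integral_mkcond.
pose F (z : T * R) : \bar R := (if c < X z then exp_density z.1 else 0)%:E.
have mF : measurable_fun setT F.
  apply/measurable_EFinP; apply: measurable_fun_ifT => //.
  exact: measurable_fun_ltr.
have F0 z : (0 <= F z)%E by rewrite /F; case: ifP => // _; rewrite lee_fin.
transitivity (\int[m]_z F z)%E.
  apply: eq_integral => z _; rewrite /patch /F.
  by rewrite mem_preimage_itvoy; case: ifP.
rewrite (fubini_tonelli2 F mF F0).
set s := (Num.max c 0) `^ alpha^-1.
have s0 : 0 <= s by exact: powR_ge0.
transitivity (\int[mu]_t (expR (- (s * t)))%:E)%E; last first.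
  have := laplace s0; rewrite unlock => ->; congr (expR (- _))%:E.
  rewrite /s -powRrM mulVf ?(gt_eqF alpha_gt0)// powRr1//.
  by rewrite le_max lexx orbT.
apply: eq_integral_gt0.
- exact: measurable_fun_fubini_tonelli_G.
- apply/measurable_EFinP; apply: (measurableT_comp (@measurable_expR R)).
  by apply: measurableT_comp => //; exact: measurable_funM.
- by move=> t; apply: integral_ge0 => g _.
- by move=> t; rewrite lee_fin expR_ge0.
move=> t t0; rewrite /fubini_G.
transitivity (\int[leb]_(g in `](s * t)%R, +oo[) (exp_density g)%:E)%E.
  rewrite [RHS]integral_mkcond; apply: eq_integral => g _.
  rewrite /F /patch mem_setE/= in_itv/= andbT /X/= /exp_density.
  have [g0|g0] := ltP 0 g; last by rewrite !if_same.
  by rewrite rayE// mulrC; case: ifP.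
by rewrite exp_density_ray max_l// mulr_ge0// ltW.
Qed.

Let exponential_law (A : set T) : measurable A ->
  (\int[leb]_(x in A) (exp_density x)%:E = \int[m]_(z in X @^-1` A) (exp_density z.1)%:E)%E.
Proof.
move=> mA.
pose m2 := (pushforward (density m mh h0) (X : _ -> T) : {measure set T -> \bar R}).
apply: (@measure_unique _ R T (@RGenOInfty.G R) (fun n => `]- n%:R, +oo[%classic)
  _ _ _ _ (density leb measurable_exp_density exp_density_ge0) (m2 mX)) => //.
- exact: RGenOInfty.measurableE.
- move=> _ _ [x ->] [y ->]; exists (Num.max x y).
  apply/seteqP; split => t /=; rewrite !in_itv/= !andbT gt_max.
    by move=> [-> ->].
  by move=> /andP[].
- by move=> n; exists (- n%:R).
- apply/seteqP; split => // x _.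
  exists (Num.truncn `|x|).+1 => //=; rewrite in_itv/= andbT ltrNl.
  by rewrite (le_lt_trans _ (truncnS_gt _))// -normrN ler_norm.
- by move=> _ [c ->]; rewrite [RHS]law_ray.
- by move=> k; rewrite [ltLHS]exp_density_ray ltry.
Qed.

(** If [G] is standard exponential and independent of a variable [t] with law
    [mu], then [(G / t) ^ alpha] is again standard exponential: its tail at [c]
    is the Laplace transform of [mu] at [c ^ (1 / alpha)].  Computing the moment
    of order [p / alpha] in both ways gives the identity. *)
Lemma stable_negative_moment (p : R) : - alpha < p ->
  ((Gamma (p + 1))%:E * \int[mu]_t (t `^ (- p))%:E =
   (Gamma (p / alpha + 1))%:E)%E.
Proof.
move=> p_gt.
have an0 : alpha != 0 by rewrite gt_eqF.
have p1 : 0 < p + 1 by rewrite -ltrBlDr sub0r (lt_trans _ p_gt)// ltrN2.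
have r1 : 0 < p / alpha + 1.
  by rewrite -(mulfV an0) -mulrDl divr_gt0// -ltrBlDr sub0r.
pose phi (x : R) : \bar R := (x `^ (p / alpha))%:E.
have mphi : measurable_fun setT phi.
  by apply/measurable_EFinP; exact: measurable_powR.
have phi0 x : (0 <= phi x)%E by rewrite lee_fin powR_ge0.
have mneg : measurable_fun setT (fun t : R => (t `^ (- p))%:E).
  by apply/measurable_EFinP; exact: measurable_powR.
have law := @ge0_integral_pushforward_density _ _ _ T R m (density leb measurable_exp_density exp_density_ge0)
  (fun z => exp_density z.1) X phi mh h0 mX exponential_law mphi phi0.
have side1 : (\int[density leb measurable_exp_density exp_density_ge0]_x phi x = (Gamma (p / alpha + 1))%:E)%E.
  apply: (etrans (@ge0_integral_density _ T R leb exp_density measurable_exp_density exp_density_ge0 phi mphi phi0)).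
  transitivity (\int[leb]_(x in setT) ((x `^ (p / alpha)) * exp_density x)%:E)%E.
    by apply: eq_integral => x _; rewrite -EFinM.
  rewrite (integral_exp_density (fun x => x `^ (p / alpha)))//.
  rewrite setTI -(integral_Gamma r1); apply: eq_integral => x _.
  by rewrite addrK.
apply: (etrans _ (etrans (esym law) side1)).
pose F (z : T * R) : \bar R := (phi (X z) * (exp_density z.1)%:E)%E.
have mF : measurable_fun setT F.
  apply: emeasurable_funM; last exact/measurable_EFinP.
  exact: (measurableT_comp mphi mX).
have F0 z : (0 <= F z)%E by rewrite mule_ge0// lee_fin.
rewrite (fubini_tonelli2 F mF F0) -ge0_integralZl//; last 2 first.
- by move=> t _; rewrite lee_fin powR_ge0.
- by rewrite lee_fin ltW// Gamma_gt0.
apply: eq_integral_gt0.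
- exact: measurable_funeM.
- exact: measurable_fun_fubini_tonelli_G.
- by move=> t; rewrite -EFinM lee_fin mulr_ge0 ?powR_ge0// ltW// Gamma_gt0.
- by move=> t; apply: integral_ge0 => g _.
move=> t t0; rewrite /fubini_G -(integral_Gamma p1).
rewrite muleC -ge0_integralZl//; last 3 first.
- by apply/measurable_EFinP; apply: measurable_funTS; exact: measurable_powR_expRN.
- by move=> x _; rewrite lee_fin mulr_ge0 ?powR_ge0 ?expR_ge0.
- by rewrite lee_fin powR_ge0.
rewrite [LHS]integral_mkcond; apply: eq_integral => g _.
rewrite /F /phi /X /patch mem_setE/= in_itv/= andbT /exp_density -EFinM.
case: ifPn => g0; last by rewrite mule0.
rewrite -EFinM addrK; congr EFin.
rewrite -[in RHS]powRrM [alpha * _]mulrC divfK// powRM ?powR_ge0 ?(ltW g0)//.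
by rewrite -powRrM mulN1r mulrA [_ * g `^ p]mulrC.
Qed.

End stable_moments.

Section diversity_moments.
Context {R : realType}.
Variables (alpha theta : R).
Hypotheses (alpha_gt0 : 0 < alpha) (alpha_lt1 : alpha < 1).
Hypothesis theta_gt : - alpha < theta.

(** First parameter of the law of the [j]-th remaining fraction [1 - V_j]. *)
Definition stick_parameter (j : nat) : R := theta + j%:R * alpha.

Lemma stick_parameter_gt0 j : (1 <= j)%N -> 0 < stick_parameter j.
Proof.
move=> j1; have : alpha <= j%:R * alpha by rewrite ler_peMl ?ler1n// ltW.
by move: theta_gt; rewrite /stick_parameter; lra.
Qed.

Lemma stick_parameterS j : stick_parameter j.+1 = stick_parameter j + alpha.
Proof. by rewrite /stick_parameter -natr1; ring. Qed.

(** The moment of order [k] of the [alpha]-diversity.  For [theta = 0] these are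
    the moments of the Mittag-Leffler law. *)
Definition diversity_moment (k : nat) : R :=
  \prod_(1 <= j < k.+1)
    (Gamma (stick_parameter j + (1 - alpha)) / (alpha * Gamma (stick_parameter j))).

Lemma diversity_moment0 : diversity_moment 0 = 1.
Proof. by rewrite /diversity_moment big_nil. Qed.

Lemma diversity_momentS k : diversity_moment k.+1 = diversity_moment k *
  (Gamma (stick_parameter k.+1 + (1 - alpha)) /
   (alpha * Gamma (stick_parameter k.+1))).
Proof. by rewrite /diversity_moment big_nat_recr. Qed.

Lemma diversity_moment_gt0 k : 0 < diversity_moment k.
Proof.
elim: k => [|k IHk]; first by rewrite diversity_moment0.
have a0 : 0 < stick_parameter k.+1 by exact: stick_parameter_gt0.
have b0 : 0 < 1 - alpha by rewrite subr_gt0.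
have g1 := Gamma_gt0 (addr_gt0 a0 b0).
have g2 := Gamma_gt0 a0.
by rewrite diversity_momentS (mulr_gt0 IHk (divr_gt0 g1 (mulr_gt0 alpha_gt0 g2))).
Qed.

(** Consecutive factors telescope, since [stick_parameter j + (1 - alpha)] is
    [stick_parameter (j - 1) + 1] and [stick_parameter j / alpha] increases by
    one with [j]. *)
Lemma diversity_moment_Gamma k :
  Gamma (theta + 1) / Gamma (theta / alpha + 1) *
    (Gamma ((theta + k%:R * alpha) / alpha + 1) / Gamma (theta + k%:R * alpha + 1)) =
  diversity_moment k.
Proof.
have an0 : alpha != 0 by rewrite gt_eqF.
have p1 j : 0 < stick_parameter j + 1.
  rewrite /stick_parameter.
  have : 0 <= j%:R * alpha by rewrite mulr_ge0// ltW.
  by move: theta_gt alpha_lt1; lra.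
have r1 j : 0 < stick_parameter j / alpha + 1.
  rewrite -(mulfV an0) -mulrDl divr_gt0//.
  by rewrite -stick_parameterS stick_parameter_gt0.
elim: k => [|k IHk].
  have := p1 0%N; have := r1 0%N.
  rewrite /stick_parameter mul0r addr0 => g1 g2.
  rewrite diversity_moment0; have := Gamma_gt0 g1; have := Gamma_gt0 g2.
  move: (Gamma _) (Gamma _) => A B A0 B0.
  by field; rewrite !gt_eqF.
rewrite diversity_momentS -IHk -/(stick_parameter k) -/(stick_parameter k.+1).
have -> : stick_parameter k.+1 + (1 - alpha) = stick_parameter k + 1.
  by rewrite stick_parameterS; ring.
have a0 : 0 < stick_parameter k.+1 by exact: stick_parameter_gt0.
have aE : stick_parameter k.+1 / alpha = stick_parameter k / alpha + 1.
  by rewrite stick_parameterS mulrDl mulfV.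
rewrite aE (GammaS (r1 k)) (GammaS a0) -aE.
have g0 := Gamma_gt0 (r1 0%N).
have g2 := Gamma_gt0 (p1 k).
have g3 := Gamma_gt0 a0.
rewrite /stick_parameter mul0r addr0 -/(stick_parameter k) -/(stick_parameter k.+1) in g0 *.
move: g0 g2 g3 a0.
move: (Gamma (theta + 1)) (Gamma (theta / alpha + 1)).
move: (Gamma (stick_parameter k.+1 / alpha)) (Gamma (stick_parameter k + 1)).
move: (Gamma (stick_parameter k.+1)) (stick_parameter k.+1) => A s B C D E E0 C0 A0 s0.
by field; rewrite !gt_eqF.
Qed.

(** The quotient of consecutive moments grows only like [k ^ (1 - alpha)]. *)
Lemma diversity_moment_ratio (z : R) : 0 <= z -> exists N : nat,
  forall k, (N <= k)%N ->
    z * diversity_moment k.+1 * 2 <= k.+1%:R * diversity_moment k.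
Proof.
move=> z0.
have b0 : 0 < 1 - alpha by rewrite subr_gt0.
have b01 : 0 <= 1 - alpha <= 1 by rewrite ltW//= gerBl ltW.
pose c := `|theta| + 1; have c0 : 0 < c by rewrite ltr_wpDl.
pose M := 2 * z * c `^ (1 - alpha) / alpha.
have M0 : 0 <= M by rewrite divr_ge0 ?mulr_ge0 ?powR_ge0// ltW.
exists (Num.truncn (M `^ alpha^-1)) => k Nk.
have k0 : 0 < k.+1%:R :> R by [].
have Mk : M <= k.+1%:R `^ alpha.
  have -> : M = (M `^ alpha^-1) `^ alpha.
    by rewrite -powRrM mulVf ?gt_eqF// powRr1.
  apply: ge0_ler_powR; rewrite ?nnegrE ?powR_ge0 ?(ltW alpha_gt0)//.
  rewrite (le_trans (ltW (truncnS_gt _)))// ler_nat.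
  by rewrite ltnS.
have a0 : 0 < stick_parameter k.+1 by exact: stick_parameter_gt0.
have ac : stick_parameter k.+1 <= c * k.+1%:R.
  rewrite /stick_parameter /c mulrDl mul1r lerD//.
    by rewrite (le_trans (ler_norm _))// ler_peMr// ler1n.
  by rewrite ler_piMr// ltW.
rewrite diversity_momentS.
have up := Gamma_like_upper Gamma_like_Gamma a0 b01.
have g0 := Gamma_gt0 a0; have q0 := diversity_moment_gt0 k.
have {up} up : Gamma (stick_parameter k.+1 + (1 - alpha)) /
    (alpha * Gamma (stick_parameter k.+1)) <=
    (c * k.+1%:R) `^ (1 - alpha) / alpha.
  have := @ler_wpM2r R (alpha * Gamma (stick_parameter k.+1))^-1.
  rewrite invr_ge0 mulr_ge0 ?(ltW alpha_gt0) ?(ltW g0)// => /(_ isT _ _ up).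
  move/le_trans; apply.
  rewrite invfM mulrACA mulfV ?gt_eqF// mulr1.
  rewrite ler_wpM2r ?invr_ge0 ?(ltW alpha_gt0)//.
  apply: ge0_ler_powR; rewrite ?nnegrE ?(ltW a0) ?(ltW b0)//.
  by rewrite mulr_ge0 ?(ltW c0).
move: up; set G := _ / _ => up; move: q0; set q := diversity_moment k => q0.
have -> : z * (q * G) * 2 = (2 * z * G) * q by ring.
rewrite ler_wpM2r ?(ltW q0)//.
apply: (@le_trans _ _ (2 * z * ((c * k.+1%:R) `^ (1 - alpha) / alpha))).
  by rewrite ler_wpM2l// mulr_ge0.
rewrite powRM ?(ltW c0) ?(ltW k0)//.
have -> : 2 * z * (c `^ (1 - alpha) * k.+1%:R `^ (1 - alpha) / alpha) =
  M * k.+1%:R `^ (1 - alpha) by rewrite /M; ring.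
apply: (le_trans (ler_wpM2r (powR_ge0 _ _) Mk)).
by rewrite -powRD ?(gt_eqF k0) ?implybT// subrKC powRr1 ?(ltW k0).
Qed.

Lemma diversity_exponential_moment d (T : measurableType d)
    (mu : {measure set T -> \bar R}) (Y : T -> R) :
  measurable_fun setT Y -> (forall x, 0 <= Y x) ->
  (forall k, (\int[mu]_x (Y x ^+ k)%:E = (diversity_moment k)%:E)%E) ->
  forall z : R, 0 <= z -> (\int[mu]_x (expR (z * Y x))%:E < +oo)%E.
Proof.
move=> mY Y0 Yq z z0; have [N HN] := diversity_moment_ratio z0.
exact: (exponential_moment_lty mY Y0 Yq z0 HN).
Qed.

Variable f : R -> R.
Hypothesis f_stable : positive_stable_density alpha f.

Let g := tilted_stable_density alpha theta f.

Lemma tilted_stable_density_measurable : measurable_fun (`]0, +oo[%classic : set R) g.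
Proof.
have [mu [_ [mf _ _]]] := f_stable.
apply: measurable_funM => //; apply: measurable_funM => //.
by apply: measurable_funTS; exact: measurable_powR.
Qed.

Lemma tilted_stable_density_ge0 t : t \in `]0, +oo[ -> 0 <= g t.
Proof.
have [mu [_ [_ f0 _]]] := f_stable => t0.
have t1 : 0 < theta + 1 by move: theta_gt alpha_lt1; lra.
have t2 : 0 < theta / alpha + 1.
  by rewrite -[1](mulfV (lt0r_neq0 alpha_gt0)) -mulrDl divr_gt0//; move: theta_gt; lra.
have := Gamma_gt0 t1; have := Gamma_gt0 t2 => g2 g1.
by rewrite /g /tilted_stable_density mulr_ge0 ?divr_ge0 ?(ltW g1) ?(ltW g2)// mulr_ge0 ?powR_ge0 ?f0.
Qed.

Lemma tilted_stable_moment k :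
  (\int[lebesgue_measure]_(t in `]0%R, +oo[) ((t `^ (- alpha)) ^+ k * g t)%:E =
   (diversity_moment k)%:E)%E.
Proof.
have [mu [lap mu_f]] := f_stable; have [mf f0 _] := mu_f.
pose p := theta + k%:R * alpha.
have p_gt : - alpha < p.
  have : 0 <= k%:R * alpha by rewrite mulr_ge0// ltW.
  by move: theta_gt; rewrite /p; lra.
have p1 : 0 < p + 1 by move: p_gt alpha_lt1; lra.
have t1 : 0 < theta + 1 by move: theta_gt alpha_lt1; lra.
have t2 : 0 < theta / alpha + 1.
  by rewrite -[1](mulfV (lt0r_neq0 alpha_gt0)) -mulrDl divr_gt0//; move: theta_gt; lra.
have mD : measurable (`]0, +oo[%classic : set R) by exact: measurable_itv.
have mneg : measurable_fun setT (fun t : R => (t `^ (- p))%:E).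
  by apply/measurable_EFinP; exact: measurable_powR.
have neg0 (t : R) : (0 <= (t `^ (- p))%:E)%E by rewrite lee_fin powR_ge0.
have := stable_negative_moment alpha_gt0 alpha_lt1 lap mu_f p_gt.
rewrite (ge0_integral_has_density mD mu_f mneg neg0) => mom.
pose c := Gamma (theta + 1) / Gamma (theta / alpha + 1).
have c0 : 0 <= c by rewrite divr_ge0 ?(ltW (Gamma_gt0 t1)) ?(ltW (Gamma_gt0 t2)).
transitivity (c%:E * \int[lebesgue_measure]_(t in `]0%R, +oo[)
    ((t `^ (- p))%:E * (f t)%:E))%E.
  rewrite -ge0_integralZl; last 4 first.
  - exact: measurable_itv.
  - apply: emeasurable_funM; last exact/measurable_EFinP.
    by apply/measurable_EFinP; apply: measurable_funTS; exact: measurable_powR.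
  - by move=> t Dt; rewrite mule_ge0// lee_fin ?powR_ge0// f0.
  - by rewrite lee_fin.
  apply: eq_integral => t /set_mem/=; rewrite in_itv/= andbT => t0.
  rewrite -!EFinM /g /tilted_stable_density -/c; congr EFin.
  have -> : t `^ (- p) = t `^ (- theta) * (t `^ (- alpha)) ^+ k.
    rewrite -powR_mulrn ?powR_ge0// -powRrM -powRD ?(gt_eqF t0) ?implybT//.
    by congr (_ `^ _); rewrite /p; ring.
  by ring.
have gp := Gamma_gt0 p1.
have -> : (\int[lebesgue_measure]_(t in `]0%R, +oo[) ((t `^ (- p))%:E * (f t)%:E) =
    (Gamma (p / alpha + 1) / Gamma (p + 1))%:E)%E.
  rewrite mulrC EFinM -mom muleA -EFinM mulVf ?mul1e//.
  by rewrite gt_eqF.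
by rewrite -EFinM diversity_moment_Gamma.
Qed.

End diversity_moments.

(** * Expectations of products of independent variables *)

Section independent_products.
Context d (Omega : measurableType d) (R : realType) (P : probability Omega R).
Variable V : nat -> {RV P >-> R}.
Hypothesis V_indep : mutually_independent [set j | (1 <= j)%N] V.
Implicit Types (G : nat -> R -> R) (A : nat -> set R) (e : nat -> R).

Let prob_of A j : R := fine (P (V j @^-1` A j)).

Let expectation_prod_indic n A : (forall j, measurable (A j)) ->
  (\int[P]_w (\prod_(1 <= j < n.+1) \1_(A j) (V j w))%:E =
   (\prod_(1 <= j < n.+1) prob_of A j)%:E)%E.
Proof.
move=> mA.
pose J : {fset nat} := [fset j in index_iota 1 n.+1]%fset.
have J_iota : perm_eq J (index_iota 1 n.+1).
  apply: uniq_perm; rewrite ?fset_uniq ?iota_uniq// => j.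
  by rewrite in_fset.
have mV j : measurable (V j @^-1` A j).
  by rewrite -[X in measurable X]setTI; exact: measurable_funP.
have JD : [set` J] `<=` [set j | (1 <= j)%N].
  by move=> j /=; rewrite (perm_mem J_iota) mem_index_iota => /andP[].
have := V_indep JD mA.
have -> : (\prod_(j <- J) P (V j @^-1` A j) =
    (\prod_(1 <= j < n.+1) prob_of A j)%:E)%E.
  rewrite -prodEFin (perm_big _ J_iota)/=; apply: eq_bigr => j _.
  by rewrite /prob_of fineK// fin_num_measure.
move=> <-.
rewrite -[X in P X]setIT -integral_indic//; last first.
  by apply: fin_bigcap_measurable => //; exact: finite_fset.
apply: eq_integral => w _; congr EFin.
rewrite indicE; have [wJ|wJ] := boolP (w \in _).
  rewrite big_nat_cond big1// => j /andP[jn _]; rewrite indicE mem_set//.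
  move/set_mem: wJ => /(_ j); apply.
  by rewrite /= (perm_mem J_iota) mem_index_iota.
apply/eqP; rewrite prodf_seq_eq0; apply/hasP.
move: wJ; rewrite notin_setE => /existsNP[j /not_implyP[jJ jA]].
exists j; first by rewrite -(perm_mem J_iota).
by rewrite /= indicE memNset.
Qed.

(* The indicators are replaced by arbitrary functions one coordinate at a
   time; [m] is the first coordinate that still carries an indicator. *)
Let mixed m G A j : R -> R := if (j < m)%N then G j else \1_(A j).

Let mixed_expectation m e A j : R := if (j < m)%N then e j else prob_of A j.

Let expectation_prod_mixed n m G A e :
  (forall j, measurable_fun setT (G j)) -> (forall j x, 0 <= G j x) ->
  (forall j, measurable (A j)) ->
  (forall j, \int[P]_w (G j (V j w))%:E = (e j)%:E)%E ->
  (1 <= m <= n.+1)%N ->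
  (\int[P]_w (\prod_(1 <= j < n.+1) mixed m G A j (V j w))%:E =
   (\prod_(1 <= j < n.+1) mixed_expectation m e A j)%:E)%E.
Proof.
move=> mG G0 mA Ge /andP[m1]; case: m m1 => // m _.
elim: m A mA => [|m IHm] A mA mn.
  have -> : \prod_(1 <= j < n.+1) mixed_expectation 1 e A j =
      \prod_(1 <= j < n.+1) prob_of A j.
    by apply: eq_big_nat => j /andP[j1 _]; rewrite /mixed_expectation ltnNge j1.
  rewrite -expectation_prod_indic//; apply: eq_integral => w _; congr EFin.
  by apply: eq_big_nat => j /andP[j1 _]; rewrite /mixed ltnNge j1.
pose m' := m.+1.
have m'n : m' \in index_iota 1 n.+1 by rewrite mem_index_iota/=.
have Dbig (F : nat -> R) : \prod_(1 <= j < n.+1) F j =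
    F m' * \prod_(j <- index_iota 1 n.+1 | j != m') F j.
  by rewrite (bigD1_seq m') ?iota_uniq.
have e0 j : 0 <= e j.
  by rewrite -lee_fin -Ge; apply: integral_ge0 => w _; rewrite lee_fin G0.
have mix0 k B j x : 0 <= mixed k G B j x.
  by rewrite /mixed; case: ifP.
have mixe0 k B j : 0 <= mixed_expectation k e B j.
  by rewrite /mixed_expectation /prob_of; case: ifP => // _; rewrite fine_ge0.
have mmix k B j : (forall i, measurable (B i)) -> measurable_fun setT (mixed k G B j).
  by move=> mB; rewrite /mixed; case: ifP => // _; exact: measurable_indic.
pose U w := \prod_(j <- index_iota 1 n.+1 | j != m') mixed m'.+1 G A j (V j w).
pose K := \prod_(j <- index_iota 1 n.+1 | j != m') mixed_expectation m'.+1 e A j.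
have K0 : 0 <= K by rewrite prodr_ge0.
have mU : measurable_fun setT U.
  rewrite /U; elim: (index_iota _ _) => [|j r IHr].
    by under eq_fun do rewrite big_nil; exact: measurable_cst.
  under eq_fun do rewrite big_cons; case: (j != m') => //.
  apply: measurable_funM => //; exact: (measurableT_comp (mmix _ _ _ mA)).
have U0 w : 0 <= U w by rewrite prodr_ge0.
(* By the induction hypothesis, with the set at [m'] left free, [nu] is the law
   of [V m'] weighted by the product of the other factors. *)
pose nu := mscale (NngNum K0) (distribution P (V m')).
have nuE B : measurable B -> nu B = (\int[P]_(w in V m' @^-1` B) (U w)%:E)%E.
  move=> mB; pose A' j := if j == m' then B else A j.
  have mA' j : measurable (A' j) by rewrite /A'; case: ifP.
  have mVB : measurable (V m' @^-1` B).
    by rewrite -[X in measurable X]setTI; exact: measurable_funP.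
  have := IHm A' mA' (ltnW mn).
  have -> : (\prod_(1 <= j < n.+1) mixed_expectation m' e A' j)%:E = nu B.
    rewrite Dbig {1}/mixed_expectation ltnn /prob_of /A' eqxx.
    rewrite /nu /mscale/= EFinM muleC fineK ?fin_num_measure//.
    congr (_%:E * _)%E; apply: eq_bigr => j jm.
    rewrite /mixed_expectation /prob_of (negbTE jm) [in RHS]ltnS.
    rewrite [in RHS]leq_eqVlt.
    by rewrite (negbTE jm).
  move=> <-; rewrite [RHS]integral_mkcond; apply: eq_integral => w _.
  rewrite Dbig {1}/mixed ltnn /A' eqxx epatch_indic EFinM muleC.
  congr (_%:E * _)%E.
  apply: eq_bigr => j jm.
  by rewrite /mixed (negbTE jm) [in RHS]ltnS [in RHS]leq_eqVlt (negbTE jm).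
have gG0 x : (0 <= (G m' x)%:E)%E by rewrite lee_fin.
have mGE : measurable_fun setT (fun x => (G m' x)%:E) by exact/measurable_EFinP.
have := ge0_integral_pushforward_density mU U0 (measurable_funP (V m')) nuE mGE gG0.
rewrite ge0_integral_mscale//.
rewrite (ge0_integral_distribution (V m') mGE gG0) Ge => H.
transitivity (\int[P]_x ((G m' (V m' x))%:E * (U x)%:E))%E.
  apply: eq_integral => w _; rewrite Dbig -EFinM /U; congr (_ * _)%:E.
  by rewrite /mixed ltnSn.
rewrite -H Dbig /= -EFinM mulrC; congr (_ * _)%:E.
by rewrite /mixed_expectation ltnSn.
Qed.

Lemma expectation_prod n G e :
  (forall j, measurable_fun setT (G j)) -> (forall j x, 0 <= G j x) ->
  (forall j, (1 <= j)%N -> \int[P]_w (G j (V j w))%:E = (e j)%:E)%E ->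
  (\int[P]_w (\prod_(1 <= j < n.+1) G j (V j w))%:E =
   (\prod_(1 <= j < n.+1) e j)%:E)%E.
Proof.
move=> mG G0 Ge.
(* Only the indices from 1 on carry a hypothesis. *)
pose G' j : R -> R := if j is 0%N then cst 1 else G j.
pose e' j : R := if j is 0%N then 1 else e j.
have mG' j : measurable_fun setT (G' j).
  by case: j => [|j]; [exact: measurable_cst|exact: mG].
have G'0 j x : 0 <= G' j x by case: j => [|j] //=.
have G'e j : (\int[P]_w (G' j (V j w))%:E = (e' j)%:E)%E.
  case: j => [|j]; last exact: Ge.
  by rewrite [LHS](integral_cst _ measurableT 1%E) mul1e; exact: probability_setT.
have := @expectation_prod_mixed n n.+1 G' (fun=> setT) e' mG' G'0
  (fun=> measurableT) G'e (ltnSn n).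
have -> : \prod_(1 <= j < n.+1) mixed_expectation n.+1 e' (fun=> setT) j =
    \prod_(1 <= j < n.+1) e j.
  by apply: eq_big_nat => -[//|j] /andP[_ jn]; rewrite /mixed_expectation jn.
move=> <-; apply: eq_integral => w _; congr EFin.
by apply: eq_big_nat => -[//|j] /andP[_ jn]; rewrite /mixed jn.
Qed.

End independent_products.

(** * Almost sure convergence *)

Section almost_sure_convergence.
Context d (Omega : measurableType d) (R : realType).
Variable P : {measure set Omega -> \bar R}.

(** Increments with summable [L^1] norms are almost surely absolutely
    summable. *)
Lemma ae_cvgn_summable (Z : nat -> Omega -> R) (M : R) :
  (forall n, measurable_fun setT (Z n)) ->
  (forall K, (\sum_(0 <= m < K) \int[P]_w `|Z m.+1 w - Z m w|%:E <= M%:E)%E) ->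
  {ae P, forall w, cvgn (Z ^~ w)}.
Proof.
move=> mZ sumM.
pose D m w : \bar R := `|Z m.+1 w - Z m w|%:E.
have mD m : measurable_fun setT (D m).
  apply/measurable_EFinP; apply: measurableT_comp => //.
  exact: measurable_funB.
have D0 m w : (0 <= D m w)%E by rewrite lee_fin.
have int_sum : P.-integrable setT (fun w => \sum_(0 <= m <oo) D m w)%E.
  apply/integrableP; split.
    by apply: ge0_emeasurable_sum => // m w _ _; exact: D0.
  rewrite (eq_integral (fun w => \sum_(0 <= m <oo) D m w)%E); last first.
    by move=> w _; rewrite gee0_abs// nneseries_ge0.
  rewrite integral_nneseries//.
  apply: (le_lt_trans _ (ltry M)); apply: lime_le.
    by apply: is_cvg_nneseries => m _ _; apply: integral_ge0.
  by apply: nearW.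
have [N [mN N0 subN]] := integrable_ae measurableT int_sum.
exists N; split => // w /= ncvg; apply: subN => /= fin; apply: ncvg.
have {}fin : (\sum_(0 <= m <oo) D m w)%E \is a fin_num by exact: fin.
pose u m := Z m.+1 w - Z m w.
have : cvgn [normed series u].
  apply: nondecreasing_is_cvgn.
    by apply: nondecreasing_series => k _ _ /=.
  exists (fine (\sum_(0 <= m <oo) D m w)%E) => _ [n _ <-].
  rewrite -lee_fin fineK// /series/= -sumEFin.
  exact: nneseries_lim_ge.
move/normed_cvg => /cvg_ex[l ul].
apply/cvg_ex; exists (Z 0%N w + l).
rewrite -(cvg_shiftS _) /=.
have -> : (fun n => Z n.+1 w) = (fun n => Z 0%N w + series u n.+1).
  apply/funext => n; rewrite /series/= telescope_sumr//.
  by rewrite addrC subrK.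
apply: cvgD; first exact: cvg_cst.
by rewrite (cvg_shiftS (series u)).
Qed.


(** Almost sure convergence carries expectations to the limit when second
    moments are bounded.  Fatou's lemma gives one inequality; for the other,
    [x / (1 + e x)] is bounded and differs from [x] by at most
    [e x^2]. *)
Lemma moment_limit (X_ : nat -> Omega -> R) (X : Omega -> R) (m : nat -> R)
    (l C : R) : (P setT < +oo)%E ->
  (forall n, measurable_fun setT (X_ n)) -> measurable_fun setT X ->
  (forall n w, 0 <= X_ n w) -> (forall w, 0 <= X w) ->
  {ae P, forall w, X_ n w @[n --> \oo] --> X w} ->
  (forall n, \int[P]_w (X_ n w)%:E = (m n)%:E)%E -> m n @[n --> \oo] --> l ->
  (forall n, \int[P]_w (X_ n w ^+ 2)%:E <= C%:E)%E ->
  (\int[P]_w (X w)%:E = l%:E)%E.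
Proof.
move=> Pfin mX_ mX X_0 X0 X_X X_m ml XC.
have C0 : 0 <= C.
  rewrite -lee_fin (le_trans _ (XC 0%N))//; apply: integral_ge0 => w _.
  by rewrite lee_fin sqr_ge0.
have mXE_ n : measurable_fun setT (fun w => (X_ n w)%:E) by exact/measurable_EFinP.
have mXE : measurable_fun setT (fun w => (X w)%:E) by exact/measurable_EFinP.
have mlE : (m n)%:E @[n --> \oo] --> l%:E by apply: cvg_EFin => //; exact: nearW.
apply/eqP; rewrite eq_le; apply/andP; split.
  have -> : (\int[P]_w (X w)%:E = \int[P]_w limn_einf (fun n => (X_ n w)%:E))%E.
    apply: ae_eq_integral => //.
      under eq_fun do rewrite -[limn_einf _]oppeK -limn_esupN.
      apply: measurableT_comp => //; apply: measurable_fun_limn_esup => n.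
      exact: measurableT_comp.
    apply: filterS X_X => w Xw _.
    have XwE : (X_ n w)%:E @[n --> \oo] --> (X w)%:E.
      by apply: cvg_EFin => //; exact: nearW.
    rewrite is_cvg_limn_einfE; first by apply/esym/cvg_lim.
    by apply/cvg_ex; exists (X w)%:E.
  apply: le_trans (fatou P measurableT mXE_ _) _.
    by move=> n w _; rewrite lee_fin.
  under eq_fun do rewrite X_m.
  rewrite is_cvg_limn_einfE; last by apply/cvg_ex; exists l%:E.
  by rewrite (cvg_lim _ mlE).
pose phi (e x : R) := x * (1 + e * x) `^ (-1).
have den (e x : R) : 0 < e -> 0 <= x -> 0 < 1 + e * x.
  by move=> e0 x0; rewrite ltr_wpDr// mulr_ge0// ltW.
have phiE e x : 0 < e -> 0 <= x -> phi e x = x / (1 + e * x).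
  by move=> e0 x0; rewrite /phi powR_inv1// ltW// den.
have phi0 e x : 0 < e -> 0 <= x -> 0 <= phi e x.
  by move=> e0 x0; rewrite mulr_ge0 ?powR_ge0.
have phi_le e x : 0 < e -> 0 <= x -> phi e x <= x.
  move=> e0 x0; rewrite phiE// ler_pdivrMr ?den// ler_peMr// lerDl mulr_ge0//.
  exact: ltW.
have phi_bound e x : 0 < e -> 0 <= x -> phi e x <= e^-1.
  move=> e0 x0; rewrite phiE// ler_pdivrMr ?den// mulrDr mulr1 mulrA.
  by rewrite mulVf ?gt_eqF// mul1r lerDr invr_ge0 ltW.
have phi_diff e x : 0 < e -> 0 <= x -> x <= phi e x + e * x ^+ 2.
  move=> e0 x0; rewrite -lerBlDl.
  have -> : x - phi e x = e * x ^+ 2 / (1 + e * x).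
    by rewrite phiE//; field; rewrite gt_eqF ?den.
  rewrite ler_pdivrMr ?den// ler_peMr ?mulr_ge0 ?sqr_ge0 ?(ltW e0)//.
  by rewrite lerDl mulr_ge0// ltW.
have mphi e : measurable_fun setT (phi e).
  apply: measurable_funM => //; apply: (measurableT_comp (@measurable_powR R _)).
  by apply: measurable_funD => //; exact: measurable_funM.
have phi_cvg e : 0 < e ->
    (\int[P]_w (phi e (X_ n w))%:E @[n --> \oo] --> \int[P]_w (phi e (X w))%:E)%E.
  move=> e0; have [] // := @dominated_convergence _ _ _ P setT measurableT
    (fun n w => (phi e (X_ n w))%:E) (fun w => (phi e (X w))%:E) (cst (e^-1)%:E).
  - by move=> n; apply/measurable_EFinP; exact: measurableT_comp.
  - by apply/measurable_EFinP; exact: measurableT_comp.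
  - apply: filterS X_X => w Xw _; apply: cvg_EFin; first exact: nearW.
    have den_cvg : 1 + e * X_ n w @[n --> \oo] --> 1 + e * X w.
      by apply: cvgD; [exact: cvg_cst|apply: cvgMr; exact: Xw].
    apply: cvgM => //.
    exact: (cvg_comp _ _ den_cvg (powR_continuous (den _ _ e0 (X0 w)))).
  - apply/integrableP; split; first exact: measurable_cst.
    rewrite (eq_integral (cst (e^-1)%:E)); last first.
      by move=> w _; rewrite /= ger0_norm// invr_ge0 ltW.
    by rewrite integral_cst// lte_mul_pinfty// lee_fin invr_ge0 ltW.
  - by apply: aeW => w n _; rewrite abse_EFin lee_fin ger0_norm ?phi0 ?phi_bound.
have lower e : 0 < e -> (l%:E <= \int[P]_w (X w)%:E + (e * C)%:E)%E.
  move=> e0; apply: (@le_trans _ _ (\int[P]_w (phi e (X w))%:E + (e * C)%:E))%E.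
    have cvgr : (\int[P]_w (phi e (X_ n w))%:E + (e * C)%:E @[n --> \oo] -->
        \int[P]_w (phi e (X w))%:E + (e * C)%:E)%E.
      apply: cvgeD; [|exact: phi_cvg|exact: cvg_cst].
      by rewrite fin_num_adde_defl.
    rewrite -(cvg_lim _ mlE)// -(cvg_lim _ cvgr)//; apply: lee_lim.
    - by apply/cvg_ex; exists l%:E.
    - by apply/cvg_ex; eexists; exact: cvgr.
    apply: nearW => n; rewrite -X_m.
    apply: (@le_trans _ _ (\int[P]_w ((phi e (X_ n w))%:E + e%:E * (X_ n w ^+ 2)%:E)))%E.
      apply: ge0_le_integral => //.
      + by move=> w _; rewrite lee_fin.
      + apply: emeasurable_funD; first by apply/measurable_EFinP; exact: measurableT_comp.
        by apply: measurable_funeM; apply/measurable_EFinP; exact: measurable_funX.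
      + by move=> w _; rewrite -EFinM -EFinD lee_fin phi_diff.
    rewrite ge0_integralD//.
    - rewrite leeD2l// ge0_integralZl//.
      + by rewrite EFinM lee_pmul2l.
      + by apply/measurable_EFinP; exact: measurable_funX.
      + by move=> w _; rewrite lee_fin sqr_ge0.
      + by rewrite lee_fin ltW.
    - by move=> w _; rewrite lee_fin phi0.
    - by apply/measurable_EFinP; exact: measurableT_comp.
    - by move=> w _; rewrite -EFinM lee_fin mulr_ge0 ?sqr_ge0// ltW.
    - by apply: measurable_funeM; apply/measurable_EFinP; exact: measurable_funX.
  rewrite leeD2r//; apply: ge0_le_integral => //.
  + by move=> w _; rewrite lee_fin phi0.
  + by apply/measurable_EFinP; exact: measurableT_comp.
  + by move=> w _; rewrite lee_fin phi_le.
apply/lee_addgt0Pr => e e0; have C10 : 0 < C + 1 by rewrite ltr_wpDl.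
have eC : 0 < e / (C + 1) by rewrite divr_gt0.
apply: le_trans (lower _ eC) _; rewrite leeD2l// lee_fin.
by rewrite -mulrA ler_piMr ?(ltW e0)// mulrC ler_pdivrMr// mul1r lerDl.
Qed.

End almost_sure_convergence.

Section interpolation.
Context {R : realType}.
Implicit Types (Q : nat -> R) (b l : R).

Let between_fourth_powers M n : ((M.+1) ^ 4 <= n)%N ->
  exists2 m, (M <= m)%N & (m.+1 ^ 4 <= n < m.+2 ^ 4)%N.
Proof.
elim: n => [|n IHn]; first by rewrite leqn0 expn_eq0.
rewrite leq_eqVlt => /predU1P[<-|].
  by exists M; rewrite // leqnn /= ltn_exp2r.
rewrite ltnS => /IHn[m Mm /andP[mn nm]].
have [nm'|mn'] := ltnP n.+1 (m.+2 ^ 4).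
  by exists m; rewrite // nm' (leq_trans mn).
exists m.+1; first exact: leqW.
by rewrite mn' /= (leq_ltn_trans nm)// ltn_exp2r.
Qed.

Let fourth_power_ratio b :
  ((m.+2%:R / m.+1%:R : R) ^+ 4) `^ b @[m --> \oo] --> (1 : R).
Proof.
have r1 : m.+2%:R / m.+1%:R @[m --> \oo] --> (1 : R).
  have -> : (fun m : nat => m.+2%:R / m.+1%:R) = (fun m => 1 + harmonic m) :> (nat -> R).
    apply/funext => m; rewrite /harmonic/= -(natr1 m.+1).
    by rewrite mulrDl mulfV ?pnatr_eq0// mul1r.
  by rewrite -[X in _ --> X]addr0; apply: cvgD; [exact: cvg_cst|exact: cvg_harmonic].
have r4 : (m.+2%:R / m.+1%:R) ^+ 4 @[m --> \oo] --> (1 : R).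
  have := cvg_comp _ _ r1 (@exprn_continuous R 4 1).
  by rewrite expr1n => H; apply: cvg_trans H.
have one : (1 : R) `^ b = 1 by rewrite powR1.
have := cvg_comp _ _ r4 (@powR_continuous R b 1 ltr01).
by rewrite one => H; apply: cvg_trans H.
Qed.

(** A monotone sequence that behaves like a power along fourth powers does so
    throughout, since consecutive fourth powers are asymptotically
    equivalent. *)
Lemma cvg_scaled_interpolation Q b l : 0 <= b ->
  (forall n, 0 <= Q n) -> (forall m n, (m <= n)%N -> Q n <= Q m) ->
  (m.+1 ^ 4)%:R `^ b * Q (m.+1 ^ 4)%N @[m --> \oo] --> l ->
  n%:R `^ b * Q n @[n --> \oo] --> l.
Proof.
move=> b0 Q0 Qle Ql.
pose y m := (m.+1 ^ 4)%:R `^ b * Q (m.+1 ^ 4)%N.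
pose rho m : R := ((m.+2%:R / m.+1%:R) ^+ 4) `^ b.
have rho0 m : 0 < rho m by rewrite powR_gt0// exprn_gt0// divr_gt0.
have rhoE m : (m.+2 ^ 4)%:R `^ b = rho m * (m.+1 ^ 4)%:R `^ b.
  rewrite /rho -powRM ?exprn_ge0 ?divr_ge0 ?ler0n//; congr (_ `^ _).
  by rewrite !natrX -exprMn divfK// pnatr_eq0.
have up : rho m * y m @[m --> \oo] --> l.
  by rewrite -(mul1r l); apply: cvgM => //; exact: fourth_power_ratio.
have lo : (rho m)^-1 * y m.+1 @[m --> \oo] --> l.
  rewrite -(mul1r l); apply: cvgM; last by rewrite (cvg_shiftS y).
  by rewrite -invr1; apply: cvgV; [exact: oner_neq0|exact: fourth_power_ratio].
apply/cvgrPdist_lt => e e0.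
have /cvgrPdist_lt/(_ _ e0)[M1 _ H1] := up.
have /cvgrPdist_lt/(_ _ e0)[M2 _ H2] := lo.
exists ((maxn M1 M2).+1 ^ 4)%N => // n /= /between_fourth_powers[m Mm /andP[mn nm]].
have {}H1 := H1 m (leq_trans (leq_maxl _ _) Mm).
have {}H2 := H2 m (leq_trans (leq_maxr _ _) Mm).
have nb0 : 0 <= n%:R `^ b :> R by exact: powR_ge0.
have le_up : n%:R `^ b * Q n <= rho m * y m.
  rewrite /y mulrA -rhoE; apply: ler_pM => //; last exact: Qle.
  by apply: ge0_ler_powR; rewrite ?nnegrE ?ler0n// ler_nat ltnW.
have ge_lo : (rho m)^-1 * y m.+1 <= n%:R `^ b * Q n.
  rewrite /y rhoE !mulrA mulVf ?mul1r ?gt_eqF//.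
  apply: ler_pM; rewrite ?powR_ge0//; last by apply: Qle; exact: ltnW.
  by apply: ge0_ler_powR; rewrite ?nnegrE ?ler0n// ler_nat.
move: H1 H2; rewrite /= !ltr_distlC => /andP[_ h1] /andP[h2 _].
by apply/andP; split; [exact: lt_le_trans ge_lo|exact: le_lt_trans h1].
Qed.

End interpolation.

Section first_from_second.
Context d (Omega : measurableType d) (R : realType) (P : probability Omega R).

(** Integrate [|D| <= w + D ^ 2 / w]. *)
Lemma expectation_norm_le (D : Omega -> R) (w c : R) : 0 < w -> 0 <= c ->
  measurable_fun setT D -> (\int[P]_x (D x ^+ 2)%:E <= (c * w ^+ 2)%:E)%E ->
  (\int[P]_x `|D x|%:E <= ((1 + c) * w)%:E)%E.
Proof.
move=> w0 c0 mD Dc.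
have mD2 : measurable_fun setT (fun x => (D x ^+ 2)%:E).
  by apply/measurable_EFinP; exact: measurable_funX.
apply: (@le_trans _ _ (\int[P]_x (w%:E + (w^-1)%:E * (D x ^+ 2)%:E))%E).
  apply: ge0_le_integral => //.
  - by apply/measurable_EFinP; apply: measurableT_comp.
  - apply: emeasurable_funD => //; exact: measurable_funeM.
  - move=> x _; rewrite -EFinM -EFinD lee_fin -real_normK ?num_real//.
    have : 0 <= `|D x| by [].
    move: `|D x| => y y0; have [yw|/ltW wy] := leP y w.
      by rewrite ler_wpDr// mulr_ge0 ?sqr_ge0// invr_ge0 ltW.
    rewrite ler_wpDl ?(ltW w0)// expr2 mulrA ler_peMl// mulrC ler_pdivlMr//.
    by rewrite mul1r.
rewrite ge0_integralD//.
- rewrite [X in (X + _)%E](integral_cst _ measurableT) mulrDl mul1r.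
  rewrite EFinD; apply: leeD.
    by rewrite [X in (_ * X <= _)%E](probability_setT P) mule1.
  rewrite ge0_integralZl//.
  + have -> : c * w = w^-1 * (c * w ^+ 2) by field; rewrite gt_eqF.
    by rewrite (EFinM w^-1) lee_pmul2l// lte_fin invr_gt0.
  + by move=> x _; rewrite lee_fin sqr_ge0.
  + by rewrite lee_fin invr_ge0 ltW.
- by move=> x _; rewrite lee_fin ltW.
- by move=> x _; rewrite -EFinM lee_fin mulr_ge0 ?sqr_ge0// invr_ge0 ltW.
- exact: measurable_funeM.
Qed.

End first_from_second.

Section telescoping_weights.
Context {R : realType}.
(** Comparable with [1 / m ^ 2], with an explicit sum. *)
Definition telescoping_weight (m : nat) : R := m.+1%:R^-1 - m.+2%:R^-1.

Lemma telescoping_weight_gt0 m : 0 < telescoping_weight m.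
Proof. by rewrite subr_gt0 ltf_pV2 ?posrE ?ltr0n// ltr_nat. Qed.

Lemma sum_telescoping_weight K : \sum_(0 <= m < K) telescoping_weight m <= 1.
Proof.
have -> : \sum_(0 <= m < K) telescoping_weight m = 1 - K.+1%:R^-1.
  elim: K => [|K IHK]; first by rewrite big_geq// invr1 subrr.
  by rewrite big_nat_recr//= IHK addrA subrK.
by rewrite gerBl invr_ge0.
Qed.

Lemma telescoping_weight_sqr m :
  (m.+1 ^ 4)%:R^-1 <= 4 * telescoping_weight m ^+ 2.
Proof.
rewrite /telescoping_weight natrX -(natr1 m.+1).
have : 1 <= m.+1%:R :> R by rewrite ler1n.
move: (m.+1%:R : R) => x x1; have x0 : 0 < x by lra.
have -> : x^-1 - (x + 1)^-1 = (x * (x + 1))^-1 by field; lra.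
have -> : (x ^+ 4)^-1 = 4 * (2 * x ^+ 2)^-1 ^+ 2 by field; lra.
rewrite ler_pM2l// ler_pXn2r// ?nnegrE ?invr_ge0; [|nra|nra].
rewrite lef_pV2 ?posrE; [nra|nra|nra].
Qed.

End telescoping_weights.

(** * Moments of the stick-breaking remainders *)

(* From here on only the properties proved above are used. *)
Opaque Gamma Beta.

Section beta_ratios.
Context {R : realType}.
Variables (alpha theta : R).
Hypotheses (alpha_gt0 : 0 < alpha) (alpha_lt1 : alpha < 1).
Hypothesis theta_gt : - alpha < theta.
Local Notation a := (stick_parameter alpha theta).

Let b0 : 0 < 1 - alpha. Proof. by rewrite subr_gt0. Qed.

Lemma Beta_sym (x y : R) : 0 < x -> 0 < y -> Beta x y = Beta y x.
Proof.
move=> x0 y0; have g0 := Gamma_gt0 (addr_gt0 x0 y0).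
have := Beta_Gamma x0 y0; have := Beta_Gamma y0 x0; rewrite (addrC y x).
move: (Beta x y) (Beta y x) (Gamma x) (Gamma y) (Gamma (x + y)) g0.
move=> B1 B2 G1 G2 G g0 e1 e2; apply: (mulIf (lt0r_neq0 g0)).
by rewrite e1 e2 mulrC.
Qed.

Lemma Beta_le (x x' y : R) : 0 < x -> x <= x' -> 0 < y -> Beta x' y <= Beta x y.
Proof.
move=> x0 xx' y0; have x'0 : 0 < x' by rewrite (lt_le_trans x0).
suff : ((Beta x' y)%:E <= (Beta x y)%:E)%E by rewrite lee_fin.
rewrite -(integral_Beta x0 y0) -(integral_Beta x'0 y0).
have m z : measurable_fun (`]0, 1[%classic : set (measurableTypeR R))
    (fun v : R => (v `^ (z - 1) * (1 - v) `^ (y - 1))%:E).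
  apply/measurable_EFinP; apply: measurable_funTS; exact: measurable_beta_kernel.
apply: ge0_le_integral.
- exact: measurable_itv.
- by move=> v _; rewrite lee_fin mulr_ge0 ?powR_ge0.
- exact: m.
- exact: m.
- move=> v /=; rewrite in_itv/= => /andP[v0 v1].
  rewrite lee_fin ler_wpM2r ?powR_ge0//; apply: ger_powR.
    by rewrite v0 ltW.
  by rewrite lerD2r.
Qed.

(** The normalisation of the beta law of [1 - V_j], whose moment of order
    [alpha * k] is [stick_beta (j + k) / stick_beta j]. *)
Definition stick_beta (j : nat) : R := Beta (a j) (1 - alpha).
Local Notation B := stick_beta.

Lemma stick_beta_gt0 j : (1 <= j)%N -> 0 < B j.
Proof. by move=> j1; apply: Beta_gt0 => //; exact: stick_parameter_gt0. Qed.

(** The [k]-th moment of [R_n ^ alpha], in a form with a number of factors that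
    does not depend on [n]. *)
Definition stick_ratio (k n : nat) : R :=
  \prod_(1 <= j < k.+1) (B (n + j) / B j).
Local Notation M := stick_ratio.

Lemma stick_ratioS k n : M k.+1 n = M k n * (B (n + k.+1) / B k.+1).
Proof. by rewrite /stick_ratio big_nat_recr. Qed.

Lemma stick_ratio0 k : M k 0 = 1.
Proof.
rewrite /stick_ratio big_nat_cond big1// => j /andP[/andP[j1 _] _].
by rewrite add0n mulfV// gt_eqF// stick_beta_gt0.
Qed.

Lemma stick_ratio_gt0 k n : 0 < M k n.
Proof.
elim: k => [|k IHk]; first by rewrite /stick_ratio big_nil.
by rewrite stick_ratioS mulr_gt0// divr_gt0// stick_beta_gt0// addnS.
Qed.

Lemma stick_ratio_step k n : M k n.+1 = M k n * (B (n.+1 + k) / B n.+1).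
Proof.
have Bn : B n.+1 != 0 by rewrite gt_eqF// stick_beta_gt0.
elim: k => [|k IHk].
  by rewrite /stick_ratio !big_nil addn0 (mulfV Bn) mulr1.
rewrite !stick_ratioS IHk !addSn !addnS.
have B1 : B k.+1 != 0 by rewrite gt_eqF// stick_beta_gt0.
move: (B (n + k).+1) (B (n + k).+2) (B k.+1) (B n.+1) (M k n) B1 Bn.
by move=> x y z t u z0 t0; field; rewrite z0 t0.
Qed.

(** The moment of order [alpha * k] shifts the parameter index of a factor by
    [k], so that the product of [n] quotients telescopes to one of [k]. *)
Lemma stick_ratioE k n :
  M k n = \prod_(1 <= j < n.+1) (B (j + k) / B j).
Proof.
elim: n => [|n IHn]; first by rewrite stick_ratio0 big_nil.
rewrite big_nat_recr//= -IHn; exact: stick_ratio_step.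
Qed.

Lemma stick_beta_cvg j : (1 <= j)%N ->
  n.+1%:R `^ (1 - alpha) * B (n.+1 + j) @[n --> \oo] -->
  alpha `^ (alpha - 1) * Gamma (1 - alpha).
Proof.
move=> j1; have bn0 : 1 - alpha != 0 by rewrite gt_eqF.
have a0 n : 0 < a (n.+1 + j) by rewrite stick_parameter_gt0.
have bb : 0 < 1 - alpha <= 1 by rewrite b0 gerBl ltW.
pose h (n : nat) : R := n.+1%:R^-1.
have hcvg : h n @[n --> \oo] --> (0 : R) by exact: cvg_harmonic.
have ratio_cvg : a (n.+1 + j) / n.+1%:R @[n --> \oo] --> alpha.
  have -> : (fun n : nat => a (n.+1 + j) / n.+1%:R) =
      (fun n => (theta + j%:R * alpha) * h n + alpha).
    apply/funext => n; rewrite /h /stick_parameter natrD.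
    have : n.+1%:R != 0 :> R by rewrite pnatr_eq0.
    by move: (n.+1%:R : R) => x x0; field.
  rewrite -[X in _ --> X]add0r; apply: cvgD; last exact: cvg_cst.
  by rewrite -(mulr0 (theta + j%:R * alpha)); apply: cvgMr.
have an0 : alpha^-1 != 0 by rewrite invr_neq0// gt_eqF.
have pow_cvg : (n.+1%:R / a (n.+1 + j)) `^ (1 - alpha) @[n --> \oo] -->
    alpha^-1 `^ (1 - alpha).
  have inv_cvg : n.+1%:R / a (n.+1 + j) @[n --> \oo] --> alpha^-1.
    have -> : (fun n : nat => n.+1%:R / a (n.+1 + j)) =
        (fun n => (a (n.+1 + j) / n.+1%:R)^-1).
      by apply/funext => n; rewrite invf_div.
    by apply: cvgV => //; rewrite gt_eqF.
  apply: (cvg_comp _ _ inv_cvg (@powR_continuous R (1 - alpha) alpha^-1 _)).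
  by rewrite invr_gt0.
have inva_cvg : (a (n.+1 + j))^-1 @[n --> \oo] --> (0 : R).
  have -> : (fun n : nat => (a (n.+1 + j))^-1) =
      (fun n => h n * (a (n.+1 + j) / n.+1%:R)^-1).
    apply/funext => n; rewrite /h invf_div.
    by rewrite mulKf ?pnatr_eq0.
  by rewrite -(mul0r alpha^-1); apply: cvgM => //; apply: cvgV => //; rewrite gt_eqF.
have main : a (n.+1 + j) `^ (1 - alpha) * B (n.+1 + j) @[n --> \oo] -->
    Gamma (1 - alpha).
  apply: (@squeeze_cvgr _ _ _ _ (cst (Gamma (1 - alpha)))
    (fun n => Gamma (1 - alpha) * (1 + (a (n.+1 + j))^-1))).
  - by apply: nearW => n; exact: Beta_bounds.
  - exact: cvg_cst.
  - rewrite -[X in _ --> X]mulr1; apply: cvgMr.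
    by rewrite -[X in _ --> X]addr0; apply: cvgD => //; exact: cvg_cst.
have -> : alpha `^ (alpha - 1) = alpha^-1 `^ (1 - alpha).
  by rewrite -(powR_inv1 (ltW alpha_gt0)) -powRrM mulN1r opprB.
have -> : (fun n : nat => n.+1%:R `^ (1 - alpha) * B (n.+1 + j)) =
    (fun n => (n.+1%:R / a (n.+1 + j)) `^ (1 - alpha) *
       (a (n.+1 + j) `^ (1 - alpha) * B (n.+1 + j))).
  apply/funext => n; rewrite mulrA -powRM ?divr_ge0 ?(ltW (a0 n))//.
  by rewrite divfK// gt_eqF.
exact: cvgM.
Qed.

Lemma diversity_moment_beta k : diversity_moment alpha theta k =
  \prod_(1 <= j < k.+1) (Gamma (1 - alpha) / (alpha * B j)).
Proof.
apply: eq_big_nat => j /andP[j1 _]; have aj := stick_parameter_gt0 alpha_gt0 theta_gt j1.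
have Bj := stick_beta_gt0 j1.
have := Beta_Gamma aj b0; rewrite -/(stick_beta j).
have := Gamma_gt0 aj; move: Bj.
move: (Gamma (a j)) (Gamma (a j + (1 - alpha))) (Gamma (1 - alpha)) (B j).
move=> G1 G2 G3 Bj Bj0 G10 E.
have -> : G2 = G1 * G3 / Bj by rewrite -E mulrC mulKf// gt_eqF.
by field; rewrite !gt_eqF.
Qed.

(** The normalisation that turns [R_n ^ alpha] into
    [n ^ (1 - alpha) * (R_n / alpha) ^ alpha]. *)
Definition diversity_scale (n : nat) : R := alpha `^ (- alpha) * n%:R `^ (1 - alpha).

Lemma cvg_diversity_moment k :
  diversity_scale n.+1 ^+ k * M k n.+1 @[n --> \oo] --> diversity_moment alpha theta k.
Proof.
have c0 : alpha != 0 by rewrite gt_eqF.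
elim: k => [|k IHk].
  rewrite diversity_moment0 /stick_ratio.
  under eq_fun do rewrite big_nil expr0 mulr1.
  exact: cvg_cst.
rewrite diversity_moment_beta big_nat_recr//= -diversity_moment_beta.
have Bk : B k.+1 != 0 by rewrite gt_eqF// stick_beta_gt0.
have -> : (fun n : nat => diversity_scale n.+1 ^+ k.+1 * M k.+1 n.+1) =
   (fun n : nat => diversity_scale n.+1 ^+ k * M k n.+1 *
     (alpha `^ (- alpha) / B k.+1 * (n.+1%:R `^ (1 - alpha) * B (n.+1 + k.+1)))).
  apply/funext => n; rewrite stick_ratioS exprS /diversity_scale.
  move: (_ ^+ k) => u; field.
  by rewrite Bk.
apply: cvgM => //.
have -> : Gamma (1 - alpha) / (alpha * B k.+1) =
    alpha `^ (- alpha) / B k.+1 * (alpha `^ (alpha - 1) * Gamma (1 - alpha)).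
  have E : alpha `^ (- alpha) * alpha `^ (alpha - 1) = alpha^-1.
    rewrite -powRD ?c0 ?implybT// -(powR_inv1 (ltW alpha_gt0)).
    by congr (_ `^ _); ring.
  rewrite invfM -E.
  move: (alpha `^ (- alpha)) (alpha `^ (alpha - 1)) (Gamma _) (B k.+1)^-1.
  by move=> x y z t; ring.
by apply: cvgMr; exact: stick_beta_cvg.
Qed.

(** The second moment of [R_n ^ alpha] divided by its mean is a constant times
    [stick_beta (n + 2) / stick_beta (n + 1)]; one step of the recurrence of
    Beta shows that this quotient is within [O (1 / n)] of its supremum 1. *)
Lemma stick_variance_le n N : (1 <= n <= N)%N ->
  M 2 N / M 1 N ^+ 2 - M 2 n / M 1 n ^+ 2 <=
  B 1 / B 2 * ((1 - alpha) / alpha) / n%:R.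
Proof.
move=> /andP[n1 nN].
have B1 := stick_beta_gt0 (leqnn 1); have B2 := @stick_beta_gt0 2 isT.
have nz m : B m.+1 != 0 := lt0r_neq0 (stick_beta_gt0 (ltn0Sn m)).
pose r m := B m.+2 / B m.+1.
have vE m : M 2 m / M 1 m ^+ 2 = B 1 / B 2 * r m.
  have M0 : M 0 m = 1 by rewrite /stick_ratio big_geq.
  rewrite /r !stick_ratioS M0 mul1r.
  have := nz m.+1; have := nz m.
  rewrite addn1 addn2; move: (B 1) (B 2) (B m.+1) (B m.+2) B1 B2.
  by move=> x y z t x0 y0 z0 t0; field; rewrite z0 !gt_eqF.
rewrite !vE -mulrBr -[leRHS]mulrA.
apply: (ler_wpM2l (ltW (divr_gt0 B1 B2))).
have r1 m : r m <= 1.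
  rewrite /r (ler_pdivrMr _ _ (stick_beta_gt0 (ltn0Sn m))) mul1r /stick_beta stick_parameterS.
  by apply: Beta_le => //; [exact: stick_parameter_gt0|rewrite lerDl ltW].
have an := @stick_parameter_gt0 R alpha theta alpha_gt0 theta_gt n.+1 isT.
have ab0 : 0 < a n.+1 + (1 - alpha) by rewrite addr_gt0.
have rn : a n.+1 / (a n.+1 + (1 - alpha)) <= r n.
  rewrite /r (ler_pdivlMr _ _ (stick_beta_gt0 (ltn0Sn n))) /stick_beta.
  rewrite -(BetaS an b0) (stick_parameterS _ _ n.+1).
  by apply: Beta_le => //; [rewrite addr_gt0|rewrite lerD2l ltW].
apply: (@le_trans _ _ (1 - a n.+1 / (a n.+1 + (1 - alpha)))).
  exact: (lerB (r1 N) rn).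
have -> : 1 - a n.+1 / (a n.+1 + (1 - alpha)) = (1 - alpha) / (a n.+1 + (1 - alpha)).
  by field; rewrite gt_eqF.
rewrite -mulrA ler_wpM2l ?(ltW b0)// -invfM lef_pV2 ?posrE ?mulr_gt0 ?ltr0n//.
rewrite /stick_parameter -natr1 mulrDl mul1r mulrC.
by move: theta_gt alpha_lt1; lra.
Qed.

End beta_ratios.

Section beta_laws.
Context {R : realType}.
Implicit Types (x y : R) (mu : probability R R).

Lemma beta_law_interval mu x y : beta_law x y mu -> mu (~` `]0, 1[) = 0%E.
Proof.
move=> [c [_ _ muE]]; rewrite muE; last by apply: measurableC; exact: measurable_itv.
by rewrite setICl integral_set0.
Qed.

(** Total mass 1 identifies the constant of the law. *)
Lemma ge0_integral_beta_law mu x y (g : R -> R) : 0 < x -> 0 < y ->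
  beta_law x y mu -> measurable_fun setT g -> (forall v, 0 <= g v) ->
  (\int[mu]_v (g v)%:E = ((Beta x y)^-1)%:E * \int[lebesgue_measure]_(v in `]0%R, 1%R[)
     (g v * (v `^ (x - 1) * (1 - v) `^ (y - 1)))%:E)%E.
Proof.
move=> x0 y0 [c mu_c] mg g0.
pose k (v : R) := v `^ (x - 1) * (1 - v) `^ (y - 1).
have mk : measurable_fun setT k by exact: measurable_beta_kernel.
have k0 v : 0 <= k v by rewrite mulr_ge0 ?powR_ge0.
have mD : measurable (`]0, 1[%classic : set R) by exact: measurable_itv.
have c0 : 0 <= c.
  have [_ ck _] := mu_c.
  have half : `]0, 1[%classic (2^-1 : R).
    by rewrite /= in_itv/= invr_gt0 ltr0n/= invf_lt1 ?ltr1n.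
  have := ck _ half; rewrite pmulr_lge0//.
  by rewrite mulr_gt0 ?powR_gt0//; lra.
have dens (u : R -> R) : measurable_fun setT u -> (forall v, 0 <= u v) ->
    (\int[mu]_v (u v)%:E =
     c%:E * \int[lebesgue_measure]_(v in `]0%R, 1%R[) (u v * k v)%:E)%E.
  move=> mu' u0.
  have mE : measurable_fun setT (fun v : R => (u v)%:E) by exact/measurable_EFinP.
  have uE0 v : (0 <= (u v)%:E)%E by rewrite lee_fin.
  rewrite (ge0_integral_has_density mD mu_c mE uE0).
  rewrite (@ge0_lebesgue_integralZl R _ (fun v => u v * k v) c).
  - by apply: eq_integral => v _; rewrite -EFinM mulrCA.
  - exact: measurable_itv.
  - exact: measurable_funM.
  - by move=> v; rewrite mulr_ge0.
  - exact: c0.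
have cB : c = (Beta x y)^-1.
  have := dens (cst 1) (measurable_cst _) (fun=> ler01).
  have -> : (\int[mu]_v (cst 1 v : R)%:E = 1)%E.
    by rewrite [LHS](integral_cst _ measurableT 1%E) mul1e; exact: probability_setT.
  have -> : (\int[lebesgue_measure]_(v in `]0%R, 1%R[) (cst 1 v * k v)%:E =
      (Beta x y)%:E)%E.
    rewrite -(integral_Beta x0 y0); apply: eq_integral => v _.
    by rewrite /= mul1r.
  rewrite -EFinM => -[cB].
  by rewrite -[RHS]mul1r cB mulfK// gt_eqF// Beta_gt0.
by rewrite dens// cB.
Qed.

(** [1 - v] for [v] in the unit interval, which carries the beta laws.  Clipping
    elsewhere makes bounds and monotonicity hold everywhere instead of almost
    surely. *)
Definition remaining (v : R) : R := Num.max 0 (Num.min 1 (1 - v)).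

Lemma remaining_ge0 v : 0 <= remaining v.
Proof. by rewrite /remaining le_max lexx. Qed.

Lemma remaining_le1 v : remaining v <= 1.
Proof. by rewrite /remaining ge_max ler01/= ge_min lexx. Qed.

Lemma remainingE v : 0 < v < 1 -> remaining v = 1 - v.
Proof.
move=> /andP[v0 v1]; rewrite /remaining min_r ?max_r//; last by rewrite gerBl ltW.
by rewrite subr_ge0 ltW.
Qed.

Lemma measurable_remaining : measurable_fun setT remaining.
Proof.
apply: measurable_maxr => //; apply: measurable_minr => //.
exact: measurable_funB.
Qed.

Lemma remaining_moment mu x y (s : R) : 0 < x -> 0 < y -> 0 <= s ->
  beta_law x y mu ->
  (\int[mu]_v (remaining v `^ s)%:E = (Beta x (y + s) / Beta x y)%:E)%E.
Proof.
move=> x0 y0 s0 mu_b; have ys0 : 0 < y + s by rewrite ltr_wpDr.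
rewrite (ge0_integral_beta_law x0 y0 mu_b); last 2 first.
- exact: (measurableT_comp (@measurable_powR R s) measurable_remaining).
- by move=> v; rewrite powR_ge0.
rewrite mulrC EFinM; congr (_ * _)%E.
rewrite -(integral_Beta x0 ys0); apply: eq_integral => v /set_mem/=.
rewrite in_itv/= => /andP[v0 v1]; rewrite remainingE ?v0//.
rewrite mulrCA -powRD; last by rewrite (gt_eqF (_ : 0 < 1 - v)) ?subr_gt0// implybT.
by congr (_ * _ `^ _)%:E; ring.
Qed.

End beta_laws.

Section second_moments.
Context d (Omega : measurableType d) (R : realType).
Variables (P : {measure set Omega -> \bar R}) (X Y : Omega -> R).
Hypotheses (mX : measurable_fun setT X) (mY : measurable_fun setT Y).
Hypotheses (X0 : forall w, 0 <= X w) (Y0 : forall w, 0 <= Y w).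

Lemma expectation_scaled_product (s t c : R) : 0 < s -> 0 < t ->
  (\int[P]_w (X w * Y w)%:E = c%:E)%E ->
  (\int[P]_w (X w / s * (Y w / t))%:E = (c / (s * t))%:E)%E.
Proof.
move=> s0 t0 XYc.
have k0 : 0 <= (s * t)^-1 by rewrite invr_ge0 mulr_ge0// ltW.
rewrite mulrC EFinM -XYc -ge0_integralZl//.
- by apply: eq_integral => w _; rewrite -EFinM invfM mulrACA mulrC.
- by apply/measurable_EFinP; exact: measurable_funM.
- by move=> w _; rewrite lee_fin mulr_ge0.
Qed.

Lemma expectation_sqr_sub (x y c : R) :
  (\int[P]_w (X w * X w)%:E = x%:E)%E -> (\int[P]_w (Y w * Y w)%:E = y%:E)%E ->
  (\int[P]_w (X w * Y w)%:E = c%:E)%E ->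
  (\int[P]_w ((X w - Y w) ^+ 2)%:E = (x + y - 2 * c)%:E)%E.
Proof.
move=> XX YY XY.
have mE (f : Omega -> R) : measurable_fun setT f ->
  measurable_fun setT (fun w => (f w)%:E) by move=> ?; exact/measurable_EFinP.
have mXX := mE _ (measurable_funM mX mX).
have mYY := mE _ (measurable_funM mY mY).
have mXY := mE _ (measurable_funM mX mY).
have mD : measurable_fun setT (fun w => ((X w - Y w) ^+ 2)%:E).
  by apply: mE; apply: measurable_funX; exact: measurable_funB.
have H : (\int[P]_w ((X w - Y w) ^+ 2)%:E + 2%:E * \int[P]_w (X w * Y w)%:E =
    \int[P]_w (X w * X w)%:E + \int[P]_w (Y w * Y w)%:E)%E.
  rewrite -ge0_integralZl//; last by move=> w _; rewrite lee_fin mulr_ge0.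
  rewrite -!ge0_integralD//.
  - by apply: eq_integral => w _; rewrite -EFinM -!EFinD; congr EFin; ring.
  - by move=> w _; rewrite lee_fin mulr_ge0.
  - by move=> w _; rewrite lee_fin mulr_ge0.
  - by move=> w _; rewrite lee_fin sqr_ge0.
  - by move=> w _; rewrite -EFinM lee_fin !mulr_ge0.
  - exact: measurable_funeM.
move: H; rewrite XX YY XY -EFinM -EFinD => H.
have : (\int[P]_w ((X w - Y w) ^+ 2)%:E = (x + y)%:E - (2 * c)%:E)%E.
  by rewrite -H addeK.
by rewrite -EFinB.
Qed.

End second_moments.

Section stick_breaking.
Context d (Omega : measurableType d) (R : realType) (P : probability Omega R).
Variables (alpha theta : R) (V : nat -> {RV P >-> R}).
Hypotheses (alpha_gt0 : 0 < alpha) (alpha_lt1 : alpha < 1).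
Hypothesis theta_gt : - alpha < theta.
Hypothesis V_indep : mutually_independent [set j | (1 <= j)%N] V.
Hypothesis V_beta : forall j, (1 <= j)%N ->
  beta_law (1 - alpha) (theta + j%:R * alpha) (distribution P (V j)).
Local Notation B := (stick_beta alpha theta).
Local Notation M := (stick_ratio alpha theta).
Local Notation a := (stick_parameter alpha theta).

(** Almost surely [R_n ^ alpha], see [stick_power_remainder]. *)
Definition stick_power (n : nat) (w : Omega) : R :=
  \prod_(1 <= j < n.+1) remaining (V j w) `^ alpha.
Local Notation Q := stick_power.

Let b0 : 0 < 1 - alpha. Proof. by rewrite subr_gt0. Qed.

Let ratioE := stick_ratioE alpha_gt0 alpha_lt1 theta_gt.

Let ratio_gt0 := stick_ratio_gt0 alpha_gt0 alpha_lt1 theta_gt.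

Lemma stick_power_ge0 n w : 0 <= Q n w.
Proof. by apply: prodr_ge0 => j _; exact: powR_ge0. Qed.

Lemma stick_power_nonincreasing w m n : (m <= n)%N -> Q n w <= Q m w.
Proof.
elim: n => [|n IHn]; first by rewrite leqn0 => /eqP ->.
rewrite leq_eqVlt => /predU1P[->//|]; rewrite ltnS => /IHn; apply: le_trans.
rewrite /stick_power big_nat_recr//= ler_piMr ?stick_power_ge0//.
apply: (@le_trans _ _ (1 `^ alpha)); last by rewrite powR1.
apply: ge0_ler_powR.
- exact: ltW.
- by rewrite nnegrE remaining_ge0.
- by rewrite nnegrE.
- exact: remaining_le1.
Qed.

Lemma measurable_stick_power n : measurable_fun setT (Q n).
Proof.
apply: measurable_prod => j _; apply: (measurableT_comp (@measurable_powR R _)).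
exact: (measurableT_comp measurable_remaining).
Qed.

Let factor_moment j k : (1 <= j)%N ->
  (\int[P]_w ((remaining (V j w) `^ alpha) ^+ k)%:E = (B (j + k) / B j)%:E)%E.
Proof.
move=> j1; have aj := stick_parameter_gt0 alpha_gt0 theta_gt j1.
have s0 : 0 <= k%:R * alpha by rewrite mulr_ge0// ltW.
have mg : measurable_fun setT (fun v : R => (remaining v `^ (k%:R * alpha))%:E).
  apply/measurable_EFinP.
  exact: (measurableT_comp (@measurable_powR R _) measurable_remaining).
have g0 (v : R) : (0 <= (remaining v `^ (k%:R * alpha))%:E)%E.
  by rewrite lee_fin powR_ge0.
have := remaining_moment b0 aj s0 (V_beta j1).
rewrite (ge0_integral_distribution (V j) mg g0).
rewrite /stick_beta (Beta_sym b0 aj).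
have -> : a j + k%:R * alpha = a (j + k)%N.
  by rewrite /stick_parameter natrD; ring.
have ajk : 0 < a (j + k)%N by rewrite stick_parameter_gt0// (leq_trans j1)// leq_addr.
rewrite (Beta_sym b0 ajk) => <-; apply: eq_integral => w _ /=.
by rewrite -powR_mulrn ?powR_ge0// -powRrM mulrC.
Qed.

Lemma stick_power_moment n k : (\int[P]_w (Q n w ^+ k)%:E = (M k n)%:E)%E.
Proof.
rewrite ratioE.
rewrite -(@expectation_prod _ _ _ P V V_indep n
  (fun _ v => (remaining v `^ alpha) ^+ k) (fun j => B (j + k) / B j)).
- by apply: eq_integral => w _; rewrite /stick_power prodrXl.
- move=> j; apply: measurable_funX.
  exact: (measurableT_comp (@measurable_powR R _) measurable_remaining).
- by move=> j x; rewrite exprn_ge0// powR_ge0.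
- by move=> j j1; exact: factor_moment.
Qed.

(** The first [n] fractions occur squared, the others once. *)
Lemma stick_power_cross n N : (n <= N)%N ->
  (\int[P]_w (Q N w * Q n w)%:E = (M 2 n * (M 1 N / M 1 n))%:E)%E.
Proof.
move=> nN.
pose c j := if (j <= n)%N then 2%N else 1%N.
have cut (F : nat -> R) : \prod_(1 <= j < N.+1) F j =
    \prod_(1 <= j < n.+1) F j * \prod_(n.+1 <= j < N.+1) F j.
  by rewrite (@big_cat_nat _ _ _ n.+1)//=.
have highE (F : nat -> nat -> R) :
    \prod_(n.+1 <= j < N.+1) F j (c j) = \prod_(n.+1 <= j < N.+1) F j 1%N.
  by apply: eq_big_nat => j /andP[jn _]; rewrite /c leqNgt jn.
have lowE' (F : nat -> nat -> R) :
    \prod_(1 <= j < n.+1) F j (c j) = \prod_(1 <= j < n.+1) F j 2%N.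
  by apply: eq_big_nat => j /andP[_ jn]; rewrite /c -ltnS jn.
have M10 : M 1 n != 0 by rewrite gt_eqF// ratio_gt0.
have -> : M 2 n * (M 1 N / M 1 n) = \prod_(1 <= j < N.+1) (B (j + c j) / B j).
  rewrite cut (lowE' (fun j k => B (j + k) / B j)) (highE (fun j k => B (j + k) / B j)).
  rewrite -ratioE; congr (_ * _).
  rewrite (ratioE 1 N) cut -ratioE.
  by rewrite mulrAC mulfV// mul1r.
rewrite -(@expectation_prod _ _ _ P V V_indep N
  (fun j v => (remaining v `^ alpha) ^+ (c j)) (fun j => B (j + c j) / B j)).
- apply: eq_integral => w _; congr EFin.
  rewrite cut (lowE' (fun j k => (remaining (V j w) `^ alpha) ^+ k)).
  rewrite (highE (fun j k => (remaining (V j w) `^ alpha) ^+ k)).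
  by rewrite /stick_power cut prodrXl expr2 mulrAC.
- move=> j; apply: measurable_funX.
  exact: (measurableT_comp (@measurable_powR R _) measurable_remaining).
- by move=> j x; rewrite exprn_ge0// powR_ge0.
- by move=> j j1; exact: factor_moment.
Qed.

(** A martingale, bounded in [L^2]. *)
Definition normalized_stick n w := Q n w / M 1 n.
Local Notation Z := normalized_stick.

Lemma measurable_normalized_stick n : measurable_fun setT (Z n).
Proof. by apply: measurable_funM => //; exact: measurable_stick_power. Qed.

Let Z0 n w : 0 <= Z n w.
Proof. by rewrite divr_ge0 ?stick_power_ge0// ltW// ratio_gt0. Qed.

Let Z_cross n N : (n <= N)%N ->
  (\int[P]_w (Z N w * Z n w)%:E = (M 2 n / M 1 n ^+ 2)%:E)%E.
Proof.
move=> nN.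
have M1n : 0 < M 1 n by exact: ratio_gt0.
have M1N : 0 < M 1 N by exact: ratio_gt0.
have mQ m := measurable_stick_power m.
have Q0 m := @stick_power_ge0 m.
rewrite [LHS](expectation_scaled_product (mQ N) (mQ n) (Q0 N) (Q0 n) M1N M1n
  (stick_power_cross nN)).
move: (M 1 N) (M 1 n) (M 2 n) M1n M1N => x y z y0 x0.
by congr EFin; field; rewrite !gt_eqF.
Qed.

(** By orthogonality, the mean square of an increment is the increment of the
    mean squares. *)
Lemma normalized_stick_increment n N : (1 <= n <= N)%N ->
  (\int[P]_w ((Z N w - Z n w) ^+ 2)%:E <=
   (B 1 / B 2 * ((1 - alpha) / alpha) / n%:R)%:E)%E.
Proof.
move=> nN; have /andP[_ nN'] := nN.
have := stick_variance_le alpha_gt0 alpha_lt1 theta_gt nN.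
rewrite [X in (X <= _)%E](expectation_sqr_sub (measurable_normalized_stick N) (measurable_normalized_stick n) (Z0 N) (Z0 n)
  (Z_cross (leqnn N)) (Z_cross (leqnn n)) (Z_cross nN')).
move: (M 2 N / _) (M 2 n / _) (B 1 / _ * _ / _) => u v c uv.
by rewrite lee_fin; apply: le_trans uv; lra.
Qed.

End stick_breaking.

(** * The diversity of the remainders *)

Section diversity.
Context d (Omega : measurableType d) (R : realType) (P : probability Omega R).
Variables (alpha theta : R) (V : nat -> {RV P >-> R}).
Hypotheses (alpha_gt0 : 0 < alpha) (alpha_lt1 : alpha < 1).
Hypothesis theta_gt : - alpha < theta.
Hypothesis V_indep : mutually_independent [set j | (1 <= j)%N] V.
Hypothesis V_beta : forall j, (1 <= j)%N ->
  beta_law (1 - alpha) (theta + j%:R * alpha) (distribution P (V j)).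
Local Notation B := (stick_beta alpha theta).
Local Notation M := (stick_ratio alpha theta).
Local Notation Q := (stick_power alpha V).
Local Notation Z := (normalized_stick alpha theta V).
Local Notation S := (diversity_scale alpha).

Let ratio_gt0 := stick_ratio_gt0 alpha_gt0 alpha_lt1 theta_gt.

(** Fourth powers make the mean squares [O (m ^ -4)] of the increments, and
    hence their means [O (m ^ -2)], summable. *)
Lemma ae_cvgn_normalized_stick :
  {ae P, forall w, cvgn (fun m => Z (m.+1 ^ 4)%N w)}.
Proof.
pose C := B 1 / B 2 * ((1 - alpha) / alpha).
have C0 : 0 <= C.
  have B1 := stick_beta_gt0 alpha_gt0 alpha_lt1 theta_gt (leqnn 1).
  have B2 := @stick_beta_gt0 _ _ _ alpha_gt0 alpha_lt1 theta_gt 2 isT.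
  have b0 : 0 < 1 - alpha by rewrite subr_gt0.
  exact: (mulr_ge0 (ltW (divr_gt0 B1 B2)) (ltW (divr_gt0 b0 alpha_gt0))).
have mZ n := measurable_normalized_stick alpha theta V n.
apply: (@ae_cvgn_summable _ _ _ P (fun m w => Z (m.+1 ^ 4)%N w) (1 + C * 4)).
  by move=> m; exact: mZ.
move=> K; apply: (@le_trans _ _
  (\sum_(0 <= m < K) ((1 + C * 4) * telescoping_weight m)%:E)%E).
  apply: lee_sum => m _; apply: expectation_norm_le.
  - exact: telescoping_weight_gt0.
  - exact: mulr_ge0.
  - exact: measurable_funB.
  - have mm : (1 <= m.+1 ^ 4 <= m.+2 ^ 4)%N by rewrite expn_gt0 leq_exp2r// leqnSn.
    apply: le_trans (normalized_stick_increment alpha_gt0 alpha_lt1 theta_gt V_indep V_beta mm) _.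
    by rewrite lee_fin -[leRHS]mulrA; apply: (ler_wpM2l C0); exact: telescoping_weight_sqr.
rewrite sumEFin lee_fin -mulr_sumr ler_piMr//; last exact: sum_telescoping_weight.
by rewrite addr_ge0// mulr_ge0.
Qed.

(** The normalising means are asymptotic to a power of [n], which reduces the
    statement to the martingale along fourth powers. *)
Lemma ae_cvgn_stick_power :
  {ae P, forall w, cvgn (fun n => S n.+1 * Q n.+1 w)}.
Proof.
apply: filterS ae_cvgn_normalized_stick => w /cvg_ex[z Zz].
have fourth_ge m : (m <= (m.+1 ^ 4).-1)%N.
  by rewrite -ltnS prednK ?expn_gt0//; exact: (@leq_pexp2l m.+1 1 4).
have fourth : (m.+1 ^ 4).-1 @[m --> \oo] --> \oo.
  apply/cvgnyPge => A; exists A => // m Am.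
  exact: leq_trans Am (fourth_ge m).
have Sq : S (m.+1 ^ 4)%N * M 1 (m.+1 ^ 4)%N @[m --> \oo] --> diversity_moment alpha theta 1.
  have := cvg_comp _ _ fourth (@cvg_diversity_moment _ _ _ alpha_gt0 alpha_lt1 theta_gt 1%N).
  apply: cvg_trans; apply: near_eq_cvg; apply: nearW => m.
  have pE : (m.+1 ^ 4).-1.+1 = (m.+1 ^ 4)%N by rewrite prednK ?expn_gt0.
  exact: (congr1 (fun k => S k ^+ 1 * M 1 k) pE).
have QE m : S m * Q m w = S m * M 1 m * Z m w.
  by rewrite /normalized_stick -mulrA (mulrC (M 1 m)) divfK// gt_eqF// ratio_gt0.
have SQ : S (m.+1 ^ 4)%N * Q (m.+1 ^ 4)%N w @[m --> \oo] -->
    diversity_moment alpha theta 1 * z.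
  by under eq_fun do rewrite QE; exact: cvgM.
have a0 : alpha `^ alpha != 0 by rewrite gt_eqF// powR_gt0.
have SE m : alpha `^ alpha * (S m * Q m w) = m%:R `^ (1 - alpha) * Q m w.
  by rewrite /diversity_scale powRN; field.
have b0 : 0 <= 1 - alpha by rewrite subr_ge0 ltW.
have nQ : n%:R `^ (1 - alpha) * Q n w @[n --> \oo] -->
    alpha `^ alpha * (diversity_moment alpha theta 1 * z).
  apply: (cvg_scaled_interpolation (Q := Q ^~ w)) => //.
  - by move=> n; exact: stick_power_ge0.
  - by move=> m n; exact: stick_power_nonincreasing.
  - by under eq_fun do rewrite -SE; exact: cvgMr.
apply/cvg_ex; exists (diversity_moment alpha theta 1 * z).
rewrite (cvg_shiftS (fun n => S n * Q n w)).
have -> : (fun n => S n * Q n w) =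
    (fun n => (alpha `^ alpha)^-1 * (n%:R `^ (1 - alpha) * Q n w)).
  by apply/funext => n; rewrite -SE mulKf.
by rewrite -(mulKf a0 (diversity_moment alpha theta 1 * z)); exact: cvgMr.
Qed.

(** The [alpha]-diversity: the almost sure limit of
    [n ^ (1 - alpha) * (R_n / alpha) ^ alpha].  The upper limit is a version of
    it that is defined and measurable everywhere. *)
Definition diversity (w : Omega) : R :=
  fine (limn_esup (fun n => (S n.+1 * Q n.+1 w)%:E)).

Let scaled_ge0 n w : 0 <= S n * Q n w.
Proof. by rewrite mulr_ge0 ?stick_power_ge0// mulr_ge0 ?powR_ge0. Qed.

Lemma diversity_ge0 w : 0 <= diversity w.
Proof.
rewrite /diversity; apply: fine_ge0.
rewrite limn_esup_lim; apply: lime_ge; first exact: is_cvg_esups.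
apply: nearW => n; apply: (@le_trans _ _ (S n.+1 * Q n.+1 w)%:E).
  by rewrite lee_fin.
by apply: ereal_sup_ubound; exists n => //=.
Qed.

Let measurable_scaled n : measurable_fun setT (fun w => S n.+1 * Q n.+1 w).
Proof. by apply: measurable_funM => //; exact: measurable_stick_power. Qed.

Lemma measurable_diversity : measurable_fun setT diversity.
Proof.
apply: (measurableT_comp (fine_measurable measurableT)).
by apply: measurable_fun_limn_esup => n; apply/measurable_EFinP.
Qed.

Lemma cvg_diversity :
  {ae P, forall w, S n.+1 * Q n.+1 w @[n --> \oo] --> diversity w}.
Proof.
apply: filterS ae_cvgn_stick_power => w /cvg_ex[l Sl].
have SlE : (S n.+1 * Q n.+1 w)%:E @[n --> \oo] --> l%:E.
  by apply: cvg_EFin => //; exact: nearW.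
rewrite /diversity is_cvg_limn_esupE; last by apply/cvg_ex; exists l%:E.
by rewrite (cvg_lim _ SlE).
Qed.

Lemma expectation_diversity k :
  (\int[P]_w (diversity w ^+ k)%:E = (diversity_moment alpha theta k)%:E)%E.
Proof.
have mom n j : (\int[P]_w ((S n.+1 * Q n.+1 w) ^+ j)%:E =
    (S n.+1 ^+ j * M j n.+1)%:E)%E.
  rewrite (EFinM (S n.+1 ^+ j)).
  rewrite -(stick_power_moment alpha_gt0 alpha_lt1 theta_gt V_indep V_beta n.+1 j).
  rewrite -ge0_integralZl//.
  - by apply: eq_integral => w _; rewrite exprMn EFinM.
  - by apply/measurable_EFinP; apply: measurable_funX; exact: measurable_stick_power.
  - by move=> w _; rewrite lee_fin exprn_ge0// stick_power_ge0.
  - by rewrite lee_fin exprn_ge0// mulr_ge0// powR_ge0.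
have lim j := @cvg_diversity_moment _ _ _ alpha_gt0 alpha_lt1 theta_gt j.
have [C [_ boundC]] := cvg_seq_bounded (cvgP _ (lim (2 * k)%N)).
apply: (@moment_limit _ _ _ P (fun n w => (S n.+1 * Q n.+1 w) ^+ k) _
  (fun n => S n.+1 ^+ k * M k n.+1) _ (C + 1)).
- by rewrite [X in (X < _)%E](probability_setT P) ltry.
- by move=> n; exact: measurable_funX.
- exact: measurable_funX measurable_diversity.
- by move=> n w; rewrite exprn_ge0.
- by move=> w; rewrite exprn_ge0// diversity_ge0.
- apply: filterS cvg_diversity => w Yw.
  exact: (cvg_comp _ _ Yw (@exprn_continuous R k (diversity w))).
- by move=> n; exact: mom.
- exact: lim.
- move=> n; under eq_integral do rewrite -exprM mulnC.
  rewrite mom lee_fin; apply: (le_trans (ler_norm _)).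
  by apply: boundC => //; rewrite ltrDl.
Qed.

End diversity.

(** * Inverting a power law *)

Section truncation.
Context {R : realType}.
Variable r : nat -> R.
Hypothesis r_gt0 : forall n, 0 < r n.
Hypothesis r_nonincreasing : forall n, r n.+1 <= r n.

Let r_le m n : (m <= n)%N -> r n <= r m.
Proof.
elim: n => [|n IHn]; first by rewrite leqn0 => /eqP ->.
rewrite leq_eqVlt => /predU1P[->//|]; rewrite ltnS => /IHn.
exact: le_trans.
Qed.

Lemma truncation_pointP N eps : (1 <= N)%N -> 0 < eps -> eps < r N ->
  (exists2 n, (1 <= n)%N & r n < eps) ->
  exists2 n, (N <= n)%N & truncation_point r eps = n.+1 /\ r n.+1 < eps <= r n.
Proof.
move=> N1 eps0 epsN [k k1 rk]; rewrite /truncation_point.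
case: pselect => [h|[]]; last by exists k; rewrite k1.
case: ex_minnP => [[|n]]; first by rewrite ltnn.
move=> /andP[_ rn] nmin; exists n.
  rewrite leqNgt; apply/negP => /r_le rNn.
  by have := le_lt_trans rNn rn; rewrite ltNge (ltW epsN).
have Nn : (N <= n)%N.
  rewrite leqNgt; apply/negP => /r_le rNn.
  by have := le_lt_trans rNn rn; rewrite ltNge (ltW epsN).
split => //; rewrite rn leNgt /=; apply/negP => rn'.
have := nmin n; rewrite rn' (leq_trans N1 Nn) => /(_ isT).
by rewrite ltnn.
Qed.

(** The truncation point jumps between consecutive values of the remainder,
    where the two sides agree asymptotically by assumption; monotonicity takes
    care of the values of [eps] in between. *)
Lemma cvg_truncation_point (c p : R) : 0 < c -> 0 < p ->
  n%:R * (r n * c) `^ p @[n --> \oo] --> (1 : R) ->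
  ((truncation_point r eps)%:R - 1) / (eps * c) `^ (- p)
    @[eps --> 0^'+] --> (1 : R).
Proof.
move=> c0 p0 r1.
pose u n : R := n%:R * (r n * c) `^ p.
have u1 : u n @[n --> \oo] --> (1 : R) by exact: r1.
have mono x y : 0 < x -> x <= y -> (x * c) `^ p <= (y * c) `^ p.
  move=> x0 xy; have y0 := lt_le_trans x0 xy.
  by rewrite ge0_ler_powR ?(ltW p0) ?nnegrE ?mulr_ge0 ?(ltW c0) ?(ltW x0) ?(ltW y0)// ler_wpM2r ?(ltW c0).
have reach eps : 0 < eps -> exists2 n, (1 <= n)%N & r n < eps.
  move=> eps0; apply: contrapT => nex.
  have k0 : 0 < (eps * c) `^ p by rewrite powR_gt0// mulr_gt0.
  have /cvgrPdist_lt/(_ _ ltr01)[N _ HN] := u1.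
  (* Otherwise [u n] would be at least a positive multiple of [n]. *)
  pose n := maxn N (Num.truncn (2 / (eps * c) `^ p)).+1.
  have n1 : (1 <= n)%N by rewrite leq_max orbT.
  have := HN n (leq_maxl _ _); rewrite /= ltr_distlC => /andP[_].
  apply/negP; rewrite -leNgt; apply: (@le_trans _ _ (n%:R * (eps * c) `^ p)).
    rewrite -ler_pdivrMr// ltW// (lt_le_trans (truncnS_gt _))// ler_nat.
    exact: leq_maxr.
  rewrite ler_wpM2l// mono// leNgt; apply/negP => rn.
  by apply: nex; exists n.
have lo : n%:R / n.+1%:R * u n.+1 @[n --> \oo] --> (1 : R).
  have h1 : n%:R / n.+1%:R @[n --> \oo] --> (1 : R).
    have -> : (fun n : nat => n%:R / n.+1%:R) = (fun n => 1 - harmonic n) :> (nat -> R).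
      apply/funext => n; rewrite /harmonic/= -(natr1 n).
      have : n%:R + 1 != 0 :> R by rewrite natr1 pnatr_eq0.
      by move: (n%:R : R) => x x0; field.
    by rewrite -[X in _ --> X]subr0; apply: cvgB; [exact: cvg_cst|exact: cvg_harmonic].
  have u1' : u n.+1 @[n --> \oo] --> (1 : R) by rewrite (cvg_shiftS u).
  rewrite -[X in _ --> X](mulr1 (1 : R)); exact: cvgM.
apply/cvgrPdist_lt => e e0.
have /cvgrPdist_lt/(_ _ e0)[N1 _ H1] := u1.
have /cvgrPdist_lt/(_ _ e0)[N2 _ H2] := lo.
pose N := (maxn N1 N2).+1.
near=> eps.
have eps0 : 0 < eps by near: eps; exact: nbhs_right_gt.
have epsN : eps < r N by near: eps; apply: nbhs_right_lt.
have [n Nn [-> /andP[rn1 rn]]] := truncation_pointP (ltn0Sn _) eps0 epsN (reach _ eps0).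
have {}H1 := H1 n (leq_trans (leqW (leq_maxl _ _)) Nn).
have {}H2 := H2 n (leq_trans (leqW (leq_maxr _ _)) Nn).
rewrite -natr1 addrK powRN invrK.
have le_u : n%:R * (eps * c) `^ p <= u n by rewrite ler_wpM2l// mono.
have ge_u : n%:R / n.+1%:R * u n.+1 <= n%:R * (eps * c) `^ p.
  rewrite /u mulrA divfK ?pnatr_eq0// ler_wpM2l// mono// ?r_gt0//.
  exact: ltW.
move: H1 H2; rewrite /= !ltr_distlC => /andP[_ h1] /andP[h2 _].
by apply/andP; split; [exact: lt_le_trans ge_u|exact: le_lt_trans h1].
Unshelve. all: by end_near.
Qed.

End truncation.

(** * The law of the limit *)

Section tilted_stable_law.
Context {R : realType}.
Variables (alpha theta : R).
Hypotheses (alpha_gt0 : 0 < alpha) (alpha_lt1 : alpha < 1).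
Hypothesis theta_gt : - alpha < theta.
Variable f : R -> R.
Hypothesis f_stable : positive_stable_density alpha f.
Local Notation g := (tilted_stable_density alpha theta f).

Let D : set R := `]0, +oo[%classic.

Let mD : measurable D. Proof. exact: measurable_itv. Qed.

Let mg : measurable_fun D g.
Proof. exact: tilted_stable_density_measurable. Qed.

Let mh : @measurable_fun _ _ (measurableTypeR R) R setT (g \_ D).
Proof. by apply/(measurable_restrictT g) => //. Qed.

Let h0 t : 0 <= (g \_ D) t.
Proof.
rewrite /patch; case: ifPn => // /set_mem tD.
by apply: (tilted_stable_density_ge0 alpha_gt0 alpha_lt1 theta_gt f_stable).
Qed.

(** Both [Y] and the power [t ^ (- alpha)] under the tilted stable law have the
    moments [diversity_moment], which determine a law. *)
Lemma moments_tilted_stable_law d (Omega : measurableType d)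
    (P : probability Omega R) (Y : Omega -> R) :
  measurable_fun setT Y -> (forall w, 0 <= Y w) ->
  (forall k, \int[P]_w (Y w ^+ k)%:E = (diversity_moment alpha theta k)%:E)%E ->
  forall A : set R, measurable A ->
    P (Y @^-1` A) =
    (\int[lebesgue_measure]_(t in (fun t => (t `^ (- alpha))%R) @^-1` A `&` D) (g t)%:E)%E.
Proof.
move=> mY Y0 Yq A mA.
pose nu : {measure set (measurableTypeR R) -> \bar R} :=
  density (lebesgue_measure : {measure set (measurableTypeR R) -> \bar R}) mh h0.
pose Y2 (t : measurableTypeR R) : R := t `^ (- alpha).
have mY2 : measurable_fun setT Y2 by exact: (@measurable_powR R (- alpha)).
have Y2_0 t : 0 <= Y2 t by exact: powR_ge0.
have nuq k : (\int[nu]_t (Y2 t ^+ k)%:E = (diversity_moment alpha theta k)%:E)%E.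
  rewrite -(tilted_stable_moment alpha_gt0 alpha_lt1 theta_gt f_stable k).
  apply: etrans (ge0_integral_density _ mh h0 _ _) _.
  - by apply/measurable_EFinP; exact: measurable_funX.
  - by move=> t; rewrite lee_fin exprn_ge0.
  rewrite [RHS]integral_mkcond; apply: eq_integral => t _.
  by rewrite /patch; case: ifP => _; rewrite -EFinM// mulr0.
have expY := diversity_exponential_moment alpha_gt0 alpha_lt1 theta_gt mY Y0 Yq.
have exp2 := diversity_exponential_moment alpha_gt0 alpha_lt1 theta_gt mY2 Y2_0 nuq.
have -> := moment_determination mY mY2 Y0 Y2_0 expY exp2 Yq nuq mA.
rewrite [LHS]/= /density integral_mkcondr.
by apply: eq_integral => t _; rewrite /patch/=; case: ifP.
Qed.

End tilted_stable_law.

Section inverse_power.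
Context {R : realType}.
Variables (alpha theta : R).
Hypotheses (alpha_gt0 : 0 < alpha) (alpha_lt1 : alpha < 1).
Hypothesis theta_gt : - alpha < theta.
Variable f : R -> R.
Hypothesis f_stable : positive_stable_density alpha f.
Context d (Omega : measurableType d) (P : probability Omega R).
Variable Y : Omega -> R.
Hypotheses (mY : measurable_fun setT Y) (Y0 : forall w, 0 <= Y w).
Hypothesis Yq : forall k,
  (\int[P]_w (Y w ^+ k)%:E = (diversity_moment alpha theta k)%:E)%E.

Let law := moments_tilted_stable_law alpha_gt0 alpha_lt1 theta_gt f_stable mY Y0 Yq.

(** The power [t ^ (- alpha)] is positive on the support of the tilted law. *)
Lemma ae_moments_gt0 : {ae P, forall w, 0 < Y w}.
Proof.
exists (Y @^-1` [set 0]); split.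
- by rewrite -[X in measurable X]setTI; exact: mY.
- rewrite law// [X in integral _ X _](_ : _ = set0) ?integral_set0//.
  apply/seteqP; split => // t [/= t0]; rewrite in_itv/= andbT => t_gt0.
  by have := powR_gt0 (- alpha) t_gt0; rewrite t0 ltxx.
- move=> w /= /negP; rewrite -leNgt => Yw.
  by apply/eqP; rewrite eq_le Yw Y0.
Qed.

Lemma inverse_power_density (T : {RV P >-> R}) :
  (forall w, T w = Y w `^ (- alpha^-1)) ->
  has_density_on (distribution P T) `]0, +oo[
    (tilted_stable_density alpha theta f).
Proof.
move=> TE; split.
- exact: tilted_stable_density_measurable.
- by move=> t; apply: tilted_stable_density_ge0.
move=> A mA.
apply: (@etrans _ _ (P (Y @^-1` ((fun y => y `^ (- alpha^-1)) @^-1` A)))).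
  by rewrite /distribution/= /pushforward; congr (P _); apply/seteqP; split => w /=; rewrite TE.
rewrite law; last first.
  by rewrite -[X in measurable X]setTI; exact: (@measurable_powR R (- alpha^-1)).
congr (integral _ _ _); apply/seteqP; split => t [/= + tD]; move: (tD); rewrite /= in_itv/= andbT => t0;
  by rewrite -powRrM mulrNN divff ?gt_eqF// powRr1 ?(ltW t0).
Qed.

End inverse_power.

(** * Asymptotics of the truncation point *)

Section sticks.
Context d (Omega : measurableType d) (R : realType) (P : probability Omega R).
Variable V : nat -> {RV P >-> R}.

Lemma ae_sticks (a b : nat -> R) :
  (forall j, (1 <= j)%N -> beta_law (a j) (b j) (distribution P (V j))) ->
  {ae P, forall w j, (1 <= j)%N -> 0 < V j w < 1}.
Proof.
move=> V_beta; apply: ae_foralln => -[|j]; first by apply: aeW.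
exists (V j.+1 @^-1` (~` `]0, 1[)); split.
- apply: (measurable_funPTI (V j.+1) (measurableC _)).
  exact: measurable_itv.
- exact: beta_law_interval (V_beta j.+1 isT).
- by move=> w /= nV; rewrite in_itv/= => Vw; apply: nV.
Qed.

Lemma stick_remainder_gt0 w n : (forall j, (1 <= j)%N -> 0 < V j w < 1) ->
  0 < stick_remainder (fun j => V j w) n.
Proof.
move=> Vw; rewrite /stick_remainder; elim: n => [|n IHn].
  by rewrite big_geq.
rewrite big_nat_recr//= mulr_gt0// subr_gt0.
by have /andP[] := Vw n.+1 isT.
Qed.

Lemma stick_remainderS_le w n : (forall j, (1 <= j)%N -> 0 < V j w < 1) ->
  stick_remainder (fun j => V j w) n.+1 <= stick_remainder (fun j => V j w) n.
Proof.
move=> Vw; rewrite /stick_remainder big_nat_recr//= ler_piMr//.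
  by apply: ltW; exact: stick_remainder_gt0.
by have /andP[V0 _] := Vw n.+1 isT; rewrite gerBl ltW.
Qed.

Lemma stick_power_remainder alpha w n :
  (forall j, (1 <= j)%N -> 0 < V j w < 1) ->
  stick_power alpha V n w = stick_remainder (fun j => V j w) n `^ alpha.
Proof.
move=> Vw; elim: n => [|n IHn].
  by rewrite /stick_power /stick_remainder !big_geq// powR1.
have -> : stick_power alpha V n.+1 w =
    stick_power alpha V n w * remaining (V n.+1 w) `^ alpha.
  by rewrite /stick_power big_nat_recr.
have -> : stick_remainder (fun j => V j w) n.+1 =
    stick_remainder (fun j => V j w) n * (1 - V n.+1 w).
  by rewrite /stick_remainder big_nat_recr.
rewrite IHn remainingE ?Vw// powRM//.
  by apply: ltW; exact: stick_remainder_gt0.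
by have /andP[_ V1] := Vw n.+1 isT; rewrite subr_ge0 ltW.
Qed.

End sticks.

(** With [T = Y ^ (- 1 / alpha)], the left-hand side is the quotient of [n] by the
    asymptotic equivalent of the truncation point at [eps = r]. *)
Lemma scaled_remainderE (R : realType) (alpha r Y : R) (n : nat) :
  0 < alpha -> alpha < 1 -> 0 <= r -> 0 < Y ->
  n%:R * (r * (Y `^ (- alpha^-1) / alpha)) `^ (alpha / (1 - alpha)) =
  (diversity_scale alpha n * r `^ alpha / Y) `^ (1 - alpha)^-1.
Proof.
move=> a0 a1 r0 Y0; have b0 : 0 < 1 - alpha by rewrite subr_gt0.
have an0 : alpha != 0 by rewrite gt_eqF.
have bn0 : 1 - alpha != 0 by rewrite gt_eqF.
have Yi0 : 0 <= Y^-1 by rewrite invr_ge0 ltW.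
rewrite /diversity_scale !powRM ?mulr_ge0 ?powR_ge0 ?invr_ge0 ?(ltW a0) ?(ltW Y0)//.
have inv x y : 0 < x -> x^-1 `^ y = x `^ (- y).
  by move=> x0; rewrite -(powR_inv1 (ltW x0)) -powRrM mulN1r.
rewrite !inv// -!powRrM divff// powRr1 ?ler0n//.
have -> : - alpha^-1 * (alpha / (1 - alpha)) = - (1 - alpha)^-1.
  by field; rewrite an0 bn0.
rewrite mulNr; move: (_ `^ _) (_ `^ _) (_ `^ _) => x y z; ring.
Qed.

Theorem theorem2 (R : realType) (alpha theta : R)
    (alpha_gt0 : 0 < alpha) (alpha_lt1 : alpha < 1) (theta_gt : - alpha < theta)
    (f : R -> R) (f_stable : positive_stable_density alpha f)
    (d : measure_display) (Omega : measurableType d) (P : probability Omega R)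
    (V : nat -> {RV P >-> R})
    (V_indep : mutually_independent [set j | (1 <= j)%N] V)
    (V_beta : forall j, (1 <= j)%N ->
       beta_law (1 - alpha) (theta + j%:R * alpha) (distribution P (V j))) :
  exists T : {RV P >-> R},
    has_density_on (distribution P T) `]0, +oo[
      (tilted_stable_density alpha theta f) /\
    {ae P, forall omega,
       ((truncation_point (stick_remainder (fun j => V j omega)) eps)%:R - 1) /
         (eps * T omega / alpha) `^ (- (alpha / (1 - alpha)))
       @[eps --> 0^'+] --> (1 : R)}.
Proof.
pose Y := diversity alpha V.
have mY : measurable_fun setT Y by exact: measurable_diversity.
have Y0 w : 0 <= Y w by exact: diversity_ge0.
have Yq := expectation_diversity alpha_gt0 alpha_lt1 theta_gt V_indep V_beta.
have mT : measurable_fun setT (fun w => Y w `^ (- alpha^-1)).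
  exact: (measurableT_comp (@measurable_powR R _)).
pose T : {RV P >-> R} := HB.pack (fun w => Y w `^ (- alpha^-1))
  (isMeasurableFun.Build _ _ _ _ _ mT).
exists T; split.
  exact: (inverse_power_density alpha_gt0 alpha_lt1 theta_gt f_stable mY Y0 Yq).
have Ypos := ae_moments_gt0 alpha_gt0 alpha_lt1 theta_gt f_stable mY Y0 Yq.
have Ycvg := cvg_diversity alpha_gt0 alpha_lt1 theta_gt V_indep V_beta.
move: (ae_sticks V_beta) Ypos Ycvg; apply: filterS3 => w Vw Yw Ycvg.
pose r := stick_remainder (fun j => V j w).
have r0 n : 0 < r n by exact: stick_remainder_gt0.
have b0 : 0 < 1 - alpha by rewrite subr_gt0.
under eq_fun do rewrite -mulrA.
apply: cvg_truncation_point => //.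
- by move=> n; exact: stick_remainderS_le.
- by rewrite divr_gt0// powR_gt0.
- by rewrite divr_gt0.
rewrite -(cvg_shiftS (fun n => n%:R * (r n * (T w / alpha)) `^ (alpha / (1 - alpha)))).
have -> : (fun n => n.+1%:R * (r n.+1 * (T w / alpha)) `^ (alpha / (1 - alpha))) =
    (fun n => (diversity_scale alpha n.+1 * stick_power alpha V n.+1 w / Y w) `^ (1 - alpha)^-1).
  apply/funext => n; rewrite stick_power_remainder//.
  by apply: scaled_remainderE => //; exact: ltW.
have ratio1 : diversity_scale alpha n.+1 * stick_power alpha V n.+1 w / Y w @[n --> \oo] --> (1 : R).
  rewrite -(mulfV (lt0r_neq0 Yw)); apply: cvgM => //; exact: cvg_cst.
have one : (1 : R) `^ (1 - alpha)^-1 = 1 by rewrite powR1.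
have := cvg_comp _ _ ratio1 (@powR_continuous R (1 - alpha)^-1 1 ltr01).
by rewrite one => H; apply: cvg_trans H.
Qed.
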